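(* Let $\alpha\in\,]0,1[$ and let $\Omega\subset\mathbb R^N$ be a bounded domain of class $C^{4,\alpha}$. For $\sigma\in[0,1[$ let $\lambda_1(\sigma)\leq\lambda_2(\sigma)\leq\cdots\leq\lambda_j(\sigma)\leq\cdots$ be the eigenvalues, repeated according to multiplicity, of the Neumann problem for the biharmonic operator with Poisson's ratio $\sigma$ in $\Omega$ (as defined in the context). Then, for all $j\in\mathbb N$, $$\lim_{\sigma\rightarrow 1^-}\lambda_j(\sigma)=0.$$ Moreover, the function $\lambda_j$ from $[0,1]$ to $\mathbb R$ which maps $\sigma\in[0,1[$ to $\lambda_j(\sigma)$, and is extended at $\sigma=1$ by setting $\lambda_j(1)=0$, is Lipschitz continuous on $[0,1]$.
   Context: A domain is a connected open set, and $\mathbb N=\{1,2,\dots\}$. $H^2(\Omega)$ is the standard real Sobolev space, $D^2u$ is the Hessian matrix of $u$, and $D^2u:D^2\varphi=\sum_{i,j=1}^N\frac{\partial^2u}{\partial x_i\partial x_j}\frac{\partial^2\varphi}{\partial x_i\partial x_j}$. For $\sigma\in[0,1[$, the Neumann eigenvalue problem with Poisson's ratio $\sigma$ is $$\Delta^2u=\lambda u\ \text{in }\Omega,\qquad (1-\sigma)\frac{\partial^2u}{\partial\nu^2}+\sigma\Delta u=0\ \text{on }\partial\Omega,\qquad \frac{\partial\Delta u}{\partial\nu}+(1-\sigma)\mathrm{div}_{\partial\Omega}(D^2u\cdot\nu)_{\partial\Omega}=0\ \text{on }\partial\Omega,$$ where $\nu$ is the outer unit normal to $\partial\Omega$, $F_{\partial\Omega}$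 is the projection of a vector field $F$ onto the tangent space to $\partial\Omega$, and $\mathrm{div}_{\partial\Omega}F=\mathrm{div}F_{|\partial\Omega}-(DF\cdot\nu)\cdot\nu$ is the tangential divergence. It is understood in weak form: $\lambda\in\mathbb R$ is an eigenvalue if there is $u\in H^2(\Omega)$, $u\neq0$ (an eigenfunction), such that $$\int_{\Omega}\left((1-\sigma)D^2u:D^2\varphi+\sigma\Delta u\,\Delta\varphi\right) dx=\lambda\int_{\Omega}u\varphi\, dx\quad\text{for all }\varphi\in H^2(\Omega).$$ For each $\sigma\in[0,1[$ the eigenvalues are non-negative, have finite multiplicity, and form a sequence diverging to $+\infty$: $0=\lambda_1(\sigma)=\cdots=\lambda_{N+1}(\sigma)<\lambda_{N+2}(\sigma)\leq\cdots\leq\lambda_j(\sigma)\leq\cdots$.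
   Formalization: The dimension is assumed to be N ≥ 2: for N = 1 the quadratic form is the integral of u''φ'' for every σ, so λ_3(σ) is a positive constant and the claimed limit 0 fails on every bounded interval. *)

(* Defs.v *)
From HB Require Import structures.
From mathcomp Require Import all_boot all_order all_algebra.
From mathcomp Require Import all_classical all_reals all_analysis.
Import Order.TTheory GRing.Theory Num.Theory.
Import numFieldNormedType.Exports.
Set Implicit Arguments.
Unset Strict Implicit.
Unset Printing Implicit Defensive.
Local Open Scope classical_set_scope.
Local Open Scope ring_scope.

(** Lebesgue measure on R^N = 'rV[R]_N; the sigma-algebra is the product one,
    i.e. the Borel sigma-algebra. *)

Section measurable_rV.
Context {R : realType} (n : nat).

Let coors : 'I_n -> 'rV[R]_n -> measurableTypeR R := fun i x => x 0 i.

Let rV_set0 : g_sigma_preimage coors set0.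
Proof. exact: sigma_algebra0. Qed.

Let rV_setC A : g_sigma_preimage coors A -> g_sigma_preimage coors (~` A).
Proof. exact: sigma_algebraC. Qed.

Let rV_bigcup (F : _^nat) : (forall i, g_sigma_preimage coors (F i)) ->
  g_sigma_preimage coors (\bigcup_i (F i)).
Proof. exact: sigma_algebra_bigcup. Qed.

HB.instance Definition _ := @isMeasurable.Build default_measure_display
  'rV[R]_n (g_sigma_preimage coors) rV_set0 rV_setC rV_bigcup.

Lemma measurable_coord (i : 'I_n) :
  measurable_fun [set: 'rV[R]_n] (fun x : 'rV[R]_n => x 0 i : measurableTypeR R).
Proof.
move=> _ Y mY; rewrite setTI; apply: sub_sigma_algebra => /=.
rewrite -bigcup_seq/=; exists i => /=; first by rewrite mem_index_enum.
by exists Y => //; rewrite setTI.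
Qed.

Lemma measurable_fun_rV d (T : measurableType d) (f : T -> 'rV[R]_n) :
  (forall i, measurable_fun setT (fun t => f t 0 i : measurableTypeR R)) ->
  measurable_fun setT f.
Proof.
move=> mf _ A mA; rewrite setTI.
suff: measurable `<=` [set B : set 'rV[R]_n | measurable (f @^-1` B)].
  by move/(_ _ mA).
apply: smallest_sub.
- split => /=.
  + by rewrite preimage_set0.
  + by move=> B mB; rewrite setTD preimage_setC; exact: measurableC.
  + by move=> F mF; rewrite preimage_bigcup; exact: bigcup_measurable.
- rewrite -bigcup_seq; apply: bigcup_sub => i _ B [C mC <-] /=.
  by have := mf i measurableT C mC; rewrite !setTI.
Qed.

End measurable_rV.

Section lebesgue_rV.
Context {R : realType}.

Definition cons_rV (n : nat) (p : 'rV[R]_n * measurableTypeR R) : 'rV[R]_n.+1 :=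
  row_mx (const_mx p.2 : 'rV_1) p.1.

Lemma cons_rV0 n (p : 'rV[R]_n * measurableTypeR R) :
  cons_rV p ord0 ord0 = p.2.
Proof.
rewrite /cons_rV (_ : (ord0 : 'I_n.+1) = @lshift 1 n ord0); last exact/val_inj.
by apply: (etrans (row_mxEl _ _ _ _)); rewrite mxE.
Qed.

Lemma cons_rVS n (p : 'rV[R]_n * measurableTypeR R) (j : 'I_n) :
  cons_rV p ord0 (lift ord0 j) = p.1 ord0 j.
Proof.
rewrite /cons_rV (_ : lift ord0 j = @rshift 1 n j); last exact/val_inj.
exact: row_mxEr.
Qed.

Lemma measurable_cons_rV n : measurable_fun [set: _] (@cons_rV n).
Proof.
apply: measurable_fun_rV => i.
rewrite (_ : (fun t => _) = fun t : 'rV[R]_n * measurableTypeR R =>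
    if @fintype.split 1 n i is inr k then t.1 0 k else t.2); last first.
  by apply/funext => t; rewrite mxE; case: fintype.split => // a; rewrite mxE.
case: fintype.split => [_|k]; first exact: measurable_snd.
apply: (measurableT_comp (measurable_coord k)).
exact: measurable_fst.
Qed.

Fixpoint lebesgue_rV (n : nat) : {measure set 'rV[R]_n -> \bar R} :=
  match n with
  | 0 => dirac (0 : 'rV[R]_0)
  | m.+1 =>
    measure_function_pushforward__canonical__measure_function_Measure
      (lebesgue_rV m \x (@lebesgue_measure R))%E (@measurable_cons_rV m)
  end.

Lemma measurable_box n (A : 'I_n -> set (measurableTypeR R)) :
  (forall i, measurable (A i)) ->
  measurable [set x : 'rV[R]_n | forall i, A i (x 0 i)].
Proof.
move=> mA; rewrite (_ : mkset _ =
    \big[setI/setT]_(i < n) ((fun x : 'rV[R]_n => x 0 i) @^-1` A i)); last first.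
  rewrite -bigcap_seq; apply/seteqP; split=> x /= h i; first by move=> _; exact: h.
  by apply: h; rewrite /= mem_index_enum.
apply: bigsetI_measurable => i _.
by have := measurable_coord i measurableT (mA i); rewrite setTI.
Qed.

Lemma lebesgue_rV_box n (A : 'I_n -> set (measurableTypeR R)) :
  (forall i, measurable (A i)) ->
  (lebesgue_rV n [set x | forall i, A i (x ord0 i)] =
   \prod_(i < n) lebesgue_measure (A i))%E.
Proof.
elim: n A => [|n IH] A mA.
  by rewrite big_ord0 /= diracE mem_set// => -[].
rewrite big_ord_recl /= /pushforward.
rewrite (_ : _ @^-1` _ = [set x : 'rV[R]_n | forall i, A (lift ord0 i) (x 0 i)]
    `*` A ord0); last first.
  apply/seteqP; split=> -[x t] /=.
    move=> h; split => [i|].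
      by have := h (lift ord0 i); rewrite cons_rVS.
    by have := h ord0; rewrite cons_rV0.
  move=> [hx ht] i; case: (unliftP ord0 i) => [j ->|->].
    by rewrite cons_rVS; exact: hx.
  by rewrite cons_rV0.
rewrite product_measure1E//; last exact: (measurable_box (A := fun i => A (lift ord0 i))).
by rewrite (IH (fun i => A (lift ord0 i)))// muleC.
Qed.

End lebesgue_rV.

(** The norm of 'rV[R]_N is the sup norm; being equivalent to the Euclidean
    one, it gives the same open, bounded and compact sets and the same Hoelder
    and C^{k,alpha} classes. *)

Section regularity.
Context {R : realType} {N : nat}.
Implicit Types (f : 'rV[R]_N -> R) (s : seq 'I_N) (k : nat).

Definition unit_rV (i : 'I_N) : 'rV[R]_N := delta_mx 0 i.

Definition pderivs s f : 'rV[R]_N -> R :=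
  foldr (fun i g => 'D_(unit_rV i) g) f s.

Definition class_C k f :=
  (forall s i x, (size s < k)%N -> derivable (pderivs s f) x (unit_rV i)) /\
  (forall s, (size s <= k)%N -> continuous (pderivs s f)).

Definition class_C_alpha k (alpha : R) f :=
  class_C k f /\
  forall s, size s = k -> exists C : R, forall x y,
    `|pderivs s f x - pderivs s f y| <= C * `|x - y| `^ alpha.

Definition test_function (Omega : set 'rV[R]_N) f :=
  [/\ forall k, class_C k f, compact (closure [set x | f x != 0])
    & closure [set x | f x != 0] `<=` Omega].

End regularity.

Section domains.
Context {R : realType} {N : nat}.
Implicit Type Omega : set 'rV[R]_N.

Definition domain Omega := open Omega /\ connected Omega.

(** Up to an isometry of R^N, Omega is near each of its boundary points the
    strict epigraph, in the direction of some coordinate axis, of a function of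
    class C^{k,alpha} of the other N - 1 coordinates. Since a local graph can be
    cut off, nothing changes by asking for a function defined on all of
    R^(N-1). *)
Definition domain_of_class k (alpha : R) Omega :=
  domain Omega /\
  forall x0, (closure Omega `\` Omega) x0 ->
    exists (r : R) (Q : 'M[R]_N) (i : 'I_N) (g : 'rV[R]_N.-1 -> R),
      [/\ 0 < r, Q *m Q^T = 1%:M, class_C_alpha k alpha g
        & forall x, ball x0 r x ->
            Omega x <-> g (col' i (x *m Q)) < (x *m Q) 0 i].

End domains.

Section sobolev.
Context {R : realType} {N : nat}.
Variable Omega : set 'rV[R]_N.
Implicit Types (u v g phi : 'rV[R]_N -> R) (s : seq 'I_N) (k : nat).

Definition L2 u :=
  measurable_fun Omega u /\
  (lebesgue_rV N).-integrable Omega (fun x => (u x ^+ 2)%:E).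

Definition ae_eq_on u v :=
  {ae lebesgue_rV N, forall x, Omega x -> u x = v x}.

Definition weak_deriv s u g :=
  forall phi, test_function Omega phi ->
    \int[lebesgue_rV N]_(x in Omega) (u x * pderivs s phi x) =
    (-1) ^+ size s * \int[lebesgue_rV N]_(x in Omega) (g x * phi x).

Definition sobolev k u :=
  L2 u /\
  forall s, (size s <= k)%N -> exists2 g, L2 g & weak_deriv s u g.

(** A representative of the weak derivative, which is unique almost
    everywhere. *)
Definition wderiv s u : 'rV[R]_N -> R :=
  xget (fun=> 0) [set g | L2 g /\ weak_deriv s u g].

Definition hessian u (x : 'rV[R]_N) : 'M[R]_N :=
  \matrix_(i, j) wderiv [:: i; j] u x.

Definition laplacian u (x : 'rV[R]_N) : R := \tr (hessian u x).

End sobolev.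

Section neumann.
Context {R : realType} {N : nat}.
Variables (Omega : set 'rV[R]_N) (sigma : R).
Implicit Types (u phi : 'rV[R]_N -> R) (lambda : R) (m : nat).

Definition frobenius (A B : 'M[R]_N) : R := \sum_i \sum_j A i j * B i j.

Definition neumann_form u phi : R :=
  \int[lebesgue_rV N]_(x in Omega)
    ((1 - sigma) * frobenius (hessian Omega u x) (hessian Omega phi x)
     + sigma * (laplacian Omega u x * laplacian Omega phi x)).

(** The eigenspace of lambda, the zero function included; H^2 functions are
    represented by actual functions, to be identified when equal almost
    everywhere on Omega. *)
Definition eigenspace lambda u :=
  sobolev Omega 2 u /\
  forall phi, sobolev Omega 2 phi ->
    neumann_form u phi =
    lambda * \int[lebesgue_rV N]_(x in Omega) (u x * phi x).

Definition eigenvalue lambda :=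
  exists2 u, eigenspace lambda u & ~ ae_eq_on Omega u (fun=> 0).

Definition multiplicity lambda m :=
  exists e : 'I_m -> 'rV[R]_N -> R,
    [/\ forall i, eigenspace lambda (e i),
        forall c : 'I_m -> R,
          ae_eq_on Omega (fun x => \sum_i c i * e i x) (fun=> 0) ->
          forall i, c i = 0
      & forall u, eigenspace lambda u -> exists c : 'I_m -> R,
          ae_eq_on Omega u (fun x => \sum_i c i * e i x)].

(** l 1 <= l 2 <= ... lists all the eigenvalues, each repeated as many times
    as its multiplicity; the value l 0 is irrelevant. *)
Definition eigenvalue_sequence (l : nat -> R) :=
  [/\ forall i j, (0 < i <= j)%N -> l i <= l j,
      forall j, (0 < j)%N -> eigenvalue (l j)
    & forall lambda, eigenvalue lambda -> exists2 m, multiplicity lambda m &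
        ([set j | (0 < j)%N /\ l j = lambda] #= `I_m)%card].

End neumann.

(* Main.v *)
(** By the min-max principle the eigenvalues are those of the form
    (1 - sigma) A + sigma L, with A u = |D^2 u|^2 and L u = |Delta u|^2, relatively to
    |u|^2. On the harmonic functions exp (k x_1) cos (k (x_2 - y_2)), which span a space
    of infinite dimension in H^2, L vanishes, so that
      lambda_j(sigma) <= C_j (1 - sigma).
    Let sigma <= tau < 1. As L <= N A, the form at sigma controls L up to a constant, and
    the form at tau is at most the form at sigma plus (tau - sigma) L; hence
    lambda_j(tau) <= lambda_j(sigma) + C (tau - sigma). In the other direction, the form at
    sigma is at most the form at tau plus (tau - sigma) A, and A is at most
    lambda_j(tau) / (1 - tau) <= C_j on the span of the first j eigenfunctions at tau.

    Minimizers exist because the embedding of H^2 in L^2 is compact. Compactness is used in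
    the form: for every e > 0 there are finitely many test functions psi such that
    |u|^2 <= e |D^2 u|^2 + C \sum_psi <u, psi>^2. This follows from a Poincare inequality
    on small pieces of the domain, based on the cone property of the boundary and on
    the bound of u(x + h) - u(x) in L^2 by |h| times the gradient. *)
Require Import Defs.
From HB Require Import structures.
From mathcomp Require Import all_boot all_order all_algebra.
From mathcomp Require Import all_classical all_reals all_analysis.
From mathcomp Require Import measurable_realfun ring lra.
Import Order.TTheory GRing.Theory Num.Theory.
Import numFieldNormedType.Exports.
Local Open Scope classical_set_scope.
Local Open Scope ring_scope.

Set Implicit Arguments.
Unset Strict Implicit.
Unset Printing Implicit Defensive.

(** * Lebesgue measure on R^N *)

Section rV_measure.
Context {R : realType} {N : nat}.
Local Notation rV := 'rV[R]_N.
Local Notation mu := (lebesgue_rV (R := R) N).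

(** The Sobolev space is given by weak derivatives alone, so the estimates are obtained by duality
    rather than by smooth approximation up to the boundary: a square-integrable function is bounded
    through its pairings with test functions, which are dense in [L^2], and translations are moved
    onto the test function. A translation by [h] is controlled only while the whole segment stays in
    [Omega]; this is what the cones provide.

    The form contains no first derivatives. They are recovered by applying the compactness
    inequality to each first derivative, whose pairing with [psi] is a pairing of [u] with a
    derivative of [psi].

    The list [lambda] is given, not constructed: eigenpairs are produced by successive minimization
    and then matched with [lambda] by comparing multiplicities. Functions equal almost everywhere
    are not identified; the spectral theory runs on a vector space where [b] may be degenerate, and
    independence and spanning are understood modulo its null vectors. The dimension enters through
    the harmonic functions, which use two distinct coordinates. *)

Lemma ball_rVE (x : rV) (e : R) : 0 < e ->
  ball x e = [set y | forall i, `|x 0 i - y 0 i| < e].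
Proof.
move=> e0; apply/seteqP; split => y /=.
  by move=> [_ h] i; exact: h.
by move=> h; split => // i j; rewrite (ord1 i); exact: h.
Qed.

Lemma ball_rV_box (x : rV) (e : R) : 0 < e ->
  ball x e = [set y | forall i, ball (x 0 i) e (y 0 i)].
Proof. by move=> e0; rewrite ball_rVE. Qed.

Lemma coord_le_norm (x : rV) i : `|x 0 i| <= `|x|.
Proof.
rewrite [leRHS](mx_normrE x).
exact: (le_bigmax _ (fun ij : 'I_1 * 'I_N => `|x ij.1 ij.2|) (0, i)).
Qed.

Lemma norm_rV_le (x : rV) c : 0 <= c -> (forall i, `|x 0 i| <= c) -> `|x| <= c.
Proof.
move=> c0 h; rewrite [leLHS](mx_normrE x); apply/bigmax_leP; split => // -[i j] _ /=.
by rewrite (ord1 i).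
Qed.

Lemma bigcup_countable_measurable d (T : measurableType d) (I : countType)
    (P : set I) (F : I -> set T) :
  (forall i, P i -> measurable (F i)) -> measurable (\bigcup_(i in P) F i).
Proof.
move=> mF.
pose G n := if unpickle n is Some i then (if `[< P i >] then F i else set0)
  else set0.
rewrite (_ : \bigcup_(i in P) F i = \bigcup_n G n).
  apply: bigcupT_measurable => n; rewrite /G.
  by case: unpickle => // i; case: asboolP => // /mF.
apply/seteqP; split => x.
  by move=> [i Pi Fi]; exists (pickle i) => //; rewrite /G pickleK asboolT.
by move=> [n _]; rewrite /G; case: unpickle => // i; case: asboolP => // Pi Fi; exists i.
Qed.

Lemma ball_rV_measurable (x : rV) (e : R) : measurable (ball x e).
Proof.
have [e0|e0] := ltP 0 e.
  rewrite ball_rV_box//.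
  apply: (measurable_box (A := fun i => ball (x 0 i) e)) => i.
  by rewrite ball_itv; exact: measurable_itv.
rewrite (_ : ball x e = set0) ?measurable0//.
by apply/seteqP; split => // y [] /(le_lt_trans e0); rewrite ltxx.
Qed.

(** There are only countably many such cubes. It is the closed cube that is placed in [U], so that a
    bump living on it is a test function of [U]. *)
Lemma open_rat_ball (U : set rV) (x : rV) : open U -> U x ->
  exists (q : 'rV[rat]_N) (n : nat),
    ball (map_mx (@ratr R) q : rV) (n.+1%:R^-1 : R) x /\
    [set y : rV | `|(map_mx (@ratr R) q : rV) - y| <= n.+1%:R^-1] `<=` U.
Proof.
move=> oU Ux.
have /nbhs_ballP[e /= e0 eU] : nbhs x U by exact: open_nbhs_nbhs.
have [n ne] : exists n : nat, 2 * n.+1%:R^-1 < e.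
  have e20 : (0 : R) < e / 2 by rewrite divr_gt0.
  have [n _ h] := near_infty_natSinv_lt (PosNum e20).
  by exists n; move: (h n (leqnn n)); rewrite /= ltr_pdivlMr// mulrC.
set d := n.+1%:R^-1 : R.
have d0 : 0 < d by rewrite invr_gt0.
have : forall i, exists q : rat, `|ratr q - x 0 i| < d.
  move=> i.
  have /rat_in_itvoo[q qP] : x 0 i - d < x 0 i + d by rewrite ltrD2l gt0_cp.
  by exists q; rewrite ltr_distl; move: qP; rewrite in_itv.
move=> /choice[q qP].
have xq : ball (map_mx (@ratr R) (\row_i q i) : rV) d x.
  by rewrite ball_rVE// => i; rewrite /= !mxE; exact: qP.
exists (\row_i q i), n; split => // y /= dy; apply: eU => /=.
rewrite -ball_normE /=; move: xq; rewrite -ball_normE /= => xq.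
apply: le_lt_trans (ler_distD (map_mx (@ratr R) (\row_i q i)) _ _) _.
by apply: lt_trans ne; rewrite mulr_natl mulr2n ltr_leD// distrC.
Qed.

(** The sigma-algebra is generated by the coordinates; an open set is reached as a countable union
    of rational cubes. *)
Lemma open_rV_measurable (U : set rV) : open U -> measurable U.
Proof.
move=> oU.
pose I := ('rV[rat]_N * nat)%type.
pose F (p : I) : set rV :=
  ball (map_mx (@ratr R) p.1 : rV) (p.2.+1%:R^-1 : R).
rewrite (_ : U = \bigcup_(p in [set p | F p `<=` U]) F p).
  by apply: bigcup_countable_measurable => p _; exact: ball_rV_measurable.
apply/seteqP; split => [x Ux|x [p] + Fx]; last exact.
have [q [n [xq qU]]] := open_rat_ball oU Ux.
exists (q, n) => //= y qy; apply: qU => /=.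
by move: qy; rewrite /F /= -ball_normE /= => /ltW.
Qed.

Lemma continuous_rV_measurable (f : rV -> R) : continuous f ->
  measurable_fun setT f.
Proof.
move=> /continuousP cf; apply: (measurability _ (RGenOpens.measurableE R)).
move=> _ [_ [a [b ->] <-]]; rewrite setTI; apply: open_rV_measurable.
exact/cf/interval_open.
Qed.

Lemma measurable_shift (h : rV) : measurable_fun setT (fun x : rV => x + h).
Proof.
apply: measurable_fun_rV => i.
rewrite (_ : (fun _ => _) = (fun x : rV => x 0 i + h 0 i)); last first.
  by apply/funext => x; rewrite mxE.
by apply: measurable_funD => //; exact: measurable_coord.
Qed.

Lemma lebesgue_rV_ball (x : rV) (e : R) : 0 < e ->
  mu (ball x e) = ((2 * e) ^+ N)%:E.
Proof.
move=> e0; rewrite ball_rV_box//.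
rewrite (lebesgue_rV_box (A := fun i => ball (x 0 i) e)); last first.
  by move=> i; rewrite ball_itv; exact: measurable_itv.
rewrite (eq_bigr (fun=> (2 * e)%:E)); last first.
  by move=> i _; rewrite lebesgue_measure_ball 1?ltW// mulr_natl.
by rewrite prodEFin prodr_const card_ord.
Qed.

Lemma bounded_rV_ball (A : set rV) : bounded_set A ->
  exists2 r, 0 < r & A `<=` ball 0 r.
Proof.
move=> [M [Mr hM]]; exists (`|M| + 2); first by rewrite ltr_wpDl.
move=> x Ax; rewrite -ball_normE /ball_ /= sub0r normrN.
apply: (@le_lt_trans _ _ (`|M| + 1)); last by rewrite ltrD2l ltr1n.
by apply: hM => //; rewrite ltr_pwDr// ler_norm.
Qed.

Lemma lebesgue_rV_bounded (A : set rV) : measurable A -> bounded_set A ->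
  (mu A < +oo)%E.
Proof.
move=> mA /bounded_rV_ball[r r0 Ar].
apply: (@le_lt_trans _ _ (mu (ball 0 r))); last by rewrite lebesgue_rV_ball// ltry.
by apply: le_measure; rewrite ?inE//; exact: ball_rV_measurable.
Qed.

Lemma lebesgue_rV_open_gt0 (U : set rV) (x : rV) : open U -> U x -> (0 < mu U)%E.
Proof.
move=> oU Ux; have /nbhs_ballP[e /= e0 eU] : nbhs x U by exact: open_nbhs_nbhs.
apply: (@lt_le_trans _ _ (mu (ball x e))).
  by rewrite lebesgue_rV_ball// lte_fin exprn_gt0// mulr_gt0.
by apply: le_measure; rewrite ?inE//; [exact: ball_rV_measurable|exact: open_rV_measurable].
Qed.

Definition boxes : set (set rV) :=
  [set A : set rV | exists B : 'I_N -> set (measurableTypeR R),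
    (forall i, measurable (B i)) /\ A = [set x : rV | forall i, B i (x 0 i)]].

Lemma boxes_setI : setI_closed boxes.
Proof.
move=> _ _ [B [mB ->]] [C [mC ->]]; exists (fun i => B i `&` C i); split.
  by move=> i; exact: measurableI.
apply/seteqP; split => x /= => [[h1 h2] i|h]; first by split.
by split => i; have [] := h i.
Qed.

Lemma measurable_boxesE : @measurable _ rV = <<s boxes >>.
Proof.
apply/seteqP; split.
  apply: smallest_sub; first exact: smallest_sigma_algebra.
  rewrite -bigcup_seq; apply: bigcup_sub => i _ _ [C mC <-]; rewrite setTI.
  apply: sub_sigma_algebra; exists (fun j => if j == i then C else setT); split.
    by move=> j; case: ifP.
  apply/seteqP; split => x /= => [Cx j|/(_ i)]; last by rewrite eqxx.
  by case: eqP => [->|].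
apply: smallest_sub; first exact: sigma_algebra_measurable.
by move=> _ [B [mB ->]]; exact: measurable_box.
Qed.

Definition cube (n : nat) : set rV := [set x | forall i, `](- n%:R), n%:R[%classic (x 0 i)].

Lemma cube_boxes n : boxes (cube n).
Proof. by exists (fun=> `](- n%:R), n%:R[%classic); split. Qed.

Lemma cube_cover : \bigcup_n cube n = setT.
Proof.
apply/seteqP; split => // x _.
exists (Num.bound `|x|).+1 => // i; rewrite /= in_itv /= -ltr_norml.
apply: le_lt_trans (coord_le_norm x i) _.
apply: lt_le_trans (archi_boundP (normr_ge0 _)) _.
by rewrite ler_nat.
Qed.

Lemma cube_lty n : (mu (cube n) < +oo)%E.
Proof.
rewrite (lebesgue_rV_box (A := fun=> `](- n%:R), n%:R[%classic))//.
rewrite (eq_bigr (fun=> (n%:R + n%:R)%:E)); last first.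
  move=> i _; rewrite lebesgue_measure_itv/= lte_fin.
  case: n => [|n]; first by rewrite mulr0n oppr0 ltxx addr0.
  by rewrite gtrN// -EFinB opprK.
by rewrite prodEFin ltry.
Qed.

(** Boxes form a pi-system generating the sigma-algebra and the space is exhausted by cubes of
    finite measure. Translation invariance follows by checking boxes, hence intervals. *)
Lemma lebesgue_rV_unique (m1 m2 : {measure set rV -> \bar R}) :
  (forall A, boxes A -> m1 A = mu A) -> (forall A, boxes A -> m2 A = mu A) ->
  forall A, measurable A -> m1 A = m2 A.
Proof.
move=> h1 h2 A mA; apply: (@measure_unique _ R _ boxes cube measurable_boxesE
  boxes_setI cube_boxes cube_cover m1 m2) => //.
  by move=> B bB; rewrite h1// h2.
by move=> k; rewrite h1; [exact: cube_lty|exact: cube_boxes].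
Qed.

Let measurable_shift1 (c : R) :
  measurable_fun setT (fun t : measurableTypeR R => t + c : measurableTypeR R).
Proof. exact: measurable_funD. Qed.

Lemma lebesgue_measure_shift (c : R) (A : set (measurableTypeR R)) :
  measurable A -> lebesgue_measure ((fun t => t + c) @^-1` A) = lebesgue_measure A.
Proof.
move=> mA.
pose m1 : {measure set (measurableTypeR R) -> \bar R} :=
  measure_function_pushforward__canonical__measure_function_Measure
    lebesgue_measure (measurable_shift1 c).
apply/esym; apply: (@lebesgue_measure_unique R m1) => // _ [[a b] _ <-].
rewrite /m1 /= /pushforward.
rewrite (_ : _ @^-1` _ = `]a - c, b - c]%classic); last first.
  by apply/seteqP; split => x /=; rewrite !in_itv /= ltrBlDr lerBrDr.
rewrite !lebesgue_measure_itv /= !lte_fin ltrD2r.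
by case: ifP => // _; rewrite -!EFinB opprB addrA subrK.
Qed.

Lemma lebesgue_rV_shift (h : rV) (A : set rV) : measurable A ->
  pushforward mu (fun x => x + h) A = mu A.
Proof.
move=> mA.
pose m1 : {measure set rV -> \bar R} :=
  measure_function_pushforward__canonical__measure_function_Measure mu
    (measurable_shift h).
have -> : pushforward mu (fun x => x + h) A = m1 A by [].
apply: (@lebesgue_rV_unique m1 mu) => // {mA}A [B [mB ->]].
rewrite /m1 /= /pushforward.
have -> : (fun x : rV => x + h) @^-1` [set x : rV | forall i, B i (x 0 i)] =
    [set x : rV | forall i, ((fun t => t + h 0 i) @^-1` B i) (x 0 i)].
  by apply/seteqP; split => x /= H i; have := H i; rewrite mxE.
rewrite (lebesgue_rV_box mB).
rewrite (lebesgue_rV_box (A := fun i => (fun t => t + h 0 i) @^-1` B i)); last first.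
  by move=> i; rewrite -[X in measurable X]setTI; exact: measurable_shift1.
apply: eq_bigr => i _.
exact: lebesgue_measure_shift.
Qed.

End rV_measure.

Section rV_shift.
Context {R : realType} {N : nat}.
Local Notation rV := 'rV[R]_N.
Local Notation mu := (lebesgue_rV (R := R) N).

Lemma lebesgue_rV_sigma_finite : sigma_finite setT mu.
Proof.
exists cube; first by rewrite cube_cover.
move=> n; split; last exact: cube_lty.
by rewrite measurable_boxesE; apply: sub_sigma_algebra; exact: cube_boxes.
Qed.

(* An unbundled copy of [mu]: instances cannot be attached to the bundled measure. *)
Definition leb_rV : set rV -> \bar R := mu.

HB.instance Definition _ := isMeasure.Build _ _ _ leb_rV (measure0 mu)
  (measure_ge0 mu) (@measure_semi_sigma_additive _ _ _ mu).

HB.instance Definition _ := Measure_isSigmaFinite.Build _ _ _ leb_rV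
  lebesgue_rV_sigma_finite.

Lemma tonelli_rV (f : rV * rV -> \bar R) : measurable_fun setT f ->
  (forall z, 0 <= f z)%E ->
  (\int[mu]_x \int[mu]_y f (x, y) = \int[mu]_y \int[mu]_x f (x, y))%E.
Proof. by move=> mf f0; exact: (@fubini_tonelli _ _ _ _ _ leb_rV leb_rV). Qed.

Lemma integral_rV_shift (h : rV) (f : rV -> \bar R) : measurable_fun setT f ->
  (\int[mu]_x f (x + h)%R = \int[mu]_x f x)%E.
Proof.
move=> mf.
have H (g : rV -> \bar R) : measurable_fun setT g -> (forall x, 0 <= g x)%E ->
    (\int[mu]_x g (x + h)%R = \int[mu]_x g x)%E.
  move=> mg g0.
  rewrite -[RHS](@eq_measure_integral _ _ _ _ mu (measure_function_pushforward__canonical__measure_function_Measure mu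
    (measurable_shift h))).
    rewrite (ge0_integral_pushforward (measurable_shift h))//.
  by move=> A mA _; exact: lebesgue_rV_shift.
rewrite integralE [RHS]integralE; congr (_ - _)%E.
  rewrite -[RHS]H; last by move=> x; exact: funepos_ge0.
    by apply: eq_integral => x _; rewrite !funeposE.
  exact: measurable_funepos.
rewrite -[RHS]H; last by move=> x; exact: funeneg_ge0.
  by apply: eq_integral => x _; rewrite !funenegE.
exact: measurable_funeneg.
Qed.

Lemma integrable_rV_shift (h : rV) (f : rV -> \bar R) :
  mu.-integrable setT f -> mu.-integrable setT (fun x => f (x + h)).
Proof.
move=> /integrableP[mf fi]; apply/integrableP; split.
  by apply: measurableT_comp => //; exact: measurable_shift.
by rewrite (@integral_rV_shift h (fun x => `|f x|%E))//; exact: measurableT_comp.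
Qed.

Lemma Rintegral_rV_shift (h : rV) (f : rV -> R) : measurable_fun setT f ->
  \int[mu]_x f (x + h) = \int[mu]_x f x.
Proof.
move=> mf; congr fine; apply: (@integral_rV_shift h (EFin \o f)).
exact/measurable_EFinP.
Qed.

End rV_shift.

(** * Square-integrable functions *)

Section square_integrable.
Context d (T : measurableType d) (R : realType) (mu : {measure set T -> \bar R}).
Variable D : set T.
Hypothesis mD : measurable D.
Implicit Types f g : T -> R.

(** For [D := Omega] this unfolds to [L2]. The general domain lets the same facts serve on [Omega]
    and on the whole space. *)
Definition sqint f :=
  measurable_fun D f /\ mu.-integrable D (fun x => (f x ^+ 2)%:E).

Definition ip f g : R := \int[mu]_(x in D) (f x * g x).

Lemma ip_integrable f g : sqint f -> sqint g ->
  mu.-integrable D (EFin \o (fun x => f x * g x)).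
Proof.
move=> [mf f2] [mg g2].
apply: (le_integrable mD _ _ (integrableD mD f2 g2)).
  by apply/measurable_EFinP; exact: measurable_funM.
move=> x Dx /=; rewrite ?abse_EFin lee_fin.
rewrite [leRHS]ger0_norm ?addr_ge0 ?sqr_ge0// ler_norml.
have := sqr_ge0 (f x + g x); have := sqr_ge0 (f x - g x).
rewrite sqrrB sqrrD => h1 h2; apply/andP; nra.
Qed.

Lemma sqint0 : sqint (fun=> 0).
Proof.
split; first exact: measurable_cst.
under eq_fun do rewrite expr0n /=; exact: integrable0.
Qed.

Lemma sqintZ c f : sqint f -> sqint (fun x => c * f x).
Proof.
move=> [mf f2]; split; first by apply: measurable_funM.
rewrite (_ : (fun _ => _) = (fun x => (c ^+ 2)%:E * (f x ^+ 2)%:E)%E).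
  exact: integrableZl.
by apply/funext => x; rewrite exprMn EFinM.
Qed.

Lemma sqintD f g : sqint f -> sqint g -> sqint (fun x => f x + g x).
Proof.
move=> hf hg; have [mf f2] := hf; have [mg g2] := hg.
split; first exact: measurable_funD.
have fg := ip_integrable hf hg.
have := integrableD mD (integrableD mD f2 g2) (integrableZl mD 2 fg).
apply: eq_integrable => // x Dx /=.
transitivity ((f x ^+ 2 + g x ^+ 2 + 2 * (f x * g x))%:E) => //.
by congr EFin; ring.
Qed.

Lemma sqintN f : sqint f -> sqint (fun x => - f x).
Proof.
move=> /(sqintZ (-1)); rewrite (_ : (fun _ => _) = (fun x => - f x))//.
by apply/funext => x; rewrite mulN1r.
Qed.

Lemma sqintB f g : sqint f -> sqint g -> sqint (fun x => f x - g x).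
Proof. by move=> hf /sqintN; exact: sqintD. Qed.

Lemma sqint_sum I (r : seq I) (P : pred I) (F : I -> T -> R) :
  (forall i, sqint (F i)) -> sqint (fun x => \sum_(i <- r | P i) F i x).
Proof.
move=> h; elim: r => [|i r IH].
  by under eq_fun do rewrite big_nil; exact: sqint0.
under eq_fun do rewrite big_cons.
by case: (P i) => //; exact: sqintD.
Qed.

Lemma ipC f g : ip f g = ip g f.
Proof. by rewrite /ip; apply: eq_Rintegral => x _; rewrite mulrC. Qed.

Lemma ipZl c f g : sqint f -> sqint g -> ip (fun x => c * f x) g = c * ip f g.
Proof.
move=> hf hg; rewrite /ip -RintegralZl//; last exact: ip_integrable.
by apply: eq_Rintegral => x _; rewrite mulrA.
Qed.

Lemma ipDl f g h : sqint f -> sqint g -> sqint h ->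
  ip (fun x => f x + g x) h = ip f h + ip g h.
Proof.
move=> hf hg hh; rewrite /ip -RintegralD//; try exact: ip_integrable.
by apply: eq_Rintegral => x _; rewrite mulrDl.
Qed.

Lemma ipBl f g h : sqint f -> sqint g -> sqint h ->
  ip (fun x => f x - g x) h = ip f h - ip g h.
Proof.
move=> hf hg hh; rewrite /ip -RintegralB//; try exact: ip_integrable.
by apply: eq_Rintegral => x _; rewrite mulrBl.
Qed.

Lemma ip_ge0 f : 0 <= ip f f.
Proof. by apply: Rintegral_ge0 => x _; rewrite -expr2 sqr_ge0. Qed.

Lemma ipE f : sqint f -> (ip f f)%:E = (\int[mu]_(x in D) (f x ^+ 2)%:E)%E.
Proof.
move=> hf; rewrite /ip /Rintegral fineK//.
by apply: integrable_fin_num => //; exact: ip_integrable.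
Qed.

Lemma ip_sqrD f g : sqint f -> sqint g ->
  ip (fun x => f x + g x) (fun x => f x + g x) = ip f f + 2 * ip f g + ip g g.
Proof.
move=> hf hg; have hfg := sqintD hf hg.
rewrite ipDl// (ipC f) (ipC g) !ipDl// (ipC g f); ring.
Qed.

(* The quadratic t |-> ip (f + t g) (f + t g) is nonnegative. *)
Lemma ip_CS f g : sqint f -> sqint g -> ip f g ^+ 2 <= ip f f * ip g g.
Proof.
move=> hf hg.
have H t : 0 <= ip f f + 2 * t * ip f g + t ^+ 2 * ip g g.
  have := ip_ge0 (fun x => f x + t * g x).
  have htg := sqintZ t hg.
  have e1 : ip f (fun x => t * g x) = t * ip f g by rewrite ipC ipZl// ipC.
  have e2 : ip (fun x => t * g x) (fun x => t * g x) = t ^+ 2 * ip g g.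
    by rewrite ipZl// ipC ipZl// mulrA -expr2.
  by rewrite ip_sqrD// e1 e2 mulrA.
have [g0|g0] := eqVneq (ip g g) 0.
  have [fg0|fg0] := eqVneq (ip f g) 0; first by rewrite fg0 g0 expr0n mulr0.
  (* When [ip g g = 0] the quadratic is affine in [t], and at this point its value is [-1]. *)
  have := H (- (ip f f + 1) / (2 * ip f g)).
  rewrite g0 mulr0 addr0.
  have -> : 2 * (- (ip f f + 1) / (2 * ip f g)) * ip f g = - (ip f f + 1).
    by field; rewrite fg0.
  by rewrite opprD addrA subrr sub0r ler0N1.
have gp : 0 < ip g g by rewrite lt_neqAle eq_sym g0 ip_ge0.
have := H (- ip f g / ip g g).
have -> : ip f f + 2 * (- ip f g / ip g g) * ip f g + (- ip f g / ip g g) ^+ 2 * ip g g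
  = (ip f f * ip g g - ip f g ^+ 2) / ip g g by field.
by rewrite pmulr_lge0 ?invr_gt0// subr_ge0.
Qed.

Definition nrm f := Num.sqrt (ip f f).

Lemma nrm_ge0 f : 0 <= nrm f. Proof. exact: sqrtr_ge0. Qed.

Lemma sqr_nrm f : nrm f ^+ 2 = ip f f.
Proof. by rewrite sqr_sqrtr// ip_ge0. Qed.

Lemma ip_le_nrm f g : sqint f -> sqint g -> `|ip f g| <= nrm f * nrm g.
Proof.
move=> hf hg; rewrite -sqrtrM ?ip_ge0// -sqrtr_sqr ler_sqrt ?mulr_ge0 ?ip_ge0//.
exact: ip_CS.
Qed.

Lemma nrmD f g : sqint f -> sqint g -> nrm (fun x => f x + g x) <= nrm f + nrm g.
Proof.
move=> hf hg; rewrite -(@ler_pXn2r _ 2)// ?nnegrE ?addr_ge0 ?nrm_ge0//.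
rewrite sqr_nrm ip_sqrD// sqrrD !sqr_nrm lerD2r lerD2l -[leRHS]mulr_natl ler_pM2l//.
by apply: le_trans (ip_le_nrm hf hg); exact: ler_norm.
Qed.

Lemma ip_eq0 f : sqint f -> ip f f = 0 -> {ae mu, forall x, D x -> f x = 0}.
Proof.
move=> hf f0; have [mf f2] := hf.
have : (\int[mu]_(x in D) `|(f x ^+ 2)%:E|)%E = 0.
  under eq_integral do rewrite gee0_abs ?lee_fin ?sqr_ge0//.
  by rewrite -ipE// f0.
have [mf2 _] := integrableP _ _ _ f2.
move=> /(ae_eq_integral_abs mu mD mf2); apply: filterS => x h Dx.
by have := h Dx => -[] /eqP; rewrite sqrf_eq0 => /eqP.
Qed.

Lemma eq_ae_ip f f' g : measurable_fun D f -> measurable_fun D f' ->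
  measurable_fun D g -> {ae mu, forall x, D x -> f x = f' x} -> ip f g = ip f' g.
Proof.
move=> mf mf' mg ff'; congr fine; apply: ae_eq_integral => //.
- by apply/measurable_EFinP; exact: measurable_funM.
- by apply/measurable_EFinP; exact: measurable_funM.
by apply: filterS ff' => x /[apply] ->.
Qed.

End square_integrable.

(** * Completeness of [L^2] *)

Section riesz_fischer.
Context d (T : measurableType d) (R : realType) (mu : {measure set T -> \bar R}).
Variable D : set T.
Hypothesis mD : measurable D.

Lemma cvg_of_geometric_steps (w : R^nat) (C : R) :
  (forall k, `|w k.+1 - w k| <= C * 2^-1 ^+ k) -> cvgn w.
Proof.
move=> h.
have ca : cvgn (series (fun k => w k.+1 - w k)).
  apply: normed_cvg; apply: (@series_le_cvg _ _ (geometric C 2^-1)).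
  - by move=> n; exact: normr_ge0.
  - by move=> n; apply: le_trans (h n); exact: normr_ge0.
  - exact: h.
  - by apply: is_cvg_geometric_series; rewrite ger0_norm// invf_lt1// ltr1n.
have -> : w = cst (w 0%N) \+ series (fun k => w k.+1 - w k).
  apply/funext => n /=; rewrite /series /= telescope_sumr//.
  by rewrite addrC subrK.
by apply: is_cvgD => //; exact: is_cvg_cst.
Qed.

(** The Riesz-Fischer theorem: a rapidly converging subsequence has an almost everywhere limit, and
    Fatou's lemma along it, with [n] fixed, turns the Cauchy bound into a bound on the distance to
    the limit. *)
Lemma sqint_complete (u : nat -> T -> R) :
  (forall n, sqint mu D (u n)) ->
  (forall e, 0 < e -> exists n0, forall m n, (n0 <= m)%N -> (n0 <= n)%N ->
    ip mu D (fun x => u m x - u n x) (fun x => u m x - u n x) <= e) ->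
  exists2 f, sqint mu D f & forall e, 0 < e -> exists n0, forall n, (n0 <= n)%N ->
    ip mu D (fun x => u n x - f x) (fun x => u n x - f x) <= e.
Proof.
move=> hu uC.
have /choice[N0 N0P] : forall k, exists n0, forall m n, (n0 <= m)%N -> (n0 <= n)%N ->
    ip mu D (fun x => u m x - u n x) (fun x => u m x - u n x) <= 8^-1 ^+ k.
  by move=> k; apply: uC; rewrite exprn_gt0.
(* The sum puts [s k] above [N0 k] and makes it nondecreasing; the summand [k] makes it
   unbounded. *)
pose s k := (\sum_(i < k.+1) N0 i + k)%N.
have sN0 k : (N0 k <= s k)%N.
  by rewrite /s big_ord_recr /= -addnA addnCA leq_addr.
have ss k : (s k <= s k.+1)%N.
  by rewrite /s [in leqRHS]big_ord_recr /= addnS -addnA ltnW// ltnS leq_add2l leq_addl.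
have sk k : (k <= s k)%N by rewrite leq_addl.
pose a k x := u (s k.+1) x - u (s k) x.
have ha k : sqint mu D (a k) by exact: sqintB.
have ia k : ip mu D (a k) (a k) <= 8^-1 ^+ k.
  by apply: N0P; [exact: leq_trans (ss k)|].
(* The weight [4 ^+ k] against squared norms [8^-1 ^+ k] leaves a sum with integral at most [2].
   Wherever [G] is finite, the step [a k x] is at most [2^-1 ^+ k] times the square root of
   [G x]. *)
pose g k x := (4 ^+ k * a k x ^+ 2)%:E.
pose G x := (\sum_(0 <= k <oo) g k x)%E.
have g0 k x : (0 <= g k x)%E.
  by rewrite lee_fin; apply: mulr_ge0; [exact: exprn_ge0|exact: sqr_ge0].
have mg k : measurable_fun D (g k).
  apply/measurable_EFinP; apply: measurable_funM => //.
  by apply: measurable_funX; have [] := ha k.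
have mG : measurable_fun D G by apply: ge0_emeasurable_sum => // k x Dx _.
have iG : (\int[mu]_(x in D) G x < +oo)%E.
  rewrite integral_nneseries//.
  apply: (@le_lt_trans _ _ 2%:E); last exact: ltry.
  have cv2 := cvg_geometric_eseries_half (R := R) (r := 2) (n := 0%N).
  rewrite (_ : 2%:E = limn (eseries (fun k : nat => (2 / (2 ^ (k + 1))%:R)%:E : \bar R))).
    apply: lee_nneseries; [move=> k _ _|move=> k _].
      by apply: integral_ge0.
    rewrite /g; under eq_integral do rewrite EFinM.
    rewrite ge0_integralZl//; last 2 first.
      by apply/measurable_EFinP/measurable_funX; have [] := ha k.
      by move=> x _; rewrite lee_fin sqr_ge0.
    rewrite -ipE// -EFinM lee_fin.
    apply: (@le_trans _ _ (4 ^+ k * 8^-1 ^+ k)).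
      by rewrite ler_pM2l// exprn_gt0.
    rewrite -exprMn addn1 expnS natrM invfM mulrA divff// mul1r natrX -exprVn.
    by rewrite (_ : 4 * 8^-1 = 2^-1 :> R)//; field.
  by apply/esym/cvg_lim => //; move: cv2; rewrite expr0 divr1; exact.
have aeG : {ae mu, forall x, D x -> G x \is a fin_num}.
  apply: integrable_ae => //; apply/integrableP; split => //.
  by under eq_integral do rewrite gee0_abs ?nneseries_ge0//.
pose E := D `&` [set x | G x \is a fin_num].
have mE : measurable E by exact: emeasurable_fin_num.
have cvE x : E x -> cvgn (fun k => u (s k) x).
  move=> [Dx Gx]; apply: (@cvg_of_geometric_steps _ (Num.sqrt (fine (G x)))) => k.
  have gG : 4 ^+ k * a k x ^+ 2 <= fine (G x).
    rewrite -lee_fin fineK//.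
    apply: le_trans (nneseries_lim_ge k.+1 (fun k _ _ => g0 k x)).
    by rewrite big_nat_recr//= leeDr// sume_ge0.
  have -> : `|u (s k.+1) x - u (s k) x| = Num.sqrt (4 ^+ k * a k x ^+ 2) * 2^-1 ^+ k.
    rewrite (_ : 4 = 2 ^+ 2 :> R); last by rewrite -natrX.
    rewrite exprAC -exprMn sqrtr_sqr normrM (ger0_norm (exprn_ge0 _ _))//.
    by rewrite exprVn mulrAC divff ?mul1r// expf_neq0.
  by rewrite ler_pM2r ?exprn_gt0// ler_wsqrtr.
(* Cut off to [E], the subsequence converges at every point, to [0] off [E], so its limit is
   measurable. *)
pose v k := u (s k) \_ E.
pose f x := limn (fun k => v k x).
have vE k x : E x -> v k x = u (s k) x by move=> Ex; rewrite /v patchE mem_set.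
have vf x : v k x @[k --> \oo] --> f x.
  have [Ex|Ex] := pselect (E x).
    have : cvgn (fun k => v k x).
      by rewrite (_ : (fun k => v k x) = fun k => u (s k) x); [exact: cvE|apply/funext => k; exact: vE].
    by [].
  have -> : f x = 0.
    rewrite /f (_ : (fun k => v k x) = cst 0) ?lim_cst//.
    by apply/funext => k; rewrite /v patchE memNset.
  rewrite (_ : (fun k => v k x) = cst 0); first exact: cvg_cst.
  by apply/funext => k; rewrite /v patchE memNset.
have mv k : measurable_fun D (v k).
  apply/measurable_restrict => //.
  by apply: measurable_funS (proj1 (hu (s k))) => // x [].
have mf : measurable_fun D f by apply: (measurable_fun_cvg mv) => x _; exact: vf.
have key e n0 : 0 < e -> (forall m n, (n0 <= m)%N -> (n0 <= n)%N ->
    ip mu D (fun x => u m x - u n x) (fun x => u m x - u n x) <= e) ->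
    forall n, (n0 <= n)%N ->
    (\int[mu]_(x in D) ((u n x - f x) ^+ 2)%:E <= e%:E)%E.
  move=> e0 h n n0n.
  have mw k : measurable_fun D (fun x => ((u n x - v k x) ^+ 2)%:E).
    apply/measurable_EFinP/measurable_funX/measurable_funB => //.
    by have [] := hu n.
  have w0 k x : D x -> (0 <= ((u n x - v k x) ^+ 2)%:E)%E by rewrite lee_fin sqr_ge0.
  have := fatou mu mD mw w0.
  rewrite (_ : (\int[mu]_(x in D) _)%E = (\int[mu]_(x in D) ((u n x - f x) ^+ 2)%:E)%E); last first.
    apply: eq_integral => x _.
    suff /cvg_limn_einf_sup[-> //] :
      (((u n x - v k x) ^+ 2)%:E @[k --> \oo] --> ((u n x - f x) ^+ 2)%:E)%E by [].
    apply: cvg_EFin; first by near=> k.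
    by apply: cvgM; (apply: cvgB; [exact: cvg_cst|exact: vf]).
  move=> /le_trans; apply.
  rewrite limn_einf_lim; apply: lime_le; first exact: is_cvg_einfs.
  near=> k; apply: (@le_trans _ _ (\int[mu]_(x in D) ((u n x - v (maxn k n0) x) ^+ 2)%:E)%E).
    by apply: ereal_inf_lbound; exists (maxn k n0) => //=; exact: leq_maxl.
  rewrite (ae_eq_integral (fun x => ((u n x - u (s (maxn k n0)) x) ^+ 2)%:E))//; last 2 first.
    apply/measurable_EFinP/measurable_funX/measurable_funB; first by have [] := hu n.
    by have [] := hu (s (maxn k n0)).
    by apply: filterS aeG => x h' Dx; rewrite vE//; split => //; exact: h'.
  rewrite -ipE//; last by exact: sqintB.
  rewrite lee_fin; apply: h => //.
  by apply: leq_trans (sk _); exact: leq_maxr.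
have hf : sqint mu D f.
  have [n0 n0P] := uC 1 ltr01.
  have h1 := key 1 n0 ltr01 n0P n0 (leqnn _).
  have h2 : sqint mu D (fun x => u n0 x - f x).
    have mm : measurable_fun D (fun x => u n0 x - f x).
      by apply: measurable_funB => //; have [] := hu n0.
    split => //; apply/integrableP; split.
      by apply/measurable_EFinP/measurable_funX.
    under eq_integral do rewrite gee0_abs ?lee_fin ?sqr_ge0//.
    by apply: le_lt_trans h1 _; exact: ltry.
  have := sqintB mD (hu n0) h2.
  by rewrite (_ : (fun _ => _) = f)//; apply/funext => x; rewrite subKr.
exists f => // e e0; have [n0 n0P] := uC e e0; exists n0 => n n0n.
rewrite -lee_fin ipE//; last exact: sqintB.
exact: (key e n0).
Unshelve. all: by end_near.
Qed.

End riesz_fischer.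

(** * Smooth functions and test functions *)

Section smooth1.
Context {R : realType}.
Implicit Types (f g df : R -> R) (k : nat).

Fixpoint smooth1 k f := match k with
  | 0 => continuous f
  | k'.+1 => (forall x : R, derivable f x 1) /\ smooth1 k' (fun x => 'D_1 f x)
  end.

Lemma derivable_continuous1 f : (forall x : R, derivable f x 1) -> continuous f.
Proof. by move=> df x; apply/differentiable_continuous/derivable1_diffP. Qed.

Lemma smooth1_derive k f df : (forall x : R, is_derive x 1 f (df x)) ->
  smooth1 k df -> smooth1 k.+1 f.
Proof.
move=> hf sdf; split => [x|]; first by have [] := hf x.
by rewrite (_ : (fun x => 'D_1 f x) = df)//; apply/funext => x; have [] := hf x.
Qed.

Lemma smooth1_expR k : smooth1 k (@expR R).
Proof.
elim: k => [|k IH]; first exact: continuous_expR.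
exact: (smooth1_derive (df := expR)).
Qed.

Lemma smooth1_cos_sin k (c s : R) : smooth1 k (fun x => c * cos x + s * sin x).
Proof.
elim: k c s => [|k IH] c s.
  move=> x; apply: cvgD; apply: cvgM => //; try exact: cvg_cst.
    exact: continuous_cos.
  exact: continuous_sin.
apply: (smooth1_derive (df := fun x => s * cos x + - c * sin x)) => //.
move=> x; have := is_deriveD (is_deriveZ c (is_derive_cos x)) (is_deriveZ s (is_derive_sin x)).
by move=> /is_derive_eq; apply; rewrite /GRing.scale /=; ring.
Qed.

(** For [P = 1] this is the flat function [exp (-1/y)] extended by [0]. The polynomial factor in
    [1/y] makes the family stable under derivation. *)
Definition flat_poly (P : {poly R}) (y : R) : R :=
  if 0 < y then P.[y^-1] * expR (- y^-1) else 0.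

(** Coefficient by coefficient, from [z ^+ i / i! <= exp z] for positive [z]. *)
Lemma poly_expR_bound (P : {poly R}) :
  exists2 C, 0 <= C & forall z : R, 0 < z -> `|P.[z] * expR (- z)| <= C.
Proof.
elim/poly_ind: P => [|P c _]; first by exists 0 => // z _; rewrite horner0 mul0r normr0.
pose Q := P * 'X + c%:P.
exists (\sum_(i < size Q) `|Q`_i| * i`!%:R) => [|z z0].
  by apply: sumr_ge0 => i _; rewrite mulr_ge0.
rewrite -/Q horner_coef mulr_suml; apply: le_trans (ler_norm_sum _ _ _) _.
apply: ler_sum => i _; rewrite -mulrA normrM ler_wpM2l//.
rewrite ger0_norm; last by rewrite mulr_ge0 ?expR_ge0 ?exprn_ge0 1?ltW.
rewrite expRN ler_pdivrMr ?expR_gt0//.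
case: (nat_of_ord i) => [|n].
  by rewrite expr0 fact0 mul1r -expR0 ler_expR ltW.
rewrite -ler_pdivrMl ?ltr0n ?fact_gt0// mulrC.
by apply: le_trans (expR_ge1Dxn n (ltW z0)); rewrite lerDr.
Qed.

(** Boundedness for ['X^2 * P] instead of [P] gains the factor [y ^+ 2], which makes the derivative
    at [0] exist and vanish. *)
Lemma flat_poly_sqr_bound P :
  exists2 C, 0 <= C & forall y : R, `|flat_poly P y| <= C * y ^+ 2.
Proof.
have [C C0 hC] := poly_expR_bound ('X^2 * P).
exists C => // y; rewrite /flat_poly; case: ifPn => y0; last first.
  by rewrite normr0 mulr_ge0// sqr_ge0.
have := hC _ (eq_ind_r is_true y0 (invr_gt0 y)).
rewrite hornerM hornerXn exprVn -mulrA normrM.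
rewrite ger0_norm ?invr_ge0 ?sqr_ge0//.
by rewrite ler_pdivrMl ?exprn_gt0// (mulrC (y ^+ 2)).
Qed.

Lemma is_derive_flat_poly P (y : R) :
  is_derive y 1 (flat_poly P) (flat_poly ('X^2 * (P - P^`())) y).
Proof.
have [y0|y0|<-] := ltgtP 0 y.
- have yn0 : y != 0 by rewrite gt_eqF.
  have H : \forall z \near y, P.[z^-1] * expR (- z^-1) = flat_poly P z.
    near=> z; rewrite /flat_poly ifT//; near: z.
    exact: lt_nbhsr.
  apply: (near_eq_is_derive H).
  have d1 := is_deriveV yn0 (is_derive_id y (1 : R)).
  have dP : is_derive (y^-1) 1 (horner P) (P^`()).[y^-1].
    by apply: DeriveDef; [exact: derivable_horner|rewrite derivE derive1E].
  have d2 := is_derive1_comp dP d1.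
  have d3 := @is_derive1_comp R expR (fun z => - z^-1) y _ _
    (is_derive_expR (- y^-1)) (is_deriveN d1).
  have /is_derive_eq := is_deriveM d2 d3; apply.
  rewrite /flat_poly y0 /GRing.scale /= hornerM hornerXn hornerD hornerN exprVn.
  ring.
- have H : \forall z \near y, 0 = flat_poly P z.
    near=> z; rewrite /flat_poly ifF//; apply/negbTE; rewrite -leNgt ltW//.
    near: z; exact: lt_nbhsl.
  apply: (near_eq_is_derive H).
  have -> : flat_poly ('X^2 * (P - P^`())) y = 0 by rewrite /flat_poly ltNge ltW.
  exact: is_derive_cst.
have -> : flat_poly ('X^2 * (P - P^`())) 0 = 0 by rewrite /flat_poly ltxx.
have [C C0 hC] := flat_poly_sqr_bound P.
have H : h^-1 *: ((flat_poly P \o shift 0) (h *: (1 : R^o)) - flat_poly P 0) @[h --> 0^'] --> (0 : R^o).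
  apply/cvgrPdist_le => e e0; near=> h.
  have hn0 : h != 0 by near: h; exact: nbhs_dnbhs_neq.
  rewrite sub0r normrN /= /GRing.scale /= mulr1 addr0.
  rewrite {2}/flat_poly ltxx subr0 normrM normfV.
  rewrite ler_pdivrMl ?normr_gt0//; apply: le_trans (hC h) _.
  rewrite -real_normK ?num_real// expr2 mulrA mulrC ler_wpM2l//.
  have : `|h| <= e / (C + 1).
    near: h; apply: dnbhs0_le.
    by rewrite divr_gt0// ltr_wpDl.
  rewrite ler_pdivlMr ?ltr_wpDl// => /(le_trans _); apply.
  by rewrite mulrC ler_wpM2l// lerDl.
by apply: DeriveDef; [apply/cvg_ex; exists 0|exact/cvg_lim].
Unshelve. all: by end_near.
Qed.

Lemma smooth1_flat_poly k P : smooth1 k (flat_poly P).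
Proof.
elim: k P => [|k IH] P.
  by apply: derivable_continuous1 => x; have [] := is_derive_flat_poly P x.
exact: (smooth1_derive (is_derive_flat_poly P)).
Qed.

End smooth1.

(** * Partial and directional derivatives *)

Section partial_derivatives.
Context {R : realType} {N : nat}.
Local Notation rV := 'rV[R]_N.
Local Notation e_ i := (unit_rV (R := R) i).
Implicit Types (f g : rV -> R) (k : nat).

(** The derivative split off is the innermost one ([rcons]); this turns [class_C] into a recursion
    on [k] that induction can follow. *)
Lemma class_CS k f : class_C k.+1 f <->
  [/\ continuous f, forall i x, derivable f x (e_ i)
    & forall i, class_C k ('D_(e_ i) f)].
Proof.
split=> [[df cf]|[cf df Df]].
  split; [exact: (cf [::])|by move=> i x; exact: (df [::])|move=> i; split].
    by move=> s j x sk; have := df (rcons s i) j x; rewrite size_rcons /pderivs foldr_rcons; apply.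
  by move=> s sk; have := cf (rcons s i); rewrite size_rcons /pderivs foldr_rcons; apply.
split.
  move=> s; elim/last_ind: s => [|s i _] j x; first by move=> _; exact: df.
  by rewrite size_rcons ltnS /pderivs foldr_rcons; have [+ _] := Df i; exact.
move=> s; elim/last_ind: s => [|s i _]; first by move=> _; exact: cf.
by rewrite size_rcons ltnS /pderivs foldr_rcons; have [_ +] := Df i; exact.
Qed.

Lemma class_C0 f : class_C 0 f <-> continuous f.
Proof.
split=> [[_ /(_ [::])]|cf]; first exact.
by split => // s; rewrite leqn0 => /nilP ->.
Qed.

Lemma class_C_continuous k f : class_C k f -> continuous f.
Proof. by move=> [_ /(_ [::])]; exact. Qed.

Lemma class_C_S k f : class_C k.+1 f -> class_C k f.
Proof.
move=> [df cf]; split => [s i x sk|s sk]; first by apply: df; exact: ltnW.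
by apply: cf; exact: leqW.
Qed.

Lemma class_C_cst k (c : R) : class_C k (fun _ : rV => c).
Proof.
elim: k c => [|k IH] c; first by apply/class_C0; exact: cst_continuous.
apply/class_CS; split; [exact: cst_continuous|by move=> i x; exact: derivable_cst|].
move=> i; rewrite (_ : 'D_(e_ i) _ = fun=> 0)//.
by apply/funext => x; exact: derive_cst.
Qed.

Lemma class_C_D k f g : class_C k f -> class_C k g ->
  class_C k (fun x => f x + g x).
Proof.
elim: k f g => [|k IH] f g; first by move=> /class_C0 cf /class_C0 cg; apply/class_C0 => x;
  exact: (cvgD (cf x) (cg x)).
move=> /class_CS[cf df Df] /class_CS[cg dg Dg]; apply/class_CS; split.
- by move=> x; exact: (cvgD (cf x) (cg x)).
- by move=> i x; exact: derivableD.
move=> i; rewrite (_ : 'D_(e_ i) _ = fun x => 'D_(e_ i) f x + 'D_(e_ i) g x).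
  exact: IH.
by apply/funext => x; exact: deriveD.
Qed.

Lemma class_C_M k f g : class_C k f -> class_C k g ->
  class_C k (fun x => f x * g x).
Proof.
elim: k f g => [|k IH] f g; first by move=> /class_C0 cf /class_C0 cg; apply/class_C0 => x;
  exact: (cvgM (cf x) (cg x)).
move=> hf hg; have /class_CS[cf df Df] := hf; have /class_CS[cg dg Dg] := hg.
apply/class_CS; split.
- by move=> x; exact: (cvgM (cf x) (cg x)).
- by move=> i x; exact: derivableM.
move=> i; rewrite (_ : 'D_(e_ i) _ = fun x => f x * 'D_(e_ i) g x + g x * 'D_(e_ i) f x).
  by apply: class_C_D; apply: IH => //; exact: class_C_S.
by apply/funext => x; exact: deriveM.
Qed.

Lemma class_C_prod k I (r : seq I) (P : pred I) (F : I -> rV -> R) :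
  (forall i, class_C k (F i)) -> class_C k (fun x => \prod_(i <- r | P i) F i x).
Proof.
move=> h; elim: r => [|i r IH].
  by under eq_fun do rewrite big_nil; exact: class_C_cst.
under eq_fun do rewrite big_cons.
by case: (P i) => //; exact: class_C_M.
Qed.

Lemma class_C_Z k c f : class_C k f -> class_C k (fun x => c * f x).
Proof. by move=> hf; apply: class_C_M => //; exact: class_C_cst. Qed.

(** The two difference quotients coincide: moving [x] by [h *: v] moves the argument of [g] by
    [h * (c * v 0 i)]. *)
Lemma is_derive_comp_coord (g : R -> R) (c d : R) (i : 'I_N) (x v : rV) :
  derivable g (c * x 0 i + d) 1 ->
  is_derive x v (fun x => g (c * x 0 i + d)) (c * v 0 i * 'D_1 g (c * x 0 i + d)).
Proof.
move=> dg; have /derivable1_diffP dfg := dg.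
have E : (fun h : R => h^-1 *: (((fun x => g (c * x 0 i + d)) \o shift x) (h *: v) - g (c * x 0 i + d)))
   = (fun h : R => h^-1 *: ((g \o shift (c * x 0 i + d)) (h *: (c * v 0 i)) - g (c * x 0 i + d))).
  apply/funext => h /=; congr (_ *: (g _ - _)); rewrite !mxE /GRing.scale /=; ring.
apply: DeriveDef.
  by rewrite /derivable E; exact: (diff_derivable (v := c * v 0 i)).
rewrite {1}/derive E -/(derive g _ _) !deriveE//.
by rewrite -[X in 'd g _ X]mulr1 -/(_ *: _) linearZ.
Qed.

Lemma class_C_comp_coord k (g : R -> R) (c d : R) (i : 'I_N) :
  smooth1 k g -> class_C k (fun x => g (c * x 0 i + d)).
Proof.
have cl : continuous (fun x : rV => c * x 0 i + d).
  move=> x.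
  exact: (cvgD (cvgM (cvg_cst c) (@coord_continuous R 1 N 0 i x)) (cvg_cst d)).
elim: k g => [|k IH] g.
  by move=> cg; apply/class_C0 => x; apply: continuous_comp; [exact: cl|exact: cg].
move=> [dg sg]; apply/class_CS; split.
- by move=> x; apply: continuous_comp; [exact: cl|exact: derivable_continuous1].
- by move=> j x; have [] := is_derive_comp_coord (e_ j) (dg (c * x 0 i + d)).
move=> j; rewrite (_ : 'D_(e_ j) _ = fun x => c * e_ j 0 i * 'D_1 g (c * x 0 i + d)).
  by apply: class_C_Z; exact: (IH (fun x => 'D_1 g x)).
by apply/funext => x; have [] := is_derive_comp_coord (e_ j) (dg (c * x 0 i + d)).
Qed.

Lemma derive_line f (y v : rV) (t : R) :
  (derivable (fun t : R => f (y + t *: v)) t 1 = derivable f (y + t *: v) v) *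
  ('D_1 (fun t : R => f (y + t *: v)) t = 'D_v f (y + t *: v)).
Proof.
have E : (fun h : R => h^-1 *: (((fun t : R => f (y + t *: v)) \o shift t) (h *: (1 : R^o)) - f (y + t *: v))) =
    (fun h : R => h^-1 *: ((f \o shift (y + t *: v)) (h *: v) - f (y + t *: v))).
  apply/funext => h /=; congr (_ *: (f _ - _)).
  have -> : h *: (1 : R^o) = h by exact: mulr1.
  by rewrite scalerDl addrCA.
by split; rewrite ?/derivable ?/derive E.
Qed.

Lemma mean_value_line f (y v : rV) (r : R) : (forall x, derivable f x v) ->
  exists2 c, `|c| <= `|r| & f (y + r *: v) - f y = r * 'D_v f (y + c *: v).
Proof.
move=> df; pose F t := f (y + t *: v).
have dF (t : R) : is_derive t 1 F ('D_v f (y + t *: v)).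
  by apply: DeriveDef; rewrite derive_line.
have cF (A : set R) : {within A, continuous F}.
  by apply: continuous_subspaceT; apply: derivable_continuous1 => t; have [] := dF t.
have [r0|r0] := leP 0 r.
  have [c] := MVT_segment r0 (fun x _ => dF x) (cF _).
  rewrite in_itv /= => /andP[c0 cr]; rewrite subr0 /F scale0r addr0 => ->.
  by exists c; [rewrite !ger0_norm|rewrite mulrC].
have [c] := MVT_segment (ltW r0) (fun x _ => dF x) (cF _).
rewrite in_itv /= => /andP[c0 cr]; rewrite sub0r /F scale0r addr0 => E.
exists c; first by rewrite !ler0_norm ?lerN2// ltW.
by rewrite -opprB E mulrN opprK mulrC.
Qed.

(* Move from [x] to [x + v] one coordinate at a time. *)
Lemma mean_value f (x v : rV) : (forall i y, derivable f y (e_ i)) ->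
  exists2 xi : 'I_N -> rV, forall i, `|xi i - x| <= `|v| &
    f (x + v) - f x = \sum_i v 0 i * 'D_(e_ i) f (xi i).
Proof.
move=> df.
pose w (k : nat) : rV := \row_i (if (i < k)%N then v 0 i else 0).
have wS (i : 'I_N) : w i.+1 = w i + v 0 i *: e_ i.
  apply/rowP => j; rewrite !mxE eqxx /= ltnS leq_eqVlt.
  have [->|ji] := eqVneq j i; first by rewrite eqxx ltnn /= add0r mulr1.
  by rewrite -(inj_eq val_inj) in ji; rewrite (negbTE ji) /= mulr0 addr0.
have /choice[xi xiP] : forall i : 'I_N, exists y, `|y - x| <= `|v| /\
    f (x + w i.+1) - f (x + w i) = v 0 i * 'D_(e_ i) f y.
  move=> i; have [c cv E] := mean_value_line (x + w i) (v 0 i) (df i).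
  exists (x + w i + c *: e_ i); split; last by rewrite wS addrA.
  have -> : x + w i + c *: e_ i - x = w i + c *: e_ i.
    by rewrite -(addrA x) (addrAC x) subrr add0r.
  apply: norm_rV_le => // j.
  rewrite !mxE eqxx /=.
  have [->|ji] := eqVneq j i.
    by rewrite ltnn mulr1 add0r (le_trans cv)// coord_le_norm.
  by rewrite mulr0 addr0; case: ifP => _; rewrite ?normr0// coord_le_norm.
exists xi; first by move=> i; have [] := xiP i.
under eq_bigr do rewrite -(xiP _).2.
rewrite -(big_mkord xpredT (fun i => f (x + w i.+1) - f (x + w i))).
rewrite telescope_sumr//; congr (f (x + _) - f _).
  by apply/rowP => i; rewrite mxE ltn_ord.
by apply/rowP => i; rewrite !mxE addr0.
Qed.

(** By [mean_value] for the increment [h *: v], the difference quotient is a combination of partial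
    derivatives at points tending to [x], where these derivatives are continuous. *)
Lemma derive_directional f (x v : rV) : class_C 1 f ->
  is_derive x v f (\sum_i v 0 i * 'D_(e_ i) f x).
Proof.
move=> /class_CS[cf df Df].
have cD i : continuous ('D_(e_ i) f) by apply/class_C0; exact: Df.
have H : h^-1 *: ((f \o shift x) (h *: v) - f x) @[h --> 0^'] -->
    (\sum_i v 0 i * 'D_(e_ i) f x : R^o).
  apply/cvgrPdist_le => e e0.
  have V0 : 0 < \sum_i `|v 0 i| + 1 by rewrite ltr_wpDl// sumr_ge0.
  have e'0 : 0 < e / (\sum_i `|v 0 i| + 1) by rewrite divr_gt0.
  have nb : \forall y \near x, forall i, `|'D_(e_ i) f x - 'D_(e_ i) f y| <= e / (\sum_i `|v 0 i| + 1).
    have nbi i : \forall y \near x, `|'D_(e_ i) f x - 'D_(e_ i) f y| <= e / (\sum_i `|v 0 i| + 1).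
      by have /cvgrPdist_le := cD i x; apply.
    exact: (filter_forall _ nbi).
  have /nbhs_ballP[d /= d0 dP] := nb.
  near=> h.
  have hn0 : h != 0 by near: h; exact: nbhs_dnbhs_neq.
  have hd : `|h| < d / (`|v| + 1).
    by near: h; apply: dnbhs0_lt; rewrite divr_gt0// ltr_wpDl.
  have [xi xiP E] := mean_value x (h *: v) df.
  rewrite /= (addrC _ x) E /GRing.scale /=.
  have -> : h^-1 * \sum_i (h *: v) 0 i * 'D_(e_ i) f (xi i) = \sum_i v 0 i * 'D_(e_ i) f (xi i).
    rewrite mulr_sumr; apply: eq_bigr => i _.
    by rewrite mxE !mulrA mulVf// mul1r.
  rewrite -sumrB; apply: le_trans (ler_norm_sum _ _ _) _.
  apply: (@le_trans _ _ (\sum_i `|v 0 i| * (e / (\sum_i `|v 0 i| + 1)))).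
    apply: ler_sum => i _; rewrite -mulrBr normrM ler_wpM2l//.
    apply: dP => /=; rewrite -ball_normE /= distrC.
    apply: le_lt_trans (xiP i) _; rewrite normrZ.
    move: hd; rewrite ltr_pdivlMr ?ltr_wpDl// => /(le_lt_trans _); apply.
    by rewrite ler_wpM2l// lerDl.
  rewrite -mulr_suml mulrA ler_pdivrMr// mulrC ler_wpM2l// ?lerDl// ltW//.
by apply: DeriveDef; [apply/cvg_ex; eexists; exact: H|exact/cvg_lim].
Unshelve. all: by end_near.
Qed.

End partial_derivatives.

(** * Integrals against compactly supported functions *)

Section compact_support.
Context {R : realType} {N : nat}.
Local Notation rV := 'rV[R]_N.
Local Notation mu := (lebesgue_rV (R := R) N).
Local Notation e_ i := (unit_rV (R := R) i).
Implicit Types (f g phi psi u : rV -> R) (k : nat).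

Definition zero_off (A : set rV) f := forall x, ~ A x -> f x = 0.

Lemma ball0_bounded r : bounded_set (ball (0 : rV) r).
Proof.
exists `|r|; split; first by rewrite num_real.
move=> y ry x; rewrite -ball_normE /= sub0r normrN => xr.
by apply: ltW; apply: lt_trans xr _; apply: le_lt_trans ry; exact: ler_norm.
Qed.

Lemma norm_le_compact r : compact [set x : rV | `|x| <= r].
Proof.
apply: bounded_closed_compact.
  exists `|r|; split; first by rewrite num_real.
  move=> y ry x /= xr; apply: le_trans xr _; rewrite ltW//.
  by apply: le_lt_trans ry; exact: ler_norm.
apply: (@closed_comp _ _ (fun x : rV => `|x|) [set t | t <= r]).
  by move=> x _; exact: norm_continuous.
exact: closed_le.
Qed.

Lemma zero_off_bounded f r : continuous f -> zero_off (ball 0 r) f ->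
  exists2 M : R, 0 <= M & forall x, `|f x| <= M.
Proof.
move=> cf f0.
have := @continuous_compact _ _ f _ (continuous_subspaceT cf) (@norm_le_compact r).
move=> /compact_bounded[M [_ hM]].
exists (`|M| + 1) => [|x]; first by rewrite addr_ge0.
have [rx|rx] := pselect (ball 0 r x); last by rewrite f0// normr0 addr_ge0.
apply: hM; first by rewrite (le_lt_trans (ler_norm M))// ltrDl.
by exists x => //=; move: rx; rewrite -ball_normE /= sub0r normrN => /ltW.
Qed.

(** The radius grows by [1] so that a point off the larger ball has a whole neighbourhood off the
    smaller one. *)
Lemma zero_off_derive f r i : zero_off (ball 0 r) f -> zero_off (ball 0 (r + 1)) ('D_(e_ i) f).
Proof.
move=> f0 x xr; have -> : 'D_(e_ i) f x = 'D_(e_ i) (fun=> 0 : R) x.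
  apply: near_eq_derive; near=> y; apply: f0 => ry; apply: xr.
  apply: (ball_triangle ry); near: y.
  have := @nbhsx_ballx R rV x 1 ltr01; apply: filterS => y; exact: ball_sym.
by rewrite derive_cst.
Unshelve. all: by end_near.
Qed.

Lemma zero_off_integrable f r : measurable_fun setT f -> 
  zero_off (ball 0 r) f -> (exists M, forall x, `|f x| <= M) ->
  mu.-integrable setT (EFin \o f).
Proof.
move=> mf f0 [M fM].
have mB := @ball_rV_measurable R N 0 r.
have -> : EFin \o f = (EFin \o f) \_ (ball 0 r).
  apply/funext => x; rewrite patchE; case: ifPn => // /negP xr /=.
  by rewrite f0// => rx; apply: xr; rewrite inE.
apply/(integrable_mkcond _ mB).
apply: measurable_bounded_integrable => //.
- by apply: lebesgue_rV_bounded => //; exact: ball0_bounded.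
- exact: measurable_funTS.
exists `|M|; split; first by rewrite num_real.
move=> y My x _; apply: le_trans (fM x) _; rewrite ltW//.
by apply: le_lt_trans My; exact: ler_norm.
Qed.

(** Covers constants, continuous functions, and extensions by zero of square-integrable functions,
    the three kinds of factor that are integrated against a compactly supported function. *)
Definition loc_integrable u :=
  measurable_fun setT u /\ forall r, mu.-integrable (ball 0 r) (EFin \o u).

Lemma loc_integrable_mul u psi r : loc_integrable u -> continuous psi ->
  zero_off (ball 0 r) psi -> mu.-integrable setT (EFin \o (fun x => u x * psi x)).
Proof.
move=> [mu_ iu] cpsi psi0.
have [M M0 psiM] := zero_off_bounded cpsi psi0.
have mB := @ball_rV_measurable R N 0 r.
have mup : measurable_fun setT (fun x => u x * psi x).
  by apply: measurable_funM => //; exact: continuous_rV_measurable.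
have -> : EFin \o (fun x => u x * psi x) = (EFin \o (fun x => u x * psi x)) \_ (ball 0 r).
  apply/funext => x; rewrite patchE; case: ifPn => // /negP xr /=.
  by rewrite psi0 ?mulr0// => rx; apply: xr; rewrite inE.
apply/(integrable_mkcond _ mB).
apply: (le_integrable mB (g := fun x => (M%:E * (u x)%:E)%E)).
- by apply/measurable_EFinP; exact: measurable_funTS.
- move=> x _ /=; rewrite lee_fin !normrM mulrC ler_wpM2r//.
  by rewrite (ger0_norm M0).
by apply: integrableZl => //; exact: iu.
Qed.

Definition dirD (h : rV) psi : rV -> R := fun x => \sum_i h 0 i * 'D_(e_ i) psi x.

Lemma class_C_sum k I (r : seq I) (P : pred I) (F : I -> rV -> R) :
  (forall i, class_C k (F i)) -> class_C k (fun x => \sum_(i <- r | P i) F i x).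
Proof.
move=> h; elim: r => [|i r IH].
  by under eq_fun do rewrite big_nil; exact: class_C_cst.
under eq_fun do rewrite big_cons.
by case: (P i) => //; exact: class_C_D.
Qed.

Lemma dirD_class_C k h psi : class_C k.+1 psi -> class_C k (dirD h psi).
Proof.
by move=> /class_CS[_ _ D]; apply: class_C_sum => i; exact: class_C_Z.
Qed.

Lemma dirD_zero_off h psi r : zero_off (ball 0 r) psi -> zero_off (ball 0 (r + 1)) (dirD h psi).
Proof.
move=> psi0 x xr; rewrite /dirD big1// => i _.
by rewrite (zero_off_derive i psi0)// mulr0.
Qed.

Lemma shift_continuous f (h : rV) : continuous f -> continuous (fun x : rV => f (x + h)).
Proof.
move=> cf x; apply: (continuous_comp (f := fun x : rV => x + h)); last exact: cf.
exact: (cvgD cvg_id (cvg_cst h)).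
Qed.

Lemma shift_zero_off f (h : rV) r r' : r + `|h| <= r' -> zero_off (ball 0 r) f ->
  zero_off (ball 0 r') (fun x : rV => f (x + h)).
Proof.
move=> rr' f0 x xr'; apply: f0; rewrite -ball_normE /= sub0r normrN => xh.
apply: xr'; rewrite -ball_normE /= sub0r normrN; apply: lt_le_trans rr'.
rewrite -(addrK h x); apply: le_lt_trans (ler_normB _ _) _.
by rewrite ltrD2r.
Qed.

(** Differentiation under the integral sign; all the smoothness is carried by [psi]. Both
    integration by parts and the estimate of differences of [u] rest on this formula. *)
Lemma is_derive_shift_integral u psi r (h : rV) (s0 : R) :
  loc_integrable u -> class_C 1 psi -> zero_off (ball 0 r) psi ->
  is_derive s0 1 (fun s : R => \int[mu]_x (u x * psi (x + s *: h)))
    (\int[mu]_x (u x * dirD h psi (x + s0 *: h))).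
Proof.
move=> lu cpsi psi0.
have cp := class_C_continuous cpsi.
have cD : continuous (dirD h psi) by apply/class_C0/dirD_class_C.
have D0 := dirD_zero_off h psi0.
have [M M0 hM] := zero_off_bounded cD D0.
pose f (s : R) x := u x * psi (x + s *: h).
(* For [s] within [1] of [s0], the shifted derivatives of [psi] all vanish off this one ball, so [G]
   dominates uniformly in [s]. *)
pose r' := r + 1 + (`|s0| + 1) * `|h|.
pose G x := M * (`|u x| * \1_(ball 0 r') x).
have cs (s : R) (g : rV -> R) : continuous g -> continuous (fun x : rV => g (x + s *: h)).
  by move=> cg; exact: shift_continuous.
have sr' (s : R) : s \in `]s0 - 1, s0 + 1[ -> r + 1 + `|s *: h| <= r'.
  rewrite in_itv /= => /andP[s1 s2]; rewrite lerD2l normrZ ler_wpM2r//.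
  have := ler_normD s0 (s - s0); rewrite addrC subrK => /le_trans; apply.
  by rewrite lerD2l ler_norml; apply/andP; split; lra.
have [mu_ iu] := lu.
have G0 x : 0 <= G x by rewrite !mulr_ge0// indicE.
have iG : mu.-integrable setT (EFin \o G).
  have mB := @ball_rV_measurable R N 0 r'.
  have := integrableZl measurableT M (proj1 (integrable_mkcond _ mB) (integrable_abse (iu r'))).
  apply: eq_integrable => // x _; rewrite patchE /G /= indicE.
  case: ifPn => _ /=; first by rewrite mulr1 EFinM.
  by rewrite !mulr0; exact: mule0.
have If (s : R) : mu.-integrable setT (EFin \o f s).
  apply: (@loc_integrable_mul u (fun x : rV => psi (x + s *: h)) (r + `|s *: h|)) => //.
    exact: cs.
  exact: shift_zero_off psi0.
have df (s : R) (y : rV) : is_derive s 1 (f ^~ y) (u y * dirD h psi (y + s *: h)).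
  have dl := derive_line psi y h s.
  have [d1 d2] := derive_directional (y + s *: h) h cpsi.
  have dpsi : is_derive s 1 (fun s : R => psi (y + s *: h)) (dirD h psi (y + s *: h)).
    by apply: DeriveDef; rewrite dl.
  exact: (is_deriveZ (u y) dpsi).
have Is : `]s0 - 1, s0 + 1[%classic s0 by rewrite /= in_itv /= gtrBl ltrDl ltr01.
have ub (s : R) (y : rV) : `]s0 - 1, s0 + 1[%classic s -> setT y -> `|partial1of2 f s y| <= G y.
  move=> sI _; rewrite partial1of2E; have [_ ->] := df s y.
  rewrite normrM /G mulrCA ler_wpM2l// indicE.
  have [yB|yB] := boolP (y \in (ball (0 : rV) r' : set rV)); first by rewrite mulr1.
  rewrite mulr0 (@shift_zero_off _ _ _ r' _ D0) ?normr0//; first exact: sr'.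
  by move=> yb; move/negP: yB; apply; rewrite inE.
have dI (s : R) (y : rV) : `]s0 - 1, s0 + 1[%classic s -> setT y -> derivable (f ^~ y) s 1.
  by move=> _ _; have [] := df s y.
apply: DeriveDef.
  exact: (derivable_under_integral measurableT Is (fun s _ => If s) dI G0 iG ub).
rewrite -derive1E.
rewrite (differentiation_under_integral measurableT Is (fun s _ => If s) dI G0 iG ub).
apply: eq_Rintegral => x _; rewrite partial1of2E.
by have [] := df s0 x.
Qed.

(* The integral of x |-> psi (x + s e_i) does not depend on s. *)
Lemma integral_derive0 psi r i : class_C 1 psi -> zero_off (ball 0 r) psi ->
  \int[mu]_x 'D_(e_ i) psi x = 0.
Proof.
move=> cpsi psi0.
have l1 : loc_integrable (fun=> 1 : R).
  split => // r'; apply: measurable_bounded_integrable => //.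
  - exact: ball_rV_measurable.
  - by apply: lebesgue_rV_bounded; [exact: ball_rV_measurable|exact: ball0_bounded].
  by exists 1; split => // y y1 x _ /=; rewrite normr1 ltW.
have [_] := is_derive_shift_integral (e_ i) 0 l1 cpsi psi0.
rewrite (_ : (fun s : R => _) = cst (\int[mu]_x psi x)); last first.
  apply/funext => s /=; rewrite -[RHS](Rintegral_rV_shift (s *: e_ i)).
    by apply: eq_Rintegral => x _; rewrite mul1r.
  by apply: continuous_rV_measurable; exact: class_C_continuous cpsi.
rewrite derive_cst => /esym; rewrite -[RHS]/(0) => <-.
apply: eq_Rintegral => x _; rewrite mul1r scale0r addr0 /dirD (bigD1 i)//=.
rewrite big1 ?addr0 => [|j ji]; first by rewrite mxE !eqxx mul1r.
by rewrite mxE (negbTE ji) andbF mul0r.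
Qed.

Lemma integration_by_parts f psi r i : class_C 1 f -> class_C 1 psi ->
  zero_off (ball 0 r) psi ->
  \int[mu]_x (f x * 'D_(e_ i) psi x) = - \int[mu]_x ('D_(e_ i) f x * psi x).
Proof.
move=> cf cpsi psi0.
have /class_CS[f0 df Df] := cf; have /class_CS[p0 dp Dp] := cpsi.
have fp0 : zero_off (ball 0 r) (fun x => f x * psi x).
  by move=> x xr; rewrite psi0// mulr0.
have := integral_derive0 i (class_C_M cf cpsi) fp0.
have E x : 'D_(e_ i) (fun x => f x * psi x) x = f x * 'D_(e_ i) psi x + 'D_(e_ i) f x * psi x.
  have := @deriveM _ _ f psi x (e_ i) (df i x) (dp i x) => ->.
  by rewrite /GRing.scale /= [in X in _ + X]mulrC.
under eq_Rintegral do rewrite E.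
have lcont (g : rV -> R) : continuous g -> loc_integrable g.
  move=> cg; split; first exact: continuous_rV_measurable.
  move=> s; have mB := @ball_rV_measurable R N 0 s.
  apply: measurable_bounded_integrable => //.
  - by apply: lebesgue_rV_bounded => //; exact: ball0_bounded.
  - by apply: measurable_funTS; exact: continuous_rV_measurable.
  have := @continuous_compact _ _ g _ (continuous_subspaceT cg) (@norm_le_compact s).
  move=> /compact_bounded[M [Mr hM]]; exists M; split => // y My x xs; apply: hM My _ _.
  by exists x => //=; move: xs; rewrite -ball_normE /= sub0r normrN => /ltW.
rewrite RintegralD//.
- by move=> /eqP; rewrite addr_eq0 => /eqP.
- apply: (loc_integrable_mul (lcont _ f0) _ (zero_off_derive i psi0)).
  by apply/class_C0; exact: Dp.
- by apply: (loc_integrable_mul (lcont _ _) p0 psi0); apply/class_C0; exact: Df.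
Qed.

End compact_support.

(** * Test functions and bumps *)

Section test_functions.
Context {R : realType} {N : nat}.
Local Notation rV := 'rV[R]_N.
Local Notation mu := (lebesgue_rV (R := R) N).
Local Notation e_ i := (unit_rV (R := R) i).
Implicit Types (f g phi psi u : rV -> R) (k : nat) (Omega K C : set rV).

(** Any compact set off which [phi] vanishes may stand for its closed support, which is never
    computed. *)
Lemma test_function_intro Omega C phi : (forall k, class_C k phi) ->
  compact C -> C `<=` Omega -> zero_off C phi -> test_function Omega phi.
Proof.
move=> cphi cC CO phi0.
have cl : closed C by apply: compact_closed => //; exact: norm_hausdorff.
have sC : closure [set x | phi x != 0] `<=` C.
  rewrite closureE; apply: smallest_sub => // x /=; apply: contraNP => xC.
  by rewrite phi0.
split => //; last exact: subset_trans CO.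
by apply: (subclosed_compact _ cC sC); exact: closed_closure.
Qed.

Lemma test_function_elim Omega phi : test_function Omega phi ->
  exists C, [/\ compact C, C `<=` Omega & zero_off C phi].
Proof.
move=> [_ cC CO]; exists (closure [set x | phi x != 0]); split => // x xC.
by apply: contra_notP xC => /eqP x0; exact: subset_closure.
Qed.

Lemma test_function_ball Omega phi : test_function Omega phi ->
  exists2 r, 0 < r & zero_off (ball 0 r) phi.
Proof.
move=> /test_function_elim[C [cC _ phi0]].
have [r r0 Cr] := bounded_rV_ball (compact_bounded cC).
by exists r => // x xr; apply: phi0 => /Cr.
Qed.

Lemma test_function_zero_off Omega phi : test_function Omega phi -> zero_off Omega phi.
Proof.
move=> /test_function_elim[C [_ CO phi0]] x xO; apply: phi0 => /CO //.
Qed.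

Lemma test_functionD Omega phi psi : test_function Omega phi ->
  test_function Omega psi -> test_function Omega (fun x => phi x + psi x).
Proof.
move=> tp tq; have [C [cC CO phi0]] := test_function_elim tp.
have [D [cD DO psi0]] := test_function_elim tq.
apply: (@test_function_intro _ (C `|` D)).
- by move=> k; apply: class_C_D; [have [] := tp|have [] := tq].
- exact: compactU.
- by rewrite subUset.
by move=> x /not_orP[xC xD]; rewrite phi0// psi0// addr0.
Qed.

Lemma test_functionZ Omega c phi : test_function Omega phi ->
  test_function Omega (fun x => c * phi x).
Proof.
move=> tp; have [C [cC CO phi0]] := test_function_elim tp.
apply: (@test_function_intro _ C) => //.
- by move=> k; apply: class_C_Z; have [] := tp.
by move=> x xC; rewrite phi0// mulr0.
Qed.

Lemma test_function0 Omega : test_function Omega (fun=> 0).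
Proof.
apply: (@test_function_intro _ set0) => //; last exact: compact0.
by move=> k; exact: class_C_cst.
Qed.

Lemma test_function_derive Omega phi i : test_function Omega phi ->
  test_function Omega ('D_(e_ i) phi).
Proof.
move=> tp; have [C [cC CO phi0]] := test_function_elim tp.
apply: (@test_function_intro _ C) => //.
  by move=> k; have [cp _ _] := tp; have /class_CS[_ _] := cp k.+1.
have cl : closed C by apply: compact_closed => //; exact: norm_hausdorff.
move=> x xC; have -> : 'D_(e_ i) phi x = 'D_(e_ i) (fun=> 0 : R) x.
  apply: near_eq_derive; near=> y; apply: phi0; near: y.
  by apply: open_nbhs_nbhs; split => //; exact: closed_openC.
by rewrite derive_cst.
Unshelve. all: by end_near.
Qed.

Lemma derive_shift f (h x v : rV) :
  'D_v (fun x => f (x + h)) x = 'D_v f (x + h) /\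
  derivable (fun x => f (x + h)) x v = derivable f (x + h) v.
Proof.
have E : (fun t : R => t^-1 *: (((fun x => f (x + h)) \o shift x) (t *: v) - f (x + h))) =
    (fun t : R => t^-1 *: ((f \o shift (x + h)) (t *: v) - f (x + h))).
  by apply/funext => t /=; rewrite addrA.
by rewrite /derive /derivable E.
Qed.

Lemma pderivs_shift s f (h : rV) :
  pderivs s (fun x => f (x + h)) = (fun x => pderivs s f (x + h)).
Proof.
elim: s => //= i s ->; apply/funext => x.
by have [] := derive_shift (pderivs s f) h x (e_ i).
Qed.

Lemma class_C_shift k f (h : rV) : class_C k f -> class_C k (fun x => f (x + h)).
Proof.
move=> [df cf]; split => [s i x sk|s sk]; rewrite pderivs_shift.
  by have [_ ->] := derive_shift (pderivs s f) h x (e_ i); exact: df.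
exact/shift_continuous/cf.
Qed.

Lemma test_function_shift K Omega phi (h : rV) :
  (forall x, K x -> Omega (x + h)) -> test_function K phi ->
  test_function Omega (fun x => phi (x - h)).
Proof.
move=> KO tp; have [C [cC CK phi0]] := test_function_elim tp.
apply: (@test_function_intro _ ((fun x => x + h) @` C)).
- by move=> k; apply: class_C_shift; have [] := tp.
- apply: continuous_compact => //; apply: continuous_subspaceT => x.
  exact: (cvgD cvg_id (cvg_cst h)).
- by move=> _ [x Cx <-]; apply: KO; exact: CK.
move=> x xC; apply: phi0 => Cx; apply: xC; exists (x - h) => //.
by rewrite subrK.
Qed.

Lemma zero_off_sqint f r : continuous f -> zero_off (ball 0 r) f -> sqint mu setT f.
Proof.
move=> cf f0; have [M M0 fM] := zero_off_bounded cf f0.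
have mf := continuous_rV_measurable cf.
split => //; apply: (@zero_off_integrable _ _ (fun x => f x ^+ 2) r).
- exact: measurable_funX.
- by move=> x xr; rewrite f0// expr0n.
by exists (M ^+ 2) => x; rewrite normrX lerXn2r ?nnegrE.
Qed.

Lemma test_function_continuous Omega phi : test_function Omega phi -> continuous phi.
Proof. by move=> [/(_ 0%N) + _ _]; exact: class_C_continuous. Qed.

Lemma test_function_sqint Omega phi : test_function Omega phi -> sqint mu setT phi.
Proof.
move=> tp; have [r r0 phi0] := test_function_ball tp.
exact: zero_off_sqint (test_function_continuous tp) phi0.
Qed.

Definition flat (y : R) : R := flat_poly 1 y.

Lemma flat_ge0 y : 0 <= flat y.
Proof.
by rewrite /flat /flat_poly hornerE mul1r; case: ifP => // _; exact: expR_ge0.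
Qed.

Lemma flat_le1 y : flat y <= 1.
Proof.
rewrite /flat /flat_poly hornerE mul1r; case: ifP => // y0.
by rewrite -expR0 ler_expR oppr_le0 invr_ge0 ltW.
Qed.

Lemma flat_eq0 y : y <= 0 -> flat y = 0.
Proof. by move=> y0; rewrite /flat /flat_poly ltNge y0. Qed.

Lemma flat_cvg1 y : 0 < y -> flat (n.+1%:R * y) @[n --> \oo] --> (1 : R).
Proof.
move=> y0.
rewrite (_ : (fun n : nat => _) = (fun n => expR (- (n.+1%:R^-1 * y^-1)))); last first.
  apply/funext => n; rewrite /flat /flat_poly mulr_gt0// hornerE mul1r.
  by rewrite invfM.
rewrite -[X in _ --> X]expR0.
apply: continuous_cvg; first exact: continuous_expR.
rewrite -oppr0; apply: cvgN; rewrite -(mul0r y^-1); apply: cvgM; last exact: cvg_cst.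
exact: cvg_harmonic.
Qed.

(** A smooth approximation from below of the indicator of the cube of half-side [s] about [p]: the
    factors are [flat] at [n.+1] times the signed distances to the faces, and [flat (n.+1 * y)]
    tends to [1] when [y > 0]. The arguments are expanded into the form expected by
    [class_C_comp_coord]. *)
Definition bump (p : rV) (s : R) (n : nat) (x : rV) : R :=
  \prod_i (flat (n.+1%:R * x 0 i + n.+1%:R * (s - p 0 i)) *
           flat (- n.+1%:R * x 0 i + n.+1%:R * (s + p 0 i))).

Lemma bump_class_C p s n k : class_C k (bump p s n).
Proof.
by apply: class_C_prod => i; apply: class_C_M; apply: class_C_comp_coord;
  exact: smooth1_flat_poly.
Qed.

Lemma bump01 p s n x : 0 <= bump p s n x <= 1.
Proof.
have h (i : 'I_N) y z : 0 <= flat y * flat z <= 1.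
  by rewrite mulr_ge0 ?flat_ge0//= mulr_ile1 ?flat_ge0 ?flat_le1.
by apply/andP; split; [apply: prodr_ge0|apply: prodr_ile1] => i _;
  [rewrite mulr_ge0 ?flat_ge0|exact: h].
Qed.

Lemma bump_zero_off p s n : 0 < s -> zero_off (ball p s) (bump p s n).
Proof.
move=> s0 x; rewrite ball_rVE//= => xs.
have [i /negP] : exists i, ~ `|p 0 i - x 0 i| < s by apply/existsNP.
rewrite ltr_norml negb_and -!leNgt => /orP[h|h];
  apply/eqP/prodf_eq0; exists i => //; rewrite mulf_eq0; apply/orP.
- right; rewrite flat_eq0//; have -> : - n.+1%:R * x 0 i + n.+1%:R * (s + p 0 i) =
    n.+1%:R * (s + p 0 i - x 0 i) by ring.
  by rewrite pmulr_rle0//; lra.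
- left; rewrite flat_eq0//; have -> : n.+1%:R * x 0 i + n.+1%:R * (s - p 0 i) =
    n.+1%:R * (s - (p 0 i - x 0 i)) by ring.
  by rewrite pmulr_rle0//; lra.
Qed.

Lemma bump_cvg p s x : 0 < s -> ball p s x -> bump p s n x @[n --> \oo] --> (1 : R).
Proof.
move=> s0; rewrite ball_rVE//= => xs.
rewrite (_ : 1 = \prod_(i < N) (1 * 1)); last by rewrite mulr1 big1.
apply: cvg_big => [|i _]; first exact: mul_continuous.
 have := xs i; rewrite ltr_norml => /andP[h1 h2].
apply: cvgM.
- have h : 0 < x 0 i + (s - p 0 i) by lra.
  by have := flat_cvg1 h; under eq_fun do rewrite mulrDr.
- have h : 0 < - x 0 i + (s + p 0 i) by lra.
  have := flat_cvg1 h; rewrite (_ : (fun n => flat (n.+1%:R * (- x 0 i + (s + p 0 i)))) =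
    (fun n => flat (- n.+1%:R * x 0 i + n.+1%:R * (s + p 0 i))))//.
  by apply/funext => n; rewrite mulrDr mulrN mulNr.
Qed.

Lemma closed_ball_compact (p : rV) s : compact [set x | `|p - x| <= s].
Proof.
have -> : [set x | `|p - x| <= s] = (fun x => x + p) @` [set x : rV | `|x| <= s].
  apply/seteqP; split => [x /= xs|_ [x /= xs <-]].
    by exists (x - p); rewrite /= ?subrK// distrC.
  by rewrite opprD addrCA subrr addr0 normrN.
apply: continuous_compact; last exact: norm_le_compact.
apply: continuous_subspaceT => x.
exact: (cvgD cvg_id (cvg_cst p)).
Qed.

Lemma bump_test Omega p s n : 0 < s -> [set x | `|p - x| <= s] `<=` Omega ->
  test_function Omega (bump p s n).
Proof.
move=> s0 sO; apply: (test_function_intro (C := [set x | `|p - x| <= s])) => //.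
- by move=> k; exact: bump_class_C.
- exact: closed_ball_compact.
move=> x xs; apply: bump_zero_off => // xb; apply: xs => /=.
by move: xb; rewrite -ball_normE /= => /ltW.
Qed.

End test_functions.

(** * Density of the test functions in [L^2] *)

Section density.
Context {R : realType} {N : nat}.
Local Notation rV := 'rV[R]_N.
Local Notation mu := (lebesgue_rV (R := R) N).
Implicit Types (f g phi psi u w : rV -> R).

Lemma ip_sqrD_le d (T : measurableType d) (m : {measure set T -> \bar R})
    (D : set T) (f g : T -> R) : measurable D -> sqint m D f -> sqint m D g ->
  ip m D (fun x => f x + g x) (fun x => f x + g x) <= 2 * ip m D f f + 2 * ip m D g g.
Proof.
move=> mD hf hg; have := ip_ge0 m D (fun x => f x + -1 * g x).
rewrite !ip_sqrD//; last exact: sqintZ.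
have hg1 := sqintZ mD (-1) hg.
have e1 : ip m D f (fun x => -1 * g x) = - ip m D f g.
  by rewrite ipC ipZl// ipC mulN1r.
have e2 : ip m D (fun x => -1 * g x) (fun x => -1 * g x) = ip m D g g.
  by rewrite ipZl// ipC ipZl// mulrA mulrNN !mul1r.
by rewrite e1 e2; lra.
Qed.

(** Open sets are stable under intersection, so they can serve as generators in the lambda-system
    argument of [test_approx_indic]. *)
Lemma measurable_openE : @measurable _ rV = <<s [set U : set rV | open U] >>.
Proof.
apply/seteqP; split; last first.
  apply: smallest_sub; first exact: sigma_algebra_measurable.
  by move=> U; exact: open_rV_measurable.
apply: smallest_sub; first exact: smallest_sigma_algebra.
rewrite -bigcup_seq; apply: bigcup_sub => i _ B [C mC <-]; rewrite setTI.
have : C \in [set C : set R | <<s [set U : set rV | open U] >> ((fun x : rV => x 0 i) @^-1` C)].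
  move: C mC => C; rewrite inE (RGenOpens.measurableE R); apply: smallest_sub.
    have [S0 SD SU] := smallest_sigma_algebra setT [set U : set rV | open U].
    split => /=.
    - by rewrite preimage_set0.
    - by move=> A /SD; rewrite !setTD preimage_setC.
    - by move=> F hF; rewrite preimage_bigcup; exact: SU.
  move=> _ [a [b ->]] /=; apply: sub_sigma_algebra => /=.
  apply: open_comp; last exact: interval_open.
  by move=> x _; exact: coord_continuous.
by rewrite inE.
Qed.

Variable K : set rV.

(** The closure in [L^2] of the test functions of [K]. *)
Definition test_approx w := sqint mu setT w /\ forall e, 0 < e ->
  exists2 phi, test_function K phi &
    ip mu setT (fun x => w x - phi x) (fun x => w x - phi x) <= e.

Lemma test_approx_lim w : sqint mu setT w ->
  (forall e, 0 < e -> exists2 v, test_approx v &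
    ip mu setT (fun x => w x - v x) (fun x => w x - v x) <= e) -> test_approx w.
Proof.
move=> hw wv; split => // e e0.
have [v [hv vphi] wve] := wv (e / 4) ltac:(by rewrite divr_gt0).
have [phi tphi vpe] := vphi (e / 4) ltac:(by rewrite divr_gt0).
exists phi => //; have hp := test_function_sqint tphi.
have := ip_sqrD_le measurableT (sqintB measurableT hw hv) (sqintB measurableT hv hp).
rewrite (_ : (fun x => w x - v x + (v x - phi x)) = fun x => w x - phi x).
  by lra.
by apply/funext => x; rewrite addrA subrK.
Qed.

Lemma test_approx_test phi : test_function K phi -> test_approx phi.
Proof.
move=> tp; split; first exact: test_function_sqint tp.
move=> e e0; exists phi => //; rewrite /ip.
under eq_Rintegral do rewrite subrr mulr0.
by rewrite Rintegral_cst// mul0r ltW.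
Qed.

Lemma test_approxD v w : test_approx v -> test_approx w ->
  test_approx (fun x => v x + w x).
Proof.
move=> [hv av] [hw aw]; split; first exact: sqintD.
move=> e e0.
have [phi tphi vpe] := av (e / 4) ltac:(by rewrite divr_gt0).
have [psi tpsi wpe] := aw (e / 4) ltac:(by rewrite divr_gt0).
exists (fun x => phi x + psi x); first exact: test_functionD.
have hp := test_function_sqint tphi; have hq := test_function_sqint tpsi.
have := ip_sqrD_le measurableT (sqintB measurableT hv hp) (sqintB measurableT hw hq).
rewrite (_ : (fun x => v x - phi x + (w x - psi x)) = fun x => v x + w x - (phi x + psi x)).
  by lra.
by apply/funext => x; ring.
Qed.

Lemma test_approxZ c w : test_approx w -> test_approx (fun x => c * w x).
Proof.
move=> [hw aw]; split; first exact: sqintZ.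
move=> e e0.
have c0 : 0 < c ^+ 2 + 1 by rewrite ltr_wpDl// sqr_ge0.
have [phi tphi wpe] := aw (e / (c ^+ 2 + 1)) ltac:(by rewrite divr_gt0).
exists (fun x => c * phi x); first exact: test_functionZ.
have hp := test_function_sqint tphi.
have hwp := sqintB measurableT hw hp.
rewrite (_ : (fun x => c * w x - c * phi x) = fun x => c * (w x - phi x)); last first.
  by apply/funext => x; rewrite mulrBr.
rewrite ipZl//; last exact: sqintZ.
rewrite ipC ipZl// mulrA -expr2.
move: wpe; rewrite ler_pdivlMr// => /(le_trans _); apply.
by rewrite mulrC ler_wpM2l ?ip_ge0// lerDl.
Qed.

Lemma test_approxB v w : test_approx v -> test_approx w ->
  test_approx (fun x => v x - w x).
Proof.
move=> hv /(test_approxZ (-1)) hw; have := test_approxD hv hw.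
by under eq_fun do rewrite mulN1r.
Qed.

Lemma test_approx0 : test_approx (fun=> 0).
Proof. by apply: test_approx_test; exact: test_function0. Qed.

(** Dominated convergence in [L^2]: the squared distance is at most [4 * g ^+ 2], and a single good
    index is enough since the closure is closed. *)
Lemma test_approx_dominated (v : nat -> rV -> R) w g :
  (forall n, test_approx (v n)) -> sqint mu setT g ->
  (forall n x, `|v n x| <= g x) -> (forall x, v n x @[n --> \oo] --> w x) ->
  test_approx w.
Proof.
move=> av hg vg vw.
have mv n : measurable_fun setT (v n) by have [[]] := av n.
have mw : measurable_fun setT w by apply: (measurable_fun_cvg mv) => x _; exact: vw.
have wg x : `|w x| <= g x.
  by apply: (cvgr_to_le (cvg_norm (vw x))); apply: nearW => n; exact: vg.
have hw : sqint mu setT w.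
  split => //; apply: (le_integrable measurableT _ _ hg.2).
    by apply/measurable_EFinP; exact: measurable_funX.
  move=> x _ /=; rewrite lee_fin !ger0_norm ?sqr_ge0// -real_normK ?num_real//.
  by rewrite lerXn2r ?nnegrE// (le_trans _ (wg x)).
apply: test_approx_lim => // e e0.
have i0 : (\int[mu]_x ((w x - v n x) ^+ 2)%:E)%E @[n --> \oo] --> 0%E.
  rewrite -(integral0 mu setT).
  apply: (@dominated_cvg _ _ _ mu setT measurableT _ _ (fun x => (4%:E * (g x ^+ 2)%:E)%E)) => //.
  - by move=> n; apply/measurable_EFinP; apply: measurable_funX; exact: measurable_funB.
  - move=> x _; apply: cvg_EFin; first by near=> n.
    rewrite /= -(mulr0 0); rewrite -(subrr (w x)).
    by apply: cvgM; apply: cvgB; try exact: cvg_cst; exact: vw.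
  - by apply: integrableZl => //; exact: hg.2.
  move=> n x _ /=; rewrite -EFinM lee_fin ger0_norm ?sqr_ge0//.
  have h1 := vg n x; have h2 := wg x; rewrite (_ : 4 = 2 ^+ 2 :> R); last by rewrite -natrX.
  rewrite -exprMn -[leLHS]real_normK ?num_real// lerXn2r ?nnegrE ?mulr_ge0//.
    by rewrite (le_trans _ h1).
  by apply: le_trans (ler_normB _ _) _; lra.
have /cvgrPdist_le/(_ e e0) : fine (\int[mu]_x ((w x - v n x) ^+ 2)%:E)%E @[n --> \oo] --> (0 : R).
  exact: fine_cvg i0.
move=> [n _ /(_ n (leqnn n))] /=.
rewrite sub0r normrN => ne; exists (v n) => //.
by apply: le_trans ne; rewrite /ip /Rintegral; exact: ler_norm.
Unshelve. all: by end_near.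
Qed.

Lemma indic_sqint (A : set rV) : measurable A -> (mu A < +oo)%E ->
  sqint mu setT (\1_A : rV -> R).
Proof.
move=> mA fA; split; first exact: measurable_indic.
rewrite (_ : (fun x => _) = EFin \o (\1_A : rV -> R)).
  apply/integrableP; split; first exact/measurable_EFinP/measurable_indic.
  under eq_integral do rewrite gee0_abs ?lee_fin ?ler0n//.
  by rewrite integral_indic// setIT.
by apply/funext => x /=; rewrite indicE; case: (_ \in _); rewrite ?expr1n ?expr0n.
Qed.

(** The combination is [1 - (1 - phi) * (1 - psi)], a smooth substitute for the indicator of a
    union. *)
Lemma test_function_union phi psi : test_function K phi -> test_function K psi ->
  test_function K (fun x => phi x + psi x - phi x * psi x).
Proof.
move=> tp tq.
have tpq : test_function K (fun x => phi x * psi x).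
  have [C [cC CO phi0]] := test_function_elim tp.
  apply: (test_function_intro (C := C)) => //.
    by move=> k; apply: class_C_M; [have [] := tp|have [] := tq].
  by move=> x xC; rewrite phi0// mul0r.
have := test_functionD (test_functionD tp tq) (test_functionZ (-1) tpq).
by under eq_fun do rewrite mulN1r.
Qed.

(* [1 - \prod_(k < n) (1 - bump_k)], over bumps of rational cubes filling [U]. *)
Lemma test_approx_open (U : set rV) : open U -> U `<=` K -> (mu U < +oo)%E ->
  test_approx (\1_U : rV -> R).
Proof.
move=> oU UK fU.
pose Q := ('rV[rat]_N * nat)%type.
pose c (q : Q) : rV := map_mx ratr q.1.
pose s (q : Q) : R := q.2.+1%:R^-1.
have s0 q : 0 < s q by rewrite invr_gt0.
pose good (q : Q) := `[< [set x | `|c q - x| <= s q] `<=` U >].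
pose b k n x : R := if unpickle k is Some q then (if good q then bump (c q) (s q) n x else 0) else 0.
pose F n m x : R := 1 - \prod_(k < m) (1 - b k n x).
have b01 k n x : 0 <= b k n x <= 1.
  rewrite /b; case: unpickle => [q|]; last by rewrite lexx ler01.
  by case: ifP => _; [exact: bump01|rewrite lexx ler01].
have tb k n : test_function K (b k n).
  rewrite /b; case: unpickle => [q|]; last exact: test_function0.
  case: (boolP (good q)) => [/asboolP gq|_]; last exact: test_function0.
  by apply: bump_test => //; exact: subset_trans UK.
have FS n m x : F n m.+1 x = F n m x + b m n x - F n m x * b m n x.
  by rewrite /F big_ord_recr /=; ring.
have tF n m : test_function K (F n m).
  elim: m => [|m IH].
    rewrite (_ : F n 0%N = fun=> 0); first exact: test_function0.
    by apply/funext => x; rewrite /F big_ord0 subrr.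
  rewrite (_ : F n m.+1 = fun x => F n m x + b m n x - F n m x * b m n x).
    exact: test_function_union.
  by apply/funext => x; exact: FS.
have P01 n m x : 0 <= \prod_(k < m) (1 - b k n x) <= 1.
  have h (k : 'I_m) : 0 <= 1 - b k n x <= 1 by have /andP[] := b01 k n x; lra.
  by apply/andP; split; [apply: prodr_ge0|apply: prodr_ile1] => k _; have /andP[] := h k.
have bU k n x : ~ U x -> b k n x = 0.
  rewrite /b; case: unpickle => // q xU; case: ifPn => // /asboolP gq.
  apply: bump_zero_off => // xb; apply: xU; apply: gq => /=.
  by move: xb; rewrite -ball_normE /= => /ltW.
have FU n m x : ~ U x -> F n m x = 0.
  move=> xU; rewrite /F big1 ?subrr// => k _; by rewrite bU// subr0.
(* On the diagonal the number of cubes and the sharpness of the bumps grow together. At a point of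
   [U], the cube containing it is eventually included and its factor tends to [0], while the other
   factors stay in [[0, 1]]. *)
apply: (@test_approx_dominated (fun n => F n n) _ (\1_U)).
- by move=> n; apply: test_approx_test; exact: tF.
- by apply: indic_sqint => //; exact: open_rV_measurable.
- move=> n x; rewrite indicE; have [xU|xU] := pselect (U x).
    rewrite mem_set// mulr1n ler_norml /F; have /andP[] := P01 n n x.
    by move: (\prod_(k < n) _) => p p0 p1; apply/andP; split; lra.
  by rewrite FU// normr0 ler0n.
move=> x; rewrite indicE; have [xU|xU] := pselect (U x); last first.
  rewrite memNset// (_ : (fun n => F n n x) = cst 0); first exact: cvg_cst.
  by apply/funext => n; rewrite FU.
rewrite mem_set//.
have [q gq xq] : exists2 q, good q & ball (c q) (s q) x.
  have [q [n [xq qU]]] := open_rat_ball oU xU.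
  by exists (q, n) => //; apply/asboolP.
have bq : b (pickle q) n x @[n --> \oo] --> (1 : R).
  rewrite /b pickleK gq; exact: bump_cvg.
rewrite -[X in _ --> X]subr0; apply: cvgB; first exact: cvg_cst.
apply: (@squeeze_cvgr _ _ _ _ (cst 0) (fun n => 1 - b (pickle q) n x)).
- near=> n; rewrite /cst; have /andP[-> _] := P01 n n x; rewrite /=.
  have qn : (pickle q < n)%N by near: n; exact: nbhs_infty_gt.
  rewrite (bigD1 (Ordinal qn))//= ler_piMr//.
    by have /andP[] := b01 (pickle q) n x; lra.
  by apply: prodr_ile1 => k _; have /andP[] := b01 k n x; lra.
- exact: cvg_cst.
by rewrite -(subrr 1); apply: cvgB => //; exact: cvg_cst.
Unshelve. all: by end_near.
Qed.

(** A lambda-system argument from the open sets. Intersecting with a fixed [V] of finite measure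
    keeps every indicator square-integrable, in particular that of the whole space. *)
Lemma test_approx_indic (V A : set rV) : open V -> V `<=` K -> (mu V < +oo)%E ->
  measurable A -> test_approx (\1_(A `&` V) : rV -> R).
Proof.
move=> oV VK fV.
have mV := open_rV_measurable oV.
have hV := test_approx_open oV VK fV.
pose H := [set A : set rV | measurable A /\ test_approx (\1_(A `&` V) : rV -> R)].
suff : @measurable _ rV `<=` H by move=> + mA => /(_ _ mA)[].
clear A; rewrite measurable_openE.
apply: (@lambda_system_subset _ _ _ setT) => //.
- by move=> A B /= oA oB; exact: openI.
- split => //.
  + by split; [exact: measurableT|rewrite setTI].
  + move=> A B BA [mA aA] [mB aB]; split; first exact: measurableD.
    have := test_approxB aA aB; congr test_approx; apply/funext => x.
    rewrite !indicE !in_setI in_setC.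
    have [xB|xB] := boolP (x \in B).
      by rewrite (mem_set (BA x (set_mem xB))) subrr.
    by rewrite andbT /= subr0.
  move=> F ndF hF; split; first by apply: bigcup_measurable => n _; have [] := hF n.
  apply: (@test_approx_dominated (fun n => \1_(F n `&` V)) _ (\1_V)).
  + by move=> n; have [] := hF n.
  + exact: indic_sqint.
  + move=> n x; rewrite !indicE in_setI ger0_norm// ler_nat.
    by case: (x \in V); rewrite ?andbT ?andbF//; case: (x \in F n).
  move=> x; have [[n _ Fx]|xF] := pselect ((\bigcup_n F n) x).
    apply: cvg_near_cst; exists n => // m /= nm; rewrite !indicE !in_setI.
    have -> : x \in F m by apply/mem_set; have /subsetPset := ndF _ _ nm; exact.
    by have -> : x \in \bigcup_n F n by apply/mem_set; exists n.
  apply: cvg_near_cst; near=> m; rewrite !indicE !in_setI.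
  rewrite (memNset xF) memNset// => Fx; apply: xF; by exists m.
- move=> U /= oU; split; first exact: open_rV_measurable.
  apply: test_approx_open; first exact: openI.
    by move=> x [_ /VK].
  by apply: le_lt_trans fV; apply: le_measure; rewrite ?inE//;
    apply: measurableI => //; exact: open_rV_measurable.
Unshelve. all: by end_near.
Qed.

Lemma test_approx_sum I (r : seq I) (P : pred I) (F : I -> rV -> R) :
  (forall i, test_approx (F i)) -> test_approx (fun x => \sum_(i <- r | P i) F i x).
Proof.
move=> h; elim: r => [|i r IH].
  by under eq_fun do rewrite big_nil; exact: test_approx0.
under eq_fun do rewrite big_cons.
by case: (P i) => //; exact: test_approxD.
Qed.

Hypothesis oK : open K.

Import HBNNSimple.

(** Simple functions below [w] are cut off to the bounded open sets [V n], which exhaust [K]; [w]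
    itself is the dominating function. *)
Lemma test_approx_ge0 w : (forall x, 0 <= w x) -> sqint mu setT w ->
  zero_off K w -> test_approx w.
Proof.
move=> w0 hw wK.
have mw : measurable_fun setT (EFin \o w) by apply/measurable_EFinP; exact: hw.1.
pose h := nnsfun_approx measurableT mw.
pose g n : rV -> R := h n.
pose V n := K `&` ball 0 n%:R.
have oV n : open (V n) by apply: openI => //; exact: ball_open.
have fV n : (mu (V n) < +oo)%E.
  apply: (@le_lt_trans _ _ (mu (ball 0 n%:R))).
    by apply: le_measure; rewrite ?inE//; [exact: open_rV_measurable|exact: ball_rV_measurable|exact: subIsetr].
  by apply: lebesgue_rV_bounded; [exact: ball_rV_measurable|exact: ball0_bounded].
have gw n x : g n x <= w x.
  by rewrite -lee_fin /g /h nnsfun_approxE; apply: le_approx => // y _; rewrite lee_fin.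
have gc x : g n x @[n --> \oo] --> w x.
  have := @cvg_nnsfun_approx _ _ _ _ measurableT _ mw _ x Logic.I.
  move=> hc; apply: (@fine_cvg _ _ _ _ (EFin \o (fun n => h n x))).
  by apply: hc => y _; rewrite lee_fin.
apply: (@test_approx_dominated (fun n x => g n x * \1_(V n) x) _ w) => //.
- move=> n.
  have [s sE] : exists s : seq R, forall x,
      g n x = \sum_(y <- s) y * \1_(g n @^-1` [set y]) x.
    by eexists => x; rewrite /g fimfunE fsbig_finite.
  rewrite (_ : (fun x => _) = fun x => \sum_(y <- s)
     y * \1_((g n @^-1` [set y]) `&` V n) x); last first.
    apply/funext => x; rewrite sE mulr_suml.
    by apply: eq_bigr => i _; rewrite indicI /= mulrA.
  apply: test_approx_sum => i; apply: test_approxZ; apply: test_approx_indic => //.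
  by move=> x [].
- move=> n x; rewrite indicE normrM ger0_norm// ger0_norm ?ler0n//.
  apply: le_trans (gw n x); case: (_ \in _); rewrite ?mulr1 ?mulr0//.
move=> x; have [Kx|Kx] := pselect (K x).
  rewrite -[w x]mulr1; apply: cvgM => //.
  apply: cvg_near_cst; near=> n; rewrite indicE mem_set//; split => //.
  rewrite -ball_normE /= sub0r normrN; near: n.
  exact: nbhs_infty_gtr.
rewrite wK// (_ : (fun n => _) = cst 0); first exact: cvg_cst.
by apply/funext => n; rewrite indicE memNset ?mulr0// => -[].
Unshelve. all: by end_near.
Qed.

Lemma test_approx_dense w : sqint mu setT w -> zero_off K w -> test_approx w.
Proof.
move=> hw wK.
have hn : sqint mu setT (fun x => `|w x|).
  have [mw w2] := hw; split; first exact: measurableT_comp.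
  by apply: eq_integrable w2 => // x _; rewrite real_normK ?num_real.
have h1 : test_approx (fun x => `|w x| + w x).
  apply: test_approx_ge0; [|exact: sqintD|].
    by move=> x; rewrite -lerBlDr sub0r -normrN ler_norm.
  by move=> x /wK ->; rewrite normr0 addr0.
have h2 : test_approx (fun x => `|w x| - w x).
  apply: test_approx_ge0; [|exact: sqintB|].
    by move=> x; rewrite subr_ge0 ler_norm.
  by move=> x /wK ->; rewrite normr0 subr0.
have := test_approxZ 2^-1 (test_approxB h1 h2); congr test_approx.
by apply/funext => x; field.
Qed.

(* Testing against [w] itself, which test functions approximate. *)
Lemma test_dual_bound w (C : R) : sqint mu setT w -> zero_off K w -> 0 <= C ->
  (forall phi, test_function K phi -> ip mu setT w phi <= C * nrm mu setT phi) ->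
  nrm mu setT w <= C.
Proof.
move=> hw wK C0 wC; have [_ aw] := test_approx_dense hw wK.
set n := nrm mu setT w.
have n0 : 0 <= n by exact: nrm_ge0.
have key e : 0 < e -> n ^+ 2 <= C * n + (C + n) * e.
  move=> e0; have [phi tphi pe] := aw (e ^+ 2) ltac:(by rewrite exprn_gt0).
  have hp := test_function_sqint tphi; have hwp := sqintB measurableT hw hp.
  have ne : nrm mu setT (fun x => w x - phi x) <= e.
    by rewrite -(@ler_pXn2r _ 2)// ?nnegrE ?nrm_ge0 ?(ltW e0)// sqr_nrm.
  have np : nrm mu setT phi <= n + e.
    have := nrmD measurableT hw (sqintN measurableT hwp).
    rewrite (_ : (fun x => w x + - (w x - phi x)) = phi); last first.
      by apply/funext => x; rewrite subKr.
    move=> /le_trans; apply; rewrite lerD2l; apply: le_trans ne.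
    rewrite /nrm /ip; under eq_Rintegral do rewrite mulrNN; exact: lexx.
  have -> : n ^+ 2 = ip mu setT w phi + ip mu setT w (fun x => w x - phi x).
    rewrite sqr_nrm !(ipC _ _ w) -ipDl//.
    by congr ip; apply/funext => x; rewrite addrC subrK.
  have h1 := wC _ tphi.
  have h2 : ip mu setT w (fun x => w x - phi x) <= n * e.
    apply: le_trans (ler_norm _) _; apply: le_trans (ip_le_nrm measurableT hw hwp) _.
    by rewrite ler_wpM2l.
  have h3 := ler_wpM2l C0 np; nra.
rewrite leNgt; apply/negP => Cn.
have Cn0 : 0 < C + n + 1 by lra.
(* If [C < n], this [q] makes [(C + n) * q] less than half of [n * (n - C)], against [key]. *)
pose q := n * (n - C) / (2 * (C + n + 1)).
have q0 : 0 < q by rewrite divr_gt0 ?mulr_gt0//; lra.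
have qE : q * (2 * (C + n + 1)) = n * (n - C) by rewrite divfK// gt_eqF// mulr_gt0.
have := key q q0; have h' : 0 <= (C + n) * q by rewrite mulr_ge0//; lra.
rewrite expr2; lra.
Qed.

End density.

(** * Weak derivatives *)

Section weak_derivatives.
Context {R : realType} {N : nat}.
Local Notation rV := 'rV[R]_N.
Local Notation mu := (lebesgue_rV (R := R) N).
Local Notation e_ i := (unit_rV (R := R) i).
Variable Omega : set rV.
Hypothesis oO : open Omega.
Implicit Types (f g phi psi u v w : rV -> R) (s : seq 'I_N).
Local Notation ipO := (ip mu Omega).
Local Notation sqO := (sqint mu Omega).

Let mO : measurable Omega. Proof. exact: open_rV_measurable. Qed.

Lemma sqint_patch u : sqO u -> sqint mu setT (u \_ Omega).
Proof.
move=> [mu_ iu]; split; first exact: (proj1 (measurable_restrictT _ mO) mu_).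
have := proj1 (integrable_mkcond _ mO) iu; apply: eq_integrable => // x _.
by rewrite !patchE; case: ifP => //= _; rewrite expr0n.
Qed.

Lemma sqint_sub w : sqint mu setT w -> sqO w.
Proof.
move=> [mw iw]; split; first exact: measurable_funTS.
exact: (integrableS measurableT mO _ iw).
Qed.

Lemma ip_patch u v : ip mu setT (u \_ Omega) v = ipO u v.
Proof.
rewrite /ip [RHS]Rintegral_mkcond; apply: eq_Rintegral => x _.
by rewrite !patchE; case: ifP => // _; rewrite mul0r.
Qed.

Lemma ip_patch2 u v : ip mu setT (u \_ Omega) (v \_ Omega) = ipO u v.
Proof.
rewrite /ip [RHS]Rintegral_mkcond; apply: eq_Rintegral => x _.
by rewrite !patchE; case: ifP => // _; rewrite mul0r.
Qed.

Lemma patch_zero_off u : zero_off Omega (u \_ Omega).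
Proof. by move=> x xO; rewrite patchE memNset. Qed.

Lemma test_sqO phi : test_function Omega phi -> sqO phi.
Proof. by move=> /test_function_sqint /sqint_sub. Qed.

Lemma ip_setT_test u phi : test_function Omega phi -> ip mu setT u phi = ipO u phi.
Proof.
move=> tp; rewrite /ip [RHS]Rintegral_mkcond; apply: eq_Rintegral => x _.
rewrite patchE; case: ifPn => // /negP xO.
by rewrite (test_function_zero_off tp) ?mulr0// => Ox; apply: xO; rewrite inE.
Qed.

(** The fundamental lemma of the calculus of variations, read as the dual bound with constant [0].
    It makes weak derivatives unique. *)
Lemma test_zero u : sqO u -> (forall phi, test_function Omega phi -> ipO u phi = 0) ->
  ae_eq_on Omega u (fun=> 0).
Proof.
move=> hu u0.
have h : nrm mu setT (u \_ Omega) <= 0.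
  apply: (test_dual_bound oO) => //; [exact: sqint_patch|exact: patch_zero_off|].
  by move=> phi tp; rewrite ip_patch u0// mul0r.
have := ip_eq0 mO hu; apply.
have := sqr_nrm mu setT (u \_ Omega).
rewrite (_ : nrm mu setT _ = 0); last by apply/eqP; rewrite eq_le h nrm_ge0.
by rewrite expr0n /= ip_patch2 => <-.
Qed.

Lemma weak_derivE s u g : weak_deriv Omega s u g <->
  (forall phi, test_function Omega phi ->
    ipO u (pderivs s phi) = (-1) ^+ size s * ipO g phi).
Proof. by []. Qed.

Lemma weak_deriv_unique s u g g' : sqO g -> sqO g' ->
  weak_deriv Omega s u g -> weak_deriv Omega s u g' -> ae_eq_on Omega g g'.
Proof.
move=> hg hg' wg wg'.
have : ae_eq_on Omega (fun x => g x - g' x) (fun=> 0).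
  apply: test_zero; first exact: sqintB.
  move=> phi tp; have hp := test_sqO tp; rewrite ipBl//.
  have h := etrans (esym (wg _ tp)) (wg' _ tp).
  apply/eqP; rewrite subr_eq0; apply/eqP; apply: (mulfI _ h).
  by rewrite signr_eq0.
by apply: filterS => x h /h /eqP; rewrite subr_eq0 => /eqP.
Qed.

Lemma pderivs_test s phi : test_function Omega phi -> test_function Omega (pderivs s phi).
Proof. by elim: s => //= i s IH /IH; exact: test_function_derive. Qed.

Lemma weak_deriv_lin s (c : R) u v g h : sqO u -> sqO v -> sqO g -> sqO h ->
  weak_deriv Omega s u g -> weak_deriv Omega s v h ->
  weak_deriv Omega s (fun x => c * u x + v x) (fun x => c * g x + h x).
Proof.
move=> hu hv hg hh wu wv; apply/weak_derivE => phi tp.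
have hp := test_sqO tp; have hsp := test_sqO (pderivs_test s tp).
rewrite !ipDl ?ipZl//; try exact: sqintZ.
by move/weak_derivE : wu => ->//; move/weak_derivE : wv => ->//; ring.
Qed.

Lemma sobolev_sqO k u : sobolev Omega k u -> sqO u. Proof. by case. Qed.

Lemma wderivP k u s : sobolev Omega k u -> (size s <= k)%N ->
  sqO (wderiv Omega s u) /\ weak_deriv Omega s u (wderiv Omega s u).
Proof.
move=> [_ /(_ s)] h sk; have [g hg wg] := h sk.
exact: (@xgetPex _ (fun=> 0) [set g | L2 Omega g /\ weak_deriv Omega s u g] (ex_intro _ g (conj hg wg))).
Qed.

Lemma wderivE s u g : sqO g -> weak_deriv Omega s u g ->
  ae_eq_on Omega (wderiv Omega s u) g.
Proof.
move=> hg wg.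
have [h1 h2] : sqO (wderiv Omega s u) /\ weak_deriv Omega s u (wderiv Omega s u).
  exact: (@xgetPex _ (fun=> 0) [set g | L2 Omega g /\ weak_deriv Omega s u g] (ex_intro _ g (conj hg wg))).
exact: weak_deriv_unique wg.
Qed.

Lemma sobolev_lin k c u v : sobolev Omega k u -> sobolev Omega k v ->
  sobolev Omega k (fun x => c * u x + v x).
Proof.
move=> hu hv; split.
  by apply: sqintD => //; [apply: sqintZ => //|]; apply: sobolev_sqO; [exact: hu|exact: hv].
move=> s sk; have [a1 a2] := wderivP hu sk; have [b1 b2] := wderivP hv sk.
exists (fun x => c * wderiv Omega s u x + wderiv Omega s v x).
  by apply: sqintD => //; exact: sqintZ.
apply: weak_deriv_lin => //; [exact: sobolev_sqO hu|exact: sobolev_sqO hv].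
Qed.

Lemma wderiv_lin k c u v s : sobolev Omega k u -> sobolev Omega k v ->
  (size s <= k)%N ->
  ae_eq_on Omega (wderiv Omega s (fun x => c * u x + v x))
    (fun x => c * wderiv Omega s u x + wderiv Omega s v x).
Proof.
move=> hu hv sk; have [a1 a2] := wderivP hu sk; have [b1 b2] := wderivP hv sk.
apply: wderivE; first by apply: sqintD => //; exact: sqintZ.
apply: weak_deriv_lin => //; [exact: sobolev_sqO hu|exact: sobolev_sqO hv].
Qed.

Lemma sobolev0 k : sobolev Omega k (fun=> 0).
Proof.
split; first exact: sqint0.
move=> s _; exists (fun=> 0); first exact: sqint0.
apply/weak_derivE => phi tp.
by rewrite /ip; under eq_Rintegral do rewrite mul0r; under [in RHS]eq_Rintegral do rewrite mul0r;
  rewrite Rintegral_cst// mul0r mulr0.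
Qed.

Lemma smooth_sqO u : bounded_set Omega -> continuous u -> sqO u.
Proof.
move=> bO cu; have mu_ := continuous_rV_measurable cu.
split; first exact: measurable_funTS.
have [r r0 Or] := bounded_rV_ball bO.
have := @continuous_compact _ _ u _ (continuous_subspaceT cu) (@norm_le_compact R N r).
move=> /compact_bounded[M [Mr hM]].
have uM x : Omega x -> `|u x| <= `|M| + 1.
  move=> Ox; apply: hM; first by rewrite (le_lt_trans (ler_norm M))// ltrDl.
  exists x => //=; have := Or x Ox.
  by rewrite -ball_normE /= sub0r normrN => /ltW.
apply: measurable_bounded_integrable => //.
- exact: lebesgue_rV_bounded.
- by apply: measurable_funX; exact: measurable_funTS.
exists ((`|M| + 1) ^+ 2); split; first by rewrite num_real.
move=> y My x Ox; rewrite /= normrX; apply: le_trans (ltW My).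
by rewrite lerXn2r ?nnegrE ?addr_ge0// uM.
Qed.

Lemma weak_deriv_smooth u i phi : class_C 1 u -> test_function Omega phi ->
  ipO u ('D_(e_ i) phi) = - ipO ('D_(e_ i) u) phi.
Proof.
move=> cu tp; have [cp _ _] := tp; have [r r0 phi0] := test_function_ball tp.
rewrite -ip_setT_test; last exact: test_function_derive.
rewrite -ip_setT_test//.
exact: (integration_by_parts i cu (cp 1%N) phi0).
Qed.

Lemma sobolev_smooth u : bounded_set Omega -> class_C 2 u ->
  [/\ sobolev Omega 2 u,
      forall i, weak_deriv Omega [:: i] u ('D_(e_ i) u)
    & forall i j, weak_deriv Omega [:: i; j] u ('D_(e_ j) ('D_(e_ i) u))].
Proof.
move=> bO cu.
have /class_CS[c0 d0 c1] := cu.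
have c2 i j : continuous ('D_(e_ j) ('D_(e_ i) u)).
  by have /class_CS[_ _ /(_ j) /class_C0] := c1 i.
have w1 i : weak_deriv Omega [:: i] u ('D_(e_ i) u).
  apply/weak_derivE => phi tp /=; rewrite weak_deriv_smooth//; first by rewrite mulN1r.
  exact: class_C_S.
have w2 i j : weak_deriv Omega [:: i; j] u ('D_(e_ j) ('D_(e_ i) u)).
  apply/weak_derivE => phi tp /=; rewrite weak_deriv_smooth//; last 2 first.
    exact: class_C_S.
    exact: test_function_derive.
  by rewrite weak_deriv_smooth// opprK sqrrN expr1n mul1r.
split => //; split; first exact: smooth_sqO.
move=> [|i [|j [|//]]] _.
- exists u; first exact: smooth_sqO.
  by apply/weak_derivE => phi tp /=; rewrite mul1r.
- exists ('D_(e_ i) u) => //; apply: smooth_sqO => //.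
  exact: class_C_continuous (c1 i).
by exists ('D_(e_ j) ('D_(e_ i) u)) => //; exact: smooth_sqO.
Qed.

(** [pderivs [:: i; j] phi] is the [i]-th derivative of the test function ['D_(e_ j) phi]. Hence
    second derivatives are gradients of first ones, and inequalities about gradients apply to
    them. *)
Lemma weak_deriv_iter u i j : sobolev Omega 2 u ->
  weak_deriv Omega [:: j] (wderiv Omega [:: i] u) (wderiv Omega [:: i; j] u).
Proof.
move=> hu; have [_ w1] := wderivP (s := [:: i]) hu isT.
have [_ w2] := wderivP (s := [:: i; j]) hu isT.
apply/weak_derivE => phi tp /=.
have := w2 phi tp; have := w1 _ (test_function_derive j tp) => /=.
rewrite -!/(ip _ _ _ _) => -> /eqP; rewrite mulN1r eqr_oppLR => /eqP ->.
by rewrite sqrrN expr1n mul1r mulN1r.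
Qed.

(** For a fixed test function both sides of the defining identity are continuous in [L^2]. *)
Lemma weak_deriv_lim s (u g : nat -> rV -> R) u' g' :
  (forall n, sqO (u n)) -> (forall n, sqO (g n)) -> sqO u' -> sqO g' ->
  (forall n, weak_deriv Omega s (u n) (g n)) ->
  (forall e, 0 < e -> exists n0, forall n, (n0 <= n)%N ->
    ipO (fun x => u n x - u' x) (fun x => u n x - u' x) <= e) ->
  (forall e, 0 < e -> exists n0, forall n, (n0 <= n)%N ->
    ipO (fun x => g n x - g' x) (fun x => g n x - g' x) <= e) ->
  weak_deriv Omega s u' g'.
Proof.
move=> hu hg hu' hg' w uu' gg'; apply/weak_derivE => phi tp.
have hp := test_sqO tp; have hsp := test_sqO (pderivs_test s tp).
set A := ipO u' _; set B := ipO g' _; set sg := (-1) ^+ _.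
have sg1 : `|sg| = 1 by rewrite normrX normrN1 expr1n.
apply/eqP; rewrite -subr_eq0 -normr_le0; apply/ler_addgt0Pl => e e0.
rewrite addr0; set p := nrm mu Omega (pderivs s phi); set q := nrm mu Omega phi.
have p0 : 0 <= p by exact: nrm_ge0.
have q0 : 0 <= q by exact: nrm_ge0.
pose d := e / (p + q + 1).
have d0 : 0 < d by rewrite divr_gt0//; lra.
have [n1 hn1] := uu' (d ^+ 2) ltac:(by rewrite exprn_gt0).
have [n2 hn2] := gg' (d ^+ 2) ltac:(by rewrite exprn_gt0).
pose n := maxn n1 n2.
have nle f : ipO f f <= d ^+ 2 -> nrm mu Omega f <= d.
  by move=> h; rewrite -(@ler_pXn2r _ 2)// ?nnegrE ?nrm_ge0 ?(ltW d0)// sqr_nrm.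
have a1 := nle _ (hn1 n (leq_maxl _ _)); have a2 := nle _ (hn2 n (leq_maxr _ _)).
have E : A - sg * B = - ipO (fun x => u n x - u' x) (pderivs s phi)
    + sg * ipO (fun x => g n x - g' x) phi.
  rewrite !ipBl// -/A -/B; have /weak_derivE -> // := w n; rewrite -/sg; ring.
rewrite E; apply: le_trans (ler_normD _ _) _; rewrite normrN normrM sg1 mul1r.
have b1 := ip_le_nrm mO (sqintB mO (hu n) hu') hsp.
have b2 := ip_le_nrm mO (sqintB mO (hg n) hg') hp.
have c1 : nrm mu Omega (fun x => u n x - u' x) * p <= d * p by rewrite ler_wpM2r.
have c2 : nrm mu Omega (fun x => g n x - g' x) * q <= d * q by rewrite ler_wpM2r.
have dE : d * (p + q + 1) = e by rewrite divfK// gt_eqF//; lra.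
rewrite -/p in b1; rewrite -/q in b2; nra.
Qed.

End weak_derivatives.

(** * The cone property and Poincare's inequality *)

Section cone_property.
Context {R : realType}.

Lemma class_C1_locally_lipschitz n (g : 'rV[R]_n -> R) (y0 : 'rV[R]_n) : class_C 1 g ->
  exists L d : R, [/\ 0 <= L, 0 < d & forall y z, `|y - y0| < d -> `|z - y0| < d ->
    `|g y - g z| <= L * `|y - z|].
Proof.
move=> /class_CS[cg dg Dg].
have cD i : continuous ('D_(unit_rV i) g) by apply/class_C0; exact: Dg.
pose B i := `|'D_(unit_rV i) g y0| + 1.
have nb : \forall y \near y0, forall i, `|'D_(unit_rV i) g y| <= B i.
  have nbi i : \forall y \near y0, `|'D_(unit_rV i) g y| <= B i.
    by apply: (cvgr_norm_le _ (cD i y0)); rewrite ltrDl.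
  exact: (filter_forall _ nbi).
have /nbhs_ballP[d /= d0 dP] := nb.
(* The intermediate points of [mean_value] lie within [|y - z| < 2 * d / 3] of [z], itself within
   [d / 3] of [y0]; so they remain where the derivatives are bounded. *)
exists (\sum_i B i), (d / 3); split; first by apply: sumr_ge0 => i _; rewrite addr_ge0.
  by rewrite divr_gt0.
move=> y z yd zd.
have [xi xiP E] := mean_value z (y - z) dg.
rewrite (addrC z) subrK in E; rewrite E.
apply: le_trans (ler_norm_sum _ _ _) _; rewrite mulr_suml; apply: ler_sum => i _.
rewrite normrM mulrC; apply: ler_pM => //; last exact: coord_le_norm.
apply: dP; rewrite -ball_normE /= distrC.
have := ler_distD z (xi i) y0; have := xiP i; have := ler_distD y0 y z.
rewrite (distrC y0 z); lra.
Qed.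

(** The norm is the sup norm, which an orthogonal matrix does not preserve; a constant takes the
    place of the isometry. *)
Lemma mulmx_norm_bound m n (Q : 'M[R]_(m, n)) : exists2 C : R, 0 <= C &
  forall w : 'rV[R]_m, `|w *m Q| <= C * `|w|.
Proof.
exists (\sum_i \sum_j `|Q i j|); first by apply: sumr_ge0 => i _; apply: sumr_ge0.
move=> w; apply: norm_rV_le; first by rewrite mulr_ge0// sumr_ge0// => i _; rewrite sumr_ge0.
move=> j; rewrite mxE mulr_suml; apply: le_trans (ler_norm_sum _ _ _) _.
apply: ler_sum => i _; rewrite normrM mulrC; apply: ler_pM => //; last exact: coord_le_norm.
by rewrite (bigD1 j)//= lerDl sumr_ge0.
Qed.

Variable N : nat.
Local Notation rV := 'rV[R]_N.

(** A uniform interior cone condition: axis, opening and height are common to all points of [Omega]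
    near [x0]. The axis [e] is [0] at interior points. *)
Definition cone_at (Omega : set rV) (x0 : rV) := exists (r eta : R) (e : rV),
  [/\ 0 < r, 0 < eta & forall x t w, ball x0 r x -> Omega x -> 0 < t <= eta ->
    `|w| <= eta -> Omega (x + t *: (e + w))].

Lemma cone_at_interior (Omega : set rV) x0 : open Omega -> Omega x0 -> cone_at Omega x0.
Proof.
move=> oO Ox0; have /nbhs_ballP[d /= d0 dO] : nbhs x0 Omega by exact: open_nbhs_nbhs.
pose eta := Num.min 1 (d / 4).
have eta0 : 0 < eta by rewrite lt_min ltr01 divr_gt0.
exists (d / 2), eta, 0; split => //; first by rewrite divr_gt0.
move=> x t w; rewrite -ball_normE /= => xd _ /andP[t0 te] we; apply: dO.
rewrite -ball_normE /= add0r opprD addrA; apply: le_lt_trans (ler_normB _ _) _.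
have e1 : eta <= 1 by rewrite ge_min lexx.
have e2 : eta <= d / 4 by rewrite ge_min lexx orbT.
have : `|t *: w| <= d / 4.
  rewrite normrZ gtr0_norm//; apply: le_trans (ler_pM (ltW t0) (normr_ge0 _) te we) _.
  by apply: le_trans e2; rewrite ler_piMl// ltW.
by lra.
Qed.

Lemma col'_norm_le n (i : 'I_n) (v : 'rV[R]_n) : `|col' i v| <= `|v|.
Proof. by apply: norm_rV_le => // j; rewrite mxE; exact: coord_le_norm. Qed.

(** In the rotated coordinates [Omega] lies above the graph of a locally Lipschitz function. A
    displacement along the vertical axis raises the last coordinate by [t], which exceeds the rise
    of the graph caused by a small tilt [w]. *)
Lemma cone_at_closure alpha (Omega : set rV) x0 : domain_of_class 4 alpha Omega ->
  closure Omega x0 -> cone_at Omega x0.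
Proof.
move=> [[oO _] Obd] cx0; have [Ox0|Ox0] := pselect (Omega x0).
  exact: cone_at_interior.
have [r [Q [i [g [r0 QQ [cg _] OQ]]]]] := Obd x0 (conj cx0 Ox0).
have QtQ : Q^T *m Q = 1%:M by exact: mulmx1C.
have c1g : class_C 1 g by do 3 apply: class_C_S.
have [L [d [L0 d0 gL]]] := class_C1_locally_lipschitz (col' i (x0 *m Q)) c1g.
have [C C0 QC] := mulmx_norm_bound Q.
pose e : rV := unit_rV i *m Q^T.
have eQ : e *m Q = unit_rV i by rewrite -mulmxA QtQ mulmx1.
(* Three requirements on [eta]: [A] limits the tilt against the slope [L] of the graph, [B] keeps
   the displaced point in the ball of radius [r], and [D] keeps its projection where [g] is
   Lipschitz. *)
pose A := (L + 1) * (C + 1); pose B := (`|e| + 1) / (r / 2); pose D := C / (d / 2).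
have A0 : 0 <= A by rewrite mulr_ge0//; lra.
have B0 : 0 <= B by rewrite divr_ge0 ?addr_ge0// divr_ge0// ltW.
have D0 : 0 <= D by rewrite divr_ge0// divr_ge0// ltW.
pose K := 1 + A + B + D.
have K1 : 1 <= K by rewrite /K; lra.
have K0 : 0 < K by apply: lt_le_trans K1.
pose eta := K^-1.
have etaK X : X < K -> X * eta < 1 by rewrite ltr_pdivrMr// mul1r.
have eta0 : 0 < eta by rewrite invr_gt0.
have eta1 : eta <= 1 by rewrite invf_le1.
have AK : A * eta < 1 by apply: etaK; rewrite /K; lra.
have BK : B * eta < 1 by apply: etaK; rewrite /K; lra.
have DK : D * eta < 1 by apply: etaK; rewrite /K; lra.
have eta3 : eta * (`|e| + 1) < r / 2.
  by move: BK; rewrite /B mulrAC ltr_pdivrMr ?divr_gt0// mul1r mulrC.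
have eta4 : C * eta < d / 2.
  by move: DK; rewrite /D mulrAC ltr_pdivrMr ?divr_gt0// mul1r.
pose r' := Num.min (r / 2) (d / (2 * (C + 1))).
have r'0 : 0 < r' by rewrite lt_min !divr_gt0// mulr_gt0// ltr_wpDl.
exists r', eta, e; split => // x t w; rewrite -ball_normE /= distrC => xr Ox /andP[t0 te] we.
have xr1 : `|x - x0| < r / 2 by apply: lt_le_trans xr _; rewrite ge_min lexx.
have xr2 : C * `|x - x0| < d / 2.
  have : `|x - x0| < d / (2 * (C + 1)) by apply: lt_le_trans xr _; rewrite ge_min lexx orbT.
  have C1 : 0 < C + 1 by lra.
  rewrite ltr_pdivlMr ?mulr_gt0// => h.
  have h1 := normr_ge0 (x - x0); nra.
have tw : `|t *: w| <= eta.
  rewrite normrZ gtr0_norm//; apply: le_trans (ler_pM (ltW t0) (normr_ge0 _) te we) _.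
  by rewrite ler_piMl// ltW.
have sh : `|t *: (e + w)| < r / 2.
  rewrite normrZ gtr0_norm//; apply: le_lt_trans eta3.
  apply: ler_pM => //; first exact: ltW.
  apply: le_trans (ler_normD _ _) _; rewrite lerD2l; exact: le_trans eta1.
have xin : ball x0 r x by rewrite -ball_normE /= distrC; lra.
have zin : ball x0 r (x + t *: (e + w)).
  rewrite -ball_normE /= distrC (addrAC x); apply: le_lt_trans (ler_normD _ _) _; lra.
apply/(OQ _ zin); have /(OQ _ xin) gx := Ox.
have zQ : (x + t *: (e + w)) *m Q = x *m Q + t *: unit_rV i + t *: (w *m Q).
  by rewrite mulmxDl -scalemxAl mulmxDl eQ scalerDr addrA.
have cz : col' i ((x + t *: (e + w)) *m Q) = col' i (x *m Q) + t *: col' i (w *m Q).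
  by apply/rowP => j; rewrite zQ !mxE eq_sym (negbTE (neq_lift i j)) andbF mulr0 addr0.
have nx : `|col' i (x *m Q) - col' i (x0 *m Q)| < d / 2.
  rewrite -linearB -mulmxBl; apply: le_lt_trans (col'_norm_le _ _) _.
  exact: le_lt_trans (QC _) xr2.
have nw : `|col' i (w *m Q)| <= C * `|w|.
  by apply: le_trans (col'_norm_le _ _) _; exact: QC.
have nt : `|t *: col' i (w *m Q)| < d / 2.
  apply: le_lt_trans eta4; rewrite -linearZ scalemxAl.
  apply: le_trans (col'_norm_le _ _) _; apply: le_trans (QC _) _.
  by rewrite ler_wpM2l.
pose q := C * eta.
have wq : `|w *m Q| <= q by apply: le_trans (QC _) _; rewrite ler_wpM2l.
have Lq : (L + 1) * q < 1.
  apply: le_lt_trans AK; rewrite /A /q mulrA ler_pM2r// ler_wpM2l//; lra.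
have H : `|g (col' i (x *m Q) + t *: col' i (w *m Q)) - g (col' i (x *m Q))| <= L * (t * q).
  apply: le_trans (gL _ _ _ _) _.
  - by rewrite addrAC; apply: le_lt_trans (ler_normD _ _) _; lra.
  - by lra.
  rewrite ler_wpM2l// addrC addKr normrZ gtr0_norm// ler_pM2l//.
  exact: le_trans (col'_norm_le _ _) wq.
have zi : ((x + t *: (e + w)) *m Q) 0 i = (x *m Q) 0 i + t + t * (w *m Q) 0 i.
  rewrite zQ; move: (x *m Q) (w *m Q) => a b.
  by rewrite !mxE !eqxx mulr1.
rewrite cz zi.
have wi : `|(w *m Q) 0 i| <= q by apply: le_trans wq; exact: coord_le_norm.
move: H wi; rewrite !ler_norml => /andP[_ H] /andP[wi _].
have tq : t * ((L + 1) * q) < t by rewrite -[ltRHS]mulr1 ltr_pM2l.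
have twi := ler_wpM2l (ltW t0) wi.
move: H gx tq twi; move: (g _) (g _) ((x *m Q) 0 i) ((w *m Q) 0 i) => a b c s; lra.
Qed.

End cone_property.

(** * Translation differences controlled by the gradient *)

Section difference_estimate.
Context {R : realType} {N : nat}.
Local Notation rV := 'rV[R]_N.
Local Notation mu := (lebesgue_rV (R := R) N).
Local Notation e_ i := (unit_rV (R := R) i).
Variable Omega : set rV.
Hypothesis oO : open Omega.
Implicit Types (u phi psi : rV -> R) (g : 'I_N -> rV -> R).
Local Notation sqO := (sqint mu Omega).
Local Notation ipO := (ip mu Omega).

Let mO : measurable Omega. Proof. exact: open_rV_measurable. Qed.

Lemma sqint_loc_integrable u : sqint mu setT u -> loc_integrable u.
Proof.
move=> [mu_ iu]; split => // r; have mB := @ball_rV_measurable R N 0 r.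
have i1 : mu.-integrable (ball 0 r) (EFin \o (fun=> 1 : R)).
  apply: measurable_bounded_integrable => //.
    by apply: lebesgue_rV_bounded => //; exact: ball0_bounded.
  by exists 1; split => // y y1 x _ /=; rewrite normr1 ltW.
apply: (le_integrable mB _ _ (integrableD mB i1 (integrableS measurableT mB (@subsetT _ _) iu))).
  by apply/measurable_EFinP; exact: measurable_funTS.
move=> x _ /=; rewrite lee_fin [leRHS]ger0_norm ?addr_ge0 ?sqr_ge0//.
have := sqr_ge0 (`|u x| - 1); rewrite -[u x ^+ 2]real_normK ?num_real//; nra.
Qed.

Definition weak_gradient u g :=
  [/\ sqO u, forall i, sqO (g i) & forall i, weak_deriv Omega [:: i] u (g i)].

Lemma nrm_shift phi (h : rV) : continuous phi ->
  nrm mu setT (fun x => phi (x + h)) = nrm mu setT phi.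
Proof.
move=> cp; rewrite /nrm /ip.
rewrite (@Rintegral_rV_shift _ _ h (fun x => phi x * phi x))//.
by apply: measurable_funM; exact: continuous_rV_measurable.
Qed.

Lemma nrm_sub_le phi : sqint mu setT phi -> nrm mu Omega phi <= nrm mu setT phi.
Proof.
move=> hp; rewrite ler_sqrt ?ip_ge0// -lee_fin !ipE//; last exact: sqint_sub.
apply: ge0_subset_integral => //.
  by apply/measurable_EFinP/measurable_funX; have [] := hp.
by move=> x _; rewrite lee_fin sqr_ge0.
Qed.

(* By duality: F s := ip u (phi (. - s h)) has derivative
   \sum_i h_i ip (g i) (phi (. - s h)). *)
Lemma difference_estimate u g (K : set rV) (h : rV) : weak_gradient u g -> open K ->
  (forall x s, K x -> 0 <= s <= 1 -> Omega (x + s *: h)) ->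
  nrm mu setT ((fun x => (u \_ Omega) (x + h) - (u \_ Omega) x) \_ K) <=
    `|h| * \sum_i nrm mu Omega (g i).
Proof.
move=> [hu hg wg] oK Kh.
have mK := open_rV_measurable oK.
pose ut := u \_ Omega.
have hut : sqint mu setT ut := sqint_patch oO hu.
have mut : measurable_fun setT ut by have [] := hut.
have huth : sqint mu setT (fun x => ut (x + h)).
  have [_ iut] := hut; split.
    by apply: measurableT_comp => //; exact: measurable_shift.
  exact: (integrable_rV_shift h iut).
have hw := sqintB measurableT huth hut.
have hwK : sqint mu setT ((fun x => ut (x + h) - ut x) \_ K).
  exact: (sqint_patch oK (sqint_sub oK hw)).
apply: (test_dual_bound oK hwK).
- exact: patch_zero_off.
- by rewrite mulr_ge0// sumr_ge0// => i _; exact: nrm_ge0.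
move=> phi tp.
have hp := test_function_sqint tp.
have cp := test_function_continuous tp.
have [cphi _ _] := tp; have [r r0 phi0] := test_function_ball tp.
rewrite ip_patch -(ip_setT_test _ tp) ipBl//.
pose F (s : R) := \int[mu]_x (ut x * phi (x + s *: (- h))).
have dF (s : R) := is_derive_shift_integral (- h) s (sqint_loc_integrable hut) (cphi 1%N) phi0.
have cF : {within `[0, 1], continuous F}.
  by apply: continuous_subspaceT; apply: derivable_continuous1 => s; have [] := dF s.
have [c] := MVT_segment ler01 (fun s _ => dF s) cF.
rewrite in_itv /= => c01; rewrite subr0 mulr1 => E.
(* The segment condition acts here: every intermediate shift of [phi] is a test function of [Omega],
   so the weak derivatives can be tested against it. *)
have tps s : 0 <= s <= 1 -> test_function Omega (fun x => phi (x + s *: (- h))).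
  move=> s01; have := test_function_shift (h := s *: h) (fun x Kx => Kh x s Kx s01) tp.
  by under eq_fun do rewrite -scalerN.
have e1 : ip mu setT (fun x => ut (x + h)) phi = F 1.
  rewrite /ip /F -(@Rintegral_rV_shift _ _ h (fun x => ut x * phi (x + 1 *: - h))).
    by apply: eq_Rintegral => x _; rewrite scale1r addrK.
  apply: measurable_funM => //; apply: continuous_rV_measurable.
  exact: shift_continuous.
have e0 : ip mu setT ut phi = F 0.
  by rewrite /ip /F; apply: eq_Rintegral => x _; rewrite scale0r addr0.
rewrite e1 e0 E.
have tpc := tps c c01.
have E2 : \int[mu]_x (ut x * dirD (- h) phi (x + c *: - h)) =
    \sum_i h 0 i * ipO (g i) (fun x => phi (x + c *: - h)).
  transitivity (ipO u (fun x => \sum_i - h 0 i * 'D_(e_ i) (fun x => phi (x + c *: - h)) x)).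
    apply: etrans; last exact: ip_patch.
    apply: eq_Rintegral => x _; congr (_ * _).
    by apply: eq_bigr => i _; rewrite mxE; have [-> _] := derive_shift phi (c *: - h) x (e_ i).
  have hD i : sqO ('D_(e_ i) (fun x => phi (x + c *: - h))).
    by apply: test_sqO => //; exact: test_function_derive.
  rewrite ipC.
  have : forall r : seq 'I_N, ipO (fun x => \sum_(i <- r) - h 0 i * 'D_(e_ i) (fun x => phi (x + c *: - h)) x) u =
      \sum_(i <- r) h 0 i * ipO (g i) (fun x => phi (x + c *: - h)).
    elim=> [|i l IH].
      rewrite big_nil /ip; under eq_Rintegral do rewrite big_nil mul0r.
      by rewrite Rintegral_cst// mul0r.
    rewrite big_cons -IH.
    rewrite (_ : (fun x => \sum_(i <- i :: l) _) = (fun x => - h 0 i * 'D_(e_ i) (fun x => phi (x + c *: - h)) x +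
       \sum_(i <- l) - h 0 i * 'D_(e_ i) (fun x => phi (x + c *: - h)) x)); last first.
      by apply/funext => x; rewrite big_cons.
    rewrite ipDl//; last 2 first.
    - exact: sqintZ.
    - by apply: sqint_sum => // j; exact: sqintZ.
    congr (_ + _); rewrite ipZl// ipC; have /weak_derivE := wg i => /(_ _ tpc) /= ->.
    by rewrite expr1 mulN1r mulrNN.
  by exact.
rewrite E2; apply: le_trans (ler_norm _) _; apply: le_trans (ler_norm_sum _ _ _) _.
rewrite mulr_sumr mulr_suml; apply: ler_sum => i _.
rewrite normrM -mulrA; apply: ler_pM => //; first exact: coord_le_norm.
apply: le_trans (ip_le_nrm mO (hg i) (test_sqO oO tpc)) _.
rewrite ler_wpM2l ?nrm_ge0//; apply: le_trans (nrm_sub_le (test_function_sqint tpc)) _.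
by rewrite nrm_shift.
Qed.

End difference_estimate.

(** * Poincare's inequality on one cell *)

Section poincare.
Context {R : realType} {N : nat}.
Local Notation rV := 'rV[R]_N.
Local Notation mu := (lebesgue_rV (R := R) N).
Variable Omega : set rV.
Hypothesis oO : open Omega.
Implicit Types (u phi psi : rV -> R) (g : 'I_N -> rV -> R) (A H K P : set rV).
Local Notation sqO := (sqint mu Omega).
Local Notation ipO := (ip mu Omega).

Let mO : measurable Omega. Proof. exact: open_rV_measurable. Qed.

Definition sqr_diff u (z : rV * rV) : \bar R :=
  (((u \_ Omega) (z.1 + z.2) - (u \_ Omega) z.1) ^+ 2)%:E.

Lemma measurable_sqr_diff u : sqO u -> measurable_fun setT (sqr_diff u).
Proof.
move=> [mu_ _]; have mut : measurable_fun setT (u \_ Omega).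
  exact: (proj1 (measurable_restrictT _ mO) mu_).
apply/measurable_EFinP; apply: measurable_funX; apply: measurable_funB.
  apply: measurableT_comp => //; apply: measurable_fun_rV => i.
  rewrite (_ : (fun _ => _) = (fun z : rV * rV => z.1 0 i + z.2 0 i)); last first.
    by apply/funext => z; rewrite mxE.
  by apply: measurable_funD; apply: (measurableT_comp (measurable_coord i)).
exact: measurableT_comp.
Qed.

(** The set of displacements enters as an indicator, so that Tonelli's theorem applies on the whole
    product space. *)
Definition increment u (H : set rV) (x : rV) : \bar R :=
  (\int[mu]_h (sqr_diff u (x, h) * (\1_H h)%:E))%E.

Lemma measurable_sqr_diff_indic u H : sqO u -> measurable H ->
  measurable_fun setT (fun z : rV * rV => sqr_diff u z * (\1_H z.2)%:E)%E.
Proof.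
move=> hu mH; apply: emeasurable_funM; first exact: measurable_sqr_diff.
have m1 : measurable_fun setT (\1_H : rV -> R) by exact: measurable_indic.
apply/measurable_EFinP; exact: (measurableT_comp m1 measurable_snd).
Qed.

Lemma sqr_diff_indic_ge0 u H z : (0 <= sqr_diff u z * (\1_H z.2)%:E)%E.
Proof. by rewrite mule_ge0// lee_fin ?sqr_ge0// indicE ler0n. Qed.

Lemma measurable_increment u H : sqO u -> measurable H -> measurable_fun setT (increment u H).
Proof.
move=> hu mH.
have := @measurable_fun_fubini_tonelli_F _ _ _ _ _ (leb_rV (R := R) (N := N)) _
  (measurable_sqr_diff_indic hu mH) (sqr_diff_indic_ge0 u H).
exact.
Qed.

Lemma increment_ge0 u H x : (0 <= increment u H x)%E.
Proof. by apply: integral_ge0 => h _; exact: (sqr_diff_indic_ge0 u H (x, h)). Qed.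

(* [u x] is compared with the mean of [u] with respect to the weight [psi / I]. *)
Lemma pointwise_mean_bound u psi (x : rV) (I : R) : sqO u -> test_function Omega psi ->
  (forall y, 0 <= psi y <= 1) -> I = \int[mu]_y psi y -> 0 < I -> Omega x ->
  forall H, measurable H -> (forall h, psi (x + h) != 0 -> H h) ->
  ((u x ^+ 2)%:E <= (2 / I)%:E * increment u H x + (4 * ipO u psi ^+ 2 / I ^+ 2)%:E)%E.
Proof.
move=> hu tp psi01 IE I0 Ox H mH hH.
pose ut := u \_ Omega.
have hut : sqint mu setT ut := sqint_patch oO hu.
have [mut iut] := hut.
have cp := test_function_continuous tp; have mp := continuous_rV_measurable cp.
have hp := test_function_sqint tp.
have utx : ut x = u x by rewrite /ut patchE mem_set.
have ip1 : mu.-integrable setT (EFin \o psi).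
  have [r r0 psi0] := test_function_ball tp.
  apply: (zero_off_integrable mp psi0); exists 1 => y.
  by have /andP[a b] := psi01 y; rewrite ger0_norm.
have ip2 : mu.-integrable setT (EFin \o (fun y => ut y * psi y)) by exact: ip_integrable.
have ip3 : mu.-integrable setT (EFin \o (fun y => psi y * ut y ^+ 2)).
  apply: (le_integrable measurableT _ _ iut).
    by apply/measurable_EFinP; apply: measurable_funM => //; exact: measurable_funX.
  move=> y _ /=; rewrite lee_fin normrM ler_piMl//.
  by have /andP[a b] := psi01 y; rewrite ger0_norm.
pose q y := psi y * (ut y - ut x) ^+ 2.
have mq : measurable_fun setT q.
  by apply: measurable_funM => //; apply: measurable_funX; exact: measurable_funB.
have q0 y : 0 <= q y by rewrite mulr_ge0 ?sqr_ge0//; have /andP[] := psi01 y.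
have qE y : q y = psi y * ut y ^+ 2 - 2 * ut x * (ut y * psi y) + ut x ^+ 2 * psi y.
  by rewrite /q; ring.
have iq : mu.-integrable setT (EFin \o q).
  have := integrableD measurableT (integrableB measurableT ip3
    (integrableZl measurableT (2 * ut x) ip2)) (integrableZl measurableT (ut x ^+ 2) ip1).
  by apply: eq_integrable => // y _ /=; rewrite qE.
have Iq : \int[mu]_y q y = \int[mu]_y (psi y * ut y ^+ 2) - 2 * ut x * ipO u psi + ut x ^+ 2 * I.
  under eq_Rintegral do rewrite qE.
  have i2 : mu.-integrable setT (EFin \o (fun y => 2 * ut x * (ut y * psi y))).
    have := integrableZl measurableT (2 * ut x) ip2.
    by apply: eq_integrable => // y _ /=.
  have i3 : mu.-integrable setT (EFin \o (fun y => ut x ^+ 2 * psi y)).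
    have := integrableZl measurableT (ut x ^+ 2) ip1.
    by apply: eq_integrable => // y _ /=.
  have i1 : mu.-integrable setT (EFin \o (fun y => psi y * ut y ^+ 2 - 2 * ut x * (ut y * psi y))).
    have := integrableB measurableT ip3 i2.
    by apply: eq_integrable => // y _ /=.
  rewrite RintegralD// RintegralB// !RintegralZl//.
  have -> : \int[mu]_y (ut y * psi y) = ipO u psi by exact: ip_patch.
  by rewrite -IE.
have A0 : 0 <= \int[mu]_y (psi y * ut y ^+ 2).
  by apply: Rintegral_ge0 => y _; rewrite mulr_ge0 ?sqr_ge0//; have /andP[] := psi01 y.
have key : u x ^+ 2 <= 2 / I * \int[mu]_y q y + 4 * ipO u psi ^+ 2 / I ^+ 2.
  rewrite Iq utx; set m := ipO u psi; set A := \int[mu]_y _.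
  (* Completing the square: the right-hand side exceeds [u x ^+ 2] by a square and by
     [2 / I * A]. *)
  have -> : 2 / I * (A - 2 * u x * m + u x ^+ 2 * I) + 4 * m ^+ 2 / I ^+ 2 =
     2 / I * A + (u x - 2 * m / I) ^+ 2 + u x ^+ 2 by field; rewrite gt_eqF.
  by rewrite lerDr addr_ge0 ?sqr_ge0// mulr_ge0// divr_ge0// ltW.
apply: (@le_trans _ _ ((2 / I * \int[mu]_y q y + 4 * ipO u psi ^+ 2 / I ^+ 2)%:E)).
  by rewrite lee_fin.
rewrite EFinD leeD2r// EFinM lee_pmul2l// ?lte_fin ?divr_gt0//.
have -> : (\int[mu]_y q y)%:E = (\int[mu]_y (q y)%:E)%E.
  by rewrite /Rintegral fineK//; exact: integrable_fin_num.
rewrite -(integral_rV_shift x); last exact/measurable_EFinP.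
apply: ge0_le_integral => //.
- by move=> h _; rewrite lee_fin.
- apply/measurable_EFinP; apply: (measurableT_comp mq); exact: measurable_shift.
- exact: (measurableT_comp (measurable_sqr_diff_indic hu mH) (pair1_measurable x)).
move=> h _; rewrite /sqr_diff /= /q (addrC h) indicE.
have [p0|p0] := eqVneq (psi (x + h)) 0.
  by rewrite p0 mul0r -EFinM lee_fin mulr_ge0 ?sqr_ge0.
rewrite (mem_set (hH _ p0)) mule1 lee_fin ler_piMl ?sqr_ge0//.
by have /andP[] := psi01 (x + h).
Qed.

(** The integrals tend to the volume of the cube. Half of it suffices to bound the factor [2 / I] of
    [pointwise_mean_bound] by [4 / (2 * s) ^+ N], which no longer depends on the bump. *)
Lemma bump_integral_gt (c : rV) (s : R) : 0 < s -> exists n,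
  (2 * s) ^+ N / 2 <= \int[mu]_y bump c s n y.
Proof.
move=> s0; have mB := ball_rV_measurable c s.
have mb n : measurable_fun setT (bump c s n).
  by apply: continuous_rV_measurable; exact: class_C_continuous (bump_class_C c s n 0).
have V0 : 0 < (2 * s) ^+ N by rewrite exprn_gt0// mulr_gt0.
have mBE := lebesgue_rV_ball c s0.
have [i1 _] := indic_sqint mB (eq_ind_r (fun z => z < +oo)%E (ltry _) mBE).
have i2 : mu.-integrable setT (EFin \o (\1_(ball c s) : rV -> R)).
  have [_] := indic_sqint mB (eq_ind_r (fun z => z < +oo)%E (ltry _) mBE).
  apply: eq_integrable => // y _ /=.
  by rewrite indicE; case: (_ \in _); rewrite ?expr1n ?expr0n.
have cv : (\int[mu]_y (bump c s n y)%:E)%E @[n --> \oo] --> (\int[mu]_y (\1_(ball c s) y)%:E)%E.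
  apply: (@dominated_cvg _ _ _ mu setT measurableT _ _ (EFin \o (\1_(ball c s) : rV -> R))) => //.
  - by move=> n; exact/measurable_EFinP.
  - move=> y _; apply: cvg_EFin; first by near=> n.
    rewrite indicE; have [yB|yB] := pselect (ball c s y).
      by rewrite mem_set//; exact: bump_cvg.
    rewrite memNset// (_ : (fine \o _) = cst 0); first exact: cvg_cst.
    by apply/funext => n /=; rewrite bump_zero_off.
  move=> n y _ /=; rewrite lee_fin indicE; have /andP[b0 b1] := bump01 c s n y.
  rewrite ger0_norm//; have [yB|yB] := pselect (ball c s y); first by rewrite mem_set.
  by rewrite memNset// bump_zero_off.
rewrite integral_indic// setIT mBE in cv.
have cv' : fine (\int[mu]_y (bump c s n y)%:E)%E @[n --> \oo] --> ((2 * s) ^+ N : R).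
  exact: fine_cvg cv.
have h : (2 * s) ^+ N / 2 < (2 * s) ^+ N by rewrite ltr_pdivrMr// ltr_pMr// ltr1n.
have [n _ hn] := cvgr_ge _ cv' _ h.
by exists n; exact: (hn n (leqnn n)).
Unshelve. all: by end_near.
Qed.

Definition testfun := {psi : rV -> R | test_function Omega psi}.

(** The cell about [p] is compared with the mean over the cube about [p + d], which must lie in
    [Omega]. Both have half-side [s], so displacements between them lie in [ball d (2 * s)]. The
    bound holds on any part [P] of the cell, so that overlaps of cells can be removed later. *)
Lemma cell_bound K (p d : rV) (s : R) : 0 < s -> K `<=` Omega ->
  (forall x y, K x -> ball p s x -> `|p + d - y| <= s -> Omega y) ->
  exists (psi : testfun) (C : R), 0 <= C /\ forall u P, sqO u -> measurable P ->
    P `<=` K `&` ball p s ->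
  (\int[mu]_(x in P) ((u x ^+ 2)%:E) <=
   (4 / (2 * s) ^+ N)%:E * \int[mu]_(x in P) increment u (ball d (2 * s)) x +
   (C * ipO u (sval psi) ^+ 2)%:E)%E.
Proof.
move=> s0 KO hK; have V0 : 0 < (2 * s) ^+ N by rewrite exprn_gt0// mulr_gt0.
set V := (2 * s) ^+ N in V0 *.
(* An empty cell is treated apart: a point of the cell is needed to know that the translated cube
   lies in [Omega]. *)
have [KB|KB] := eqVneq (K `&` ball p s) set0.
  exists (exist _ _ (test_function0 Omega)), 0; split => // u P _ _.
  rewrite KB subset0 => ->; rewrite !integral_set0 mule0 mul0r adde0 //.
have [x0 [Kx0 px0]] : exists x, (K `&` ball p s) x by exact/set0P.
have [n hn] := bump_integral_gt (p + d) s0.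
set psi := bump (p + d) s n in hn; set I := \int[mu]_y _ in hn.
have I0 : 0 < I by apply: lt_le_trans hn; rewrite divr_gt0.
have tp : test_function Omega psi.
  by apply: bump_test => // y /= yp; exact: (hK x0 y).
have mH : measurable (ball d (2 * s)) by exact: ball_rV_measurable.
exists (exist _ psi tp), (4 / I ^+ 2 * V); split.
  by rewrite mulr_ge0 ?divr_ge0 ?sqr_ge0// ltW.
move=> u P hu mP PK /=.
have muP : (mu P <= V%:E)%E.
  rewrite -(lebesgue_rV_ball p s0); apply: le_measure; rewrite ?inE//.
    exact: ball_rV_measurable.
  by move=> x /PK[].
have mi := measurable_increment hu mH.
have Kpt x : P x -> ((u x ^+ 2)%:E <= (4 / V)%:E * increment u (ball d (2 * s)) x +
    (4 * ipO u psi ^+ 2 / I ^+ 2)%:E)%E.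
  move=> Px; have [Kx px] := PK x Px.
  apply: le_trans (pointwise_mean_bound hu tp (bump01 _ _ _) erefl I0 (KO _ Kx) mH _) _.
    move=> h hp; apply: contrapT => xh; move/eqP: hp; apply.
    apply: bump_zero_off => // xb; apply: xh; move: xb px; rewrite -!ball_normE /=.
    have -> : d - h = (p + d - (x + h)) - (p - x).
      by rewrite !opprD !addrA opprK; apply/rowP => i; rewrite !mxE; ring.
    move=> h1 h2; apply: le_lt_trans (ler_normB _ _) _; lra.
  rewrite -/I leeD2r// lee_wpmul2r ?increment_ge0// lee_fin.
  rewrite ler_pdivrMr// mulrAC ler_pdivlMr//.
  have : V / 2 <= I by exact: hn.
  by rewrite ler_pdivrMr//; clear; move: V I => V' I'; lra.
have mu2 : measurable_fun P (fun x => (u x ^+ 2)%:E).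
  apply/measurable_EFinP/measurable_funX; apply: measurable_funS hu.1 => //.
  by move=> x /PK[/KO].
have mi2 : measurable_fun P (fun x => (4 / V)%:E * increment u (ball d (2 * s)) x)%E.
  by apply: emeasurable_funM => //; exact: measurable_funTS.
have V40 : 0 <= 4 / V by rewrite divr_ge0// ltW.
have c0 : 0 <= 4 * ipO u psi ^+ 2 / I ^+ 2.
  by apply: divr_ge0; [apply: mulr_ge0 => //; exact: sqr_ge0|exact: sqr_ge0].
apply: (@le_trans _ _ (\int[mu]_(x in P) ((4 / V)%:E * increment u (ball d (2 * s)) x +
    (4 * ipO u psi ^+ 2 / I ^+ 2)%:E))%E).
  apply: ge0_le_integral => //.
  - by move=> x _; rewrite lee_fin sqr_ge0.
  - exact: emeasurable_funD.
rewrite ge0_integralD//; last by move=> x _; rewrite mule_ge0 ?increment_ge0 ?lee_fin.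
rewrite ge0_integralZl//; try by [exact: measurable_funTS|move=> x _; exact: increment_ge0].
rewrite leeD2l// integral_cst//.
apply: (@le_trans _ _ ((4 * ipO u psi ^+ 2 / I ^+ 2)%:E * V%:E)%E).
  by rewrite lee_wpmul2l// lee_fin.
by rewrite -EFinM lee_fin le_eqVlt; apply/orP; left; apply/eqP; ring.
Qed.

End poincare.

(** * Poincare's inequality on the whole domain *)

Section global_poincare.
Context {R : realType} {N : nat}.
Local Notation rV := 'rV[R]_N.
Local Notation mu := (lebesgue_rV (R := R) N).
Variable Omega : set rV.
Hypothesis oO : open Omega.
Implicit Types (u phi psi : rV -> R) (g : 'I_N -> rV -> R) (A H K P : set rV).
Local Notation sqO := (sqint mu Omega).
Local Notation ipO := (ip mu Omega).

Let mO : measurable Omega. Proof. exact: open_rV_measurable. Qed.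

Definition near_some (ps : seq rV) (s : R) : set rV :=
  [set x | exists2 p, p \in ps & ball p s x].

Lemma finite_ball_cover A (s : R) : compact A -> 0 < s ->
  exists ps : seq rV, A `<=` near_some ps s.
Proof.
move=> cA s0; move: cA; rewrite compact_cover => /(_ rV setT (fun p => ball p s)).
case=> [p _|x _|D' _ AD'].
- exact: ball_open.
- by exists x => //; exact: ballxx.
exists (finmap.enum_fset D') => x /AD'[p pD px].
by exists p.
Qed.

Lemma near_some_cons p ps s : near_some (p :: ps) s = near_some ps s `|` ball p s.
Proof.
apply/seteqP; split => x /=.
  by move=> [q]; rewrite inE => /orP[/eqP ->|qs qx]; [right|left; exists q].
move=> [[q qs qx]|px]; first by exists q => //; rewrite inE qs orbT.
by exists p => //; rewrite inE eqxx.
Qed.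

Lemma near_some_measurable ps s : measurable (near_some ps s).
Proof.
elim: ps => [|p ps IH].
  by rewrite (_ : near_some [::] s = set0)//; apply/seteqP; split => // x [].
by rewrite near_some_cons; apply: measurableU => //; exact: ball_rV_measurable.
Qed.

(** Each new cell is deprived of the previous ones, so the increments are integrated once and their
    coefficient is independent of the number of cells. Only [C] and the list of test functions
    grow. *)
Lemma cells_bound K (d : rV) (s : R) (ps : seq rV) : 0 < s -> K `<=` Omega -> measurable K ->
  (forall p x y, K x -> ball p s x -> `|p + d - y| <= s -> Omega y) ->
  exists (psis : seq (testfun Omega)) (C : R), 0 <= C /\ forall u, sqO u ->
  (\int[mu]_(x in K `&` near_some ps s) ((u x ^+ 2)%:E) <=
   (4 / (2 * s) ^+ N)%:E * \int[mu]_(x in K `&` near_some ps s) increment Omega u (ball d (2 * s)) x +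
   (C * \sum_(psi <- psis) ipO u (sval psi) ^+ 2)%:E)%E.
Proof.
move=> s0 KO mK hK; elim: ps => [|p ps [psis [C [C0 IH]]]].
  exists [::], 0; split => // u _.
  have -> : near_some [::] s = set0 by apply/seteqP; split => // x [].
  by rewrite setI0 !integral_set0 mule0 big_nil mulr0 adde0.
have [psi [D [D0 hD]]] := cell_bound oO s0 KO (hK p).
have V0 : 0 < (2 * s) ^+ N by rewrite exprn_gt0// mulr_gt0.
exists (psi :: psis), (C + D); split; first by rewrite addr_ge0.
move=> u hu; have mB := ball_rV_measurable p s.
have mH : measurable (ball d (2 * s)) by exact: ball_rV_measurable.
have mn := near_some_measurable ps s.
pose P := (K `&` ball p s) `\` near_some ps s.
have mP : measurable P by apply: measurableD => //; exact: measurableI.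
have PE : K `&` near_some (p :: ps) s = (K `&` near_some ps s) `|` P.
  rewrite near_some_cons; apply/seteqP; split => x.
    move=> [Kx [nx|px]]; first by left.
    have [nx|nx] := pselect (near_some ps s x); first by left.
    by right.
  by move=> [[Kx nx]|[[Kx px] nx]]; split => //; [left|right].
have mu2 A : measurable A -> A `<=` K -> measurable_fun A (fun x => (u x ^+ 2)%:E).
  move=> mA AK; apply/measurable_EFinP/measurable_funX; apply: measurable_funS hu.1 => //.
  exact: subset_trans KO.
have dj : [disjoint K `&` near_some ps s & P].
  by apply/disj_setPLR => x [_ nx] [_]; apply.
have mKn : measurable (K `&` near_some ps s) by exact: measurableI.
have f0 x : ((K `&` near_some ps s) `|` P) x -> (0 <= (u x ^+ 2)%:E)%E.
  by move=> _; rewrite lee_fin sqr_ge0.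
have i0 x : ((K `&` near_some ps s) `|` P) x -> (0 <= increment Omega u (ball d (2 * s)) x)%E.
  by move=> _; exact: increment_ge0.
have mf : measurable_fun ((K `&` near_some ps s) `|` P) (fun x => (u x ^+ 2)%:E).
  by apply: mu2; [exact: measurableU|move=> x [[]|[[]]]].
have mi : measurable_fun ((K `&` near_some ps s) `|` P) (increment Omega u (ball d (2 * s))).
  exact: measurable_funTS (measurable_increment oO hu mH).
rewrite PE (ge0_integral_setU mu mKn mP mf f0 dj) (ge0_integral_setU mu mKn mP mi i0 dj).
have h1 := IH u hu; have h2 := hD u P hu mP (@subDsetl _ _ _).
apply: le_trans (leeD h1 h2) _.
have J0 A : (0 <= \int[mu]_(x in A) increment Omega u (ball d (2 * s)) x)%E.
  by apply: integral_ge0 => x _; exact: increment_ge0.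
move: (J0 (K `&` near_some ps s)) (J0 P).
move: (integral _ (K `&` near_some ps s) _) (integral _ P _) => J1 J2 J10 J20.
rewrite ge0_muleDr// addeACA leeD2l// -EFinD lee_fin big_cons mulrDr addrC.
apply: lerD.
  by rewrite ler_wpM2r ?sqr_ge0// lerDr.
by rewrite ler_wpM2r ?sumr_ge0 ?lerDl// => q _; rewrite sqr_ge0.
Qed.

(** Once the integrals are exchanged, [difference_estimate] applies for each fixed [h]; the last
    factor is the volume of the set of displacements. *)
Lemma increment_total u g K (d : rV) (s b : R) : weak_gradient Omega u g -> 0 < s -> 0 <= b ->
  open K -> (forall h, ball d s h -> `|h| <= b) ->
  (forall x h t, K x -> ball d s h -> 0 <= t <= 1 -> Omega (x + t *: h)) ->
  (\int[mu]_(x in K) increment Omega u (ball d s) x <=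
    (((b * \sum_i nrm mu Omega (g i)) ^+ 2 * (2 * s) ^+ N)%:E))%E.
Proof.
move=> wg s0 b0 oK hb hK; have [hu _ _] := wg.
have mK := open_rV_measurable oK; have mH := ball_rV_measurable d s.
set G := \sum_i _.
have G0 : 0 <= G by rewrite sumr_ge0// => i _; exact: nrm_ge0.
pose F (z : rV * rV) : \bar R := (sqr_diff Omega u z * (\1_(ball d s) z.2)%:E * (\1_K z.1)%:E)%E.
have mF : measurable_fun setT F.
  apply: emeasurable_funM; first exact: (measurable_sqr_diff_indic oO).
  have m1 : measurable_fun setT (\1_K : rV -> R) by exact: measurable_indic.
  by apply/measurable_EFinP; exact: (measurableT_comp m1 measurable_fst).
have F0 z : (0 <= F z)%E.
  by rewrite mule_ge0 ?sqr_diff_indic_ge0// lee_fin indicE ler0n.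
have -> : (\int[mu]_(x in K) increment Omega u (ball d s) x = \int[mu]_x \int[mu]_h F (x, h))%E.
  rewrite [LHS]integral_mkcond; apply: eq_integral => x _.
  rewrite patchE /F /= indicE; case: ifPn => _.
    by apply: eq_integral => h _; rewrite mule1.
  by apply/esym; apply: integral0_eq => h _; rewrite mule0.
rewrite (tonelli_rV mF F0).
apply: (@le_trans _ _ (\int[mu]_h (((b * G) ^+ 2)%:E * (\1_(ball d s) h)%:E))%E).
  apply: ge0_le_integral => //.
  - by move=> h _; exact: integral_ge0.
  - have := @measurable_fun_fubini_tonelli_G _ _ _ _ _ (leb_rV (R := R) (N := N)) _ mF F0.
    exact.
  - apply: emeasurable_funM => //; apply/measurable_EFinP; exact: measurable_indic.
  move=> h _; rewrite indicE.
  have [hB|hB] := pselect (ball d s h); last first.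
    rewrite memNset// mule0 integral0_eq// => x _.
    by rewrite /F /= indicE memNset// mule0 mul0e.
  rewrite mem_set// mule1.
  have de := difference_estimate oO wg oK (fun x t Kx t01 => hK x h t Kx hB t01).
  pose w := (fun x => (u \_ Omega) (x + h) - (u \_ Omega) x) \_ K.
  have -> : (\int[mu]_x F (x, h) = \int[mu]_x ((w x ^+ 2)%:E))%E.
    apply: eq_integral => x _; rewrite /F /sqr_diff /= !indicE mem_set// mule1 /w patchE.
    by case: ifPn => _; rewrite ?mule1// mule0 expr0n.
  have hw : sqint mu setT w.
    apply: (sqint_patch oK); apply: (sqint_sub oK).
    have hut := sqint_patch oO hu; have [mut iut] := hut.
    apply: sqintB => //; split.
      by apply: measurableT_comp => //; exact: measurable_shift.
    exact: (integrable_rV_shift h iut).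
  rewrite -ipE// lee_fin -sqr_nrm lerXn2r ?nnegrE ?nrm_ge0 ?mulr_ge0//.
  by apply: le_trans de _; rewrite ler_wpM2r// hb.
rewrite ge0_integralZl//; last 2 first.
- by apply/measurable_EFinP; exact: measurable_indic.
- by rewrite lee_fin sqr_ge0.
by rewrite integral_indic// setIT lebesgue_rV_ball// -EFinM.
Qed.

Definition poincare_on A := measurable A /\ forall e, 0 < e ->
  exists (psis : seq (testfun Omega)) (C : R), 0 <= C /\
  forall u g, weak_gradient Omega u g ->
  (\int[mu]_(x in Omega `&` A) ((u x ^+ 2)%:E) <=
    (e * (\sum_i nrm mu Omega (g i)) ^+ 2 + C * \sum_(psi <- psis) ipO u (sval psi) ^+ 2)%:E)%E.

(** Cells of side [tau * eta] are compared with cubes moved by [tau] along the cone axis. All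
    displacements are at most [tau * B], so the gradient term carries [tau ^+ 2 * M], made small by
    [tau]. *)
Lemma poincare_on_cone x0 : cone_at Omega x0 -> exists2 r, 0 < r & poincare_on (ball x0 r).
Proof.
move=> [r [eta [e [r0 eta0 hO]]]]; exists r => //; split; first exact: ball_rV_measurable.
move=> eps eps0.
pose B := `|e| + eta; have B0 : 0 < B by rewrite ltr_wpDl.
(* The [4] comes from [cell_bound], [2 ^+ N] is the ratio of the volume of the displacements to that
   of a cell, and [tau * B] bounds their length. *)
pose M := 4 * 2 ^+ N * B ^+ 2; have M0 : 0 < M by rewrite !mulr_gt0 ?exprn_gt0.
pose tau := Num.min eta (Num.min 1 (eps / M)).
have tau0 : 0 < tau by rewrite !lt_min eta0 ltr01 divr_gt0.
have te : tau <= eta by rewrite ge_min lexx.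
have t1 : tau <= 1 by rewrite !ge_min lexx orbT.
have tM : tau <= eps / M by rewrite !ge_min lexx !orbT.
pose s := tau * eta / 2; have s0 : 0 < s by rewrite divr_gt0 ?mulr_gt0.
have s2 : 2 * s = tau * eta by rewrite /s; field.
pose K := Omega `&` ball x0 r.
have oK : open K by apply: openI => //; exact: ball_open.
have KO : K `<=` Omega by move=> x [].
have hdir x v : K x -> `|v| <= tau * eta -> forall t, 0 <= t <= 1 ->
    Omega (x + t *: (tau *: e + v)).
  move=> [Ox xr] vt t /andP[t0 t1'].
  have [->|tn0] := eqVneq t 0; first by rewrite scale0r addr0.
  have tp : 0 < t by rewrite lt_neqAle eq_sym tn0.
  have -> : t *: (tau *: e + v) = (t * tau) *: (e + tau^-1 *: v).
    by rewrite !scalerDr !scalerA -mulrA mulfV ?gt_eqF// mulr1.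
  apply: hO => //; first by rewrite mulr_gt0//= (le_trans _ te)// ler_piMl// ltW.
  by rewrite normrZ gtr0_norm ?invr_gt0// mulrC ler_pdivrMr// mulrC.
have [ps Aps] := finite_ball_cover (@closed_ball_compact _ _ x0 r) s0.
have hK p x y : K x -> ball p s x -> `|p + tau *: e - y| <= s -> Omega y.
  move=> Kx; rewrite -ball_normE /= => px py.
  have := hdir x (y - x - tau *: e) Kx; rewrite -s2 => /(_ _ 1).
  rewrite scale1r ler01 lexx => H.
  have -> : y = x + (tau *: e + (y - x - tau *: e)) by apply/rowP => i; rewrite !mxE; ring.
  apply: H => //; have -> : y - x - tau *: e = (p - x) - (p + tau *: e - y).
    by apply/rowP => i; rewrite !mxE; ring.
  by apply: le_trans (ler_normB _ _) _; lra.
have [psis [C [C0 hC]]] := cells_bound ps s0 KO (open_rV_measurable oK) hK.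
exists psis, C; split => // u g wg; have [hu _ _] := wg.
have KE : K `&` near_some ps s = K.
  apply/seteqP; split => x; first by case.
  move=> Kx; split => //; apply: Aps => /=.
  by have [_] := Kx; rewrite -ball_normE /= => /ltW.
have := hC u hu; rewrite KE => /le_trans; apply.
rewrite EFinD leeD2r//.
have hb h : ball (tau *: e) (2 * s) h -> `|h| <= tau * B.
  rewrite -ball_normE /= s2 => hh; rewrite -(subrK (tau *: e) h).
  apply: le_trans (ler_normD _ _) _; rewrite distrC normrZ gtr0_norm// /B mulrDr addrC lerD2l.
  exact: ltW.
have hK2 x h t : K x -> ball (tau *: e) (2 * s) h -> 0 <= t <= 1 -> Omega (x + t *: h).
  move=> Kx; rewrite -ball_normE /= s2 distrC => hh t01.
  by have := hdir x (h - tau *: e) Kx (ltW hh) t t01; rewrite (addrC (tau *: e)) subrK.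
have s20 : 0 < 2 * s by rewrite mulr_gt0.
have tB0 : 0 <= tau * B by rewrite mulr_ge0// ltW.
have := increment_total wg s20 tB0 oK hb hK2.
set G := \sum_i _; set J := (\int[mu]_(x in K) _)%E => hJ.
have V0 : 0 < (2 * s) ^+ N by rewrite exprn_gt0.
apply: (@le_trans _ _ ((4 / (2 * s) ^+ N)%:E * ((tau * B * G) ^+ 2 * (2 * (2 * s)) ^+ N)%:E)%E).
  by rewrite lee_wpmul2l// lee_fin divr_ge0// ltW.
rewrite -EFinM lee_fin (exprMn_comm N (mulrC 2 (2 * s))).
have -> : 4 / (2 * s) ^+ N * ((tau * B * G) ^+ 2 * (2 ^+ N * (2 * s) ^+ N)) =
    tau ^+ 2 * M * G ^+ 2 by rewrite /M; field; rewrite gt_eqF.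
rewrite ler_wpM2r ?sqr_ge0// -ler_pdivlMr//; apply: le_trans tM.
by rewrite expr2 ler_piMl// ltW.
Qed.

Lemma poincare_onU A B : poincare_on A -> poincare_on B -> poincare_on (A `|` B).
Proof.
move=> [mA hA] [mB hB]; split; first exact: measurableU.
move=> e e0; have e20 : 0 < e / 2 by rewrite divr_gt0.
have [p1 [C1 [C10 h1]]] := hA _ e20; have [p2 [C2 [C20 h2]]] := hB _ e20.
exists (p1 ++ p2), (C1 + C2); split; first by rewrite addr_ge0.
move=> u g wg; have [hu _ _] := wg.
have mOA : measurable (Omega `&` A) by exact: measurableI.
have mOB : measurable (Omega `&` B) by exact: measurableI.
have mP : measurable ((Omega `&` B) `\` A) by exact: measurableD.
have f0 (D : set rV) x : D x -> (0 <= (u x ^+ 2)%:E)%E by move=> _; rewrite lee_fin sqr_ge0.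
have mf (D : set rV) : measurable D -> D `<=` Omega -> measurable_fun D (fun x => (u x ^+ 2)%:E).
  by move=> mD DO; apply/measurable_EFinP/measurable_funX; exact: measurable_funS hu.1.
have -> : Omega `&` (A `|` B) = (Omega `&` A) `|` ((Omega `&` B) `\` A).
  apply/seteqP; split => x.
    move=> [Ox [Ax|Bx]]; first by left.
    have [Ax|Ax] := pselect (A x); [by left|by right].
  by move=> [[Ox Ax]|[[Ox Bx] _]]; split => //; [left|right].
have dj : [disjoint Omega `&` A & (Omega `&` B) `\` A].
  by apply/disj_setPLR => x [_ Ax] [_]; apply.
have mU : measurable_fun ((Omega `&` A) `|` ((Omega `&` B) `\` A)) (fun x => (u x ^+ 2)%:E).
  by apply: mf; [exact: measurableU|move=> x [[]|[[]]]].
rewrite (ge0_integral_setU mu mOA mP mU (f0 _) dj).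
have le2 : (\int[mu]_(x in (Omega `&` B) `\` A) (u x ^+ 2)%:E <=
    \int[mu]_(x in Omega `&` B) (u x ^+ 2)%:E)%E.
  apply: ge0_subset_integral => //; first by apply: mf => // x [].
  by move=> x; exact: f0.
apply: le_trans (leeD (h1 u g wg) (le_trans le2 (h2 u g wg))) _.
rewrite -EFinD lee_fin big_cat /=.
set S1 := \sum_(psi <- p1) _; set S2 := \sum_(psi <- p2) _.
have S10 : 0 <= S1 by rewrite sumr_ge0// => q _; rewrite sqr_ge0.
have S20 : 0 <= S2 by rewrite sumr_ge0// => q _; rewrite sqr_ge0.
have := mulr_ge0 C10 S20; have := mulr_ge0 C20 S10; lra.
Qed.

(** The closure is compact, so finitely many of the balls of [poincare_on_cone], some centred on the
    boundary, cover it. *)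
Lemma poincare_inequality : bounded_set Omega -> (forall x, closure Omega x -> cone_at Omega x) ->
  forall e, 0 < e -> exists (psis : seq (testfun Omega)) (C : R), 0 <= C /\
  forall u g, weak_gradient Omega u g ->
  ipO u u <= e * (\sum_i nrm mu Omega (g i)) ^+ 2 + C * \sum_(psi <- psis) ipO u (sval psi) ^+ 2.
Proof.
move=> bO cO e e0.
have cA : compact (closure Omega).
  apply: bounded_closed_compact; last exact: closed_closure.
  have [r r0 Or] := bounded_rV_ball bO.
  exists r; split; first by rewrite num_real.
  move=> y ry x Ox; apply: le_trans (ltW ry).
  have sub : closure Omega `<=` [set x | `|x| <= r].
    rewrite closureE; apply: smallest_sub.
      apply: compact_closed; [exact: norm_hausdorff|exact: norm_le_compact].
    by move=> z /Or; rewrite -ball_normE /= sub0r normrN => /ltW.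
  exact: sub.
have /choice[r rP] : forall x, exists r : R, closure Omega x -> 0 < r /\ poincare_on (ball x r).
  move=> x; have [cx|cx] := pselect (closure Omega x); last by exists 1.
  by have [r r0 hr] := poincare_on_cone (cO x cx); exists r.
move: cA; rewrite compact_cover => /(_ rV (closure Omega) (fun p => ball p (r p))).
case=> [p /rP[p0 _]|x cx|D' D'c AD']; first exact: ball_open.
  by exists x => //; apply: ballxx; have [] := rP x cx.
pose ds := finmap.enum_fset D'.
have dsc p : p \in ds -> closure Omega p by move=> pd; have := D'c p pd; rewrite inE.
have [A [hA sA]] : exists A, poincare_on A /\ [set x | exists2 p, p \in ds & ball p (r p) x] `<=` A.
  elim: ds dsc {AD'} => [|p ds IH] dsc.
    exists set0; split; last by move=> x [].
    split => // e1 e10; exists [::], 0; split => // u g wg.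
    by rewrite setI0 integral_set0 big_nil mulr0 addr0 lee_fin; apply: mulr_ge0; [exact: ltW|exact: sqr_ge0].
  have [|A [hA sA]] := IH; first by move=> q qd; apply: dsc; rewrite inE qd orbT.
  have [_ hp] := rP p (dsc p (mem_head _ _)).
  exists (A `|` ball p (r p)); split; first exact: poincare_onU.
  move=> x [q]; rewrite inE => /orP[/eqP ->|qd] qx; first by right.
  by left; apply: sA; exists q.
have [psis [C [C0 hC]]] := hA.2 e e0.
exists psis, C; split => // u g wg; have [hu _ _] := wg.
have OA : Omega `&` A = Omega.
  apply/seteqP; split => x; first by case.
  move=> Ox; split => //; apply: sA; have [p pD px] := AD' x (subset_closure Ox).
  by exists p.
by have := hC u g wg; rewrite OA -ipE// lee_fin.
Qed.

End global_poincare.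

(** * Inequalities and completeness in [H^2] *)

Lemma sqr_sum_le (R : realFieldType) (I : finType) (a : I -> R) :
  (\sum_i a i) ^+ 2 <= #|I|%:R * \sum_i a i ^+ 2.
Proof.
rewrite expr2 mulr_suml.
have -> : #|I|%:R * \sum_i a i ^+ 2 = \sum_i \sum_j (a i ^+ 2 / 2 + a j ^+ 2 / 2).
  have inner i : \sum_j (a i ^+ 2 / 2 + a j ^+ 2 / 2) =
      #|I|%:R * (a i ^+ 2 / 2) + \sum_j a j ^+ 2 / 2.
    by rewrite big_split /= sumr_const -[a i ^+ 2 / 2 *+ _]mulr_natl.
  rewrite [RHS](eq_bigr _ (fun i _ => inner i)) big_split /= sumr_const -mulr_sumr.
  rewrite -!mulr_suml; set S := \sum_i a i ^+ 2; rewrite -[S / 2 *+ _]mulr_natl.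
  transitivity (#|I|%:R * (S / 2) + #|I|%:R * (S / 2)) => //.
  by rewrite -mulrDr -splitr.
apply: ler_sum => i _; rewrite mulr_sumr; apply: ler_sum => j _.
have := sqr_ge0 (a i - a j); rewrite sqrrB; lra.
Qed.

Lemma le_sum_sum (R : realFieldType) (I : finType) (F : I -> I -> R) (i j : I) :
  (forall k l, 0 <= F k l) -> F i j <= \sum_k \sum_l F k l.
Proof.
move=> pos; apply: (@le_trans _ _ (\sum_l F i l)).
  by rewrite (bigD1 j)//= lerDl sumr_ge0.
by rewrite [leRHS](bigD1 i)//= lerDl; apply: sumr_ge0 => k _; exact: sumr_ge0.
Qed.

Section sobolev2.
Context {R : realType} {N : nat}.
Local Notation rV := 'rV[R]_N.
Local Notation mu := (lebesgue_rV (R := R) N).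
Local Notation e_ i := (unit_rV (R := R) i).
Variable Omega : set rV.
Hypothesis oO : open Omega.
Implicit Types (u v phi : rV -> R).
Local Notation sqO := (sqint mu Omega).
Local Notation ipO := (ip mu Omega).
Local Notation W s u := (wderiv Omega s u).
Local Notation H2 := (sobolev Omega 2).

Let mO : measurable Omega. Proof. exact: open_rV_measurable. Qed.

Definition d2form u v := \sum_i \sum_j ipO (W [:: i; j] u) (W [:: i; j] v).

Definition lap u : rV -> R := fun x => \sum_i W [:: i; i] u x.

Lemma W_sqO u i j : H2 u -> sqO (W [:: i; j] u).
Proof. by move=> hu; have [] := wderivP (s := [:: i; j]) hu isT. Qed.

Lemma W1_sqO u i : H2 u -> sqO (W [:: i] u).
Proof. by move=> hu; have [] := wderivP (s := [:: i]) hu isT. Qed.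

Lemma lap_sqO u : H2 u -> sqO (lap u).
Proof. by move=> hu; apply: sqint_sum => // i; exact: W_sqO. Qed.

Lemma neumann_formE (sigma : R) u v : H2 u -> H2 v ->
  neumann_form Omega sigma u v = (1 - sigma) * d2form u v + sigma * ipO (lap u) (lap v).
Proof.
move=> hu hv.
pose I := index_enum 'I_N.
have H (r q : seq 'I_N) : mu.-integrable Omega (EFin \o (fun x => \sum_(i <- r) \sum_(j <- q) W [:: i; j] u x * W [:: i; j] v x)) /\
  \int[mu]_(x in Omega) (\sum_(i <- r) \sum_(j <- q) W [:: i; j] u x * W [:: i; j] v x) =
  \sum_(i <- r) \sum_(j <- q) ipO (W [:: i; j] u) (W [:: i; j] v).
  have sum0 : mu.-integrable Omega (EFin \o (fun=> 0 : R)) by exact: integrable0.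
  have Hq i : mu.-integrable Omega (EFin \o (fun x => \sum_(j <- q) W [:: i; j] u x * W [:: i; j] v x)) /\
    \int[mu]_(x in Omega) (\sum_(j <- q) W [:: i; j] u x * W [:: i; j] v x) =
    \sum_(j <- q) ipO (W [:: i; j] u) (W [:: i; j] v).
    elim: q => [|j q [IH1 IH2]].
      split; first by under eq_fun do rewrite big_nil.
      by under eq_Rintegral do rewrite big_nil; rewrite big_nil Rintegral_cst// mul0r.
    have i1 := ip_integrable mO (W_sqO i j hu) (W_sqO i j hv).
    split.
      have := integrableD mO i1 IH1; apply: eq_integrable => // x _ /=.
      by rewrite big_cons.
    under eq_Rintegral do rewrite big_cons.
    by rewrite RintegralD// IH2 big_cons.
  elim: r => [|i r [IH1 IH2]].
    split; first by under eq_fun do rewrite big_nil.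
    by under eq_Rintegral do rewrite big_nil; rewrite big_nil Rintegral_cst// mul0r.
  have [h1 h2] := Hq i; split.
    have := integrableD mO h1 IH1; apply: eq_integrable => // x _ /=.
    by rewrite big_cons.
  under eq_Rintegral do rewrite big_cons.
  by rewrite RintegralD// IH2 h2 big_cons.
have [h1 h2] := H I I.
have h3 := ip_integrable mO (lap_sqO hu) (lap_sqO hv).
have h1' : mu.-integrable Omega (EFin \o (fun x => (1 - sigma) * \sum_i \sum_j W [:: i; j] u x * W [:: i; j] v x)).
  by have := integrableZl mO (1 - sigma) h1; apply: eq_integrable.
have h3' : mu.-integrable Omega (EFin \o (fun x => sigma * (lap u x * lap v x))).
  by have := integrableZl mO sigma h3; apply: eq_integrable.
transitivity (\int[mu]_(x in Omega) ((1 - sigma) * (\sum_i \sum_j W [:: i; j] u x * W [:: i; j] v x) + sigma * (lap u x * lap v x))).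
  apply: eq_Rintegral => x _; congr (_ * _ + _ * (_ * _)).
  - by apply: eq_bigr => i _; apply: eq_bigr => j _; rewrite !mxE.
  - by apply: eq_bigr => i _; rewrite mxE.
  - by apply: eq_bigr => i _; rewrite mxE.
by rewrite RintegralD// RintegralZl// RintegralZl// h2.
Qed.

Lemma eq_ae_ip2 u u' : sqO u -> sqO u' -> ae_eq_on Omega u u' -> ipO u u = ipO u' u'.
Proof.
move=> [mu1 _] [mu2 _] uu'.
by rewrite (eq_ae_ip mO mu1 mu2 mu1 uu') ipC (eq_ae_ip mO mu1 mu2 mu2 uu').
Qed.

Lemma H2_gradient u : H2 u -> weak_gradient Omega u (fun i => W [:: i] u).
Proof.
move=> hu; split; first exact: sobolev_sqO hu.
  by move=> i; exact: W1_sqO.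
by move=> i; have [] := wderivP (s := [:: i]) hu isT.
Qed.

Lemma H2_hessian u i : H2 u -> weak_gradient Omega (W [:: i] u) (fun j => W [:: i; j] u).
Proof.
move=> hu; split; first exact: W1_sqO.
  by move=> j; exact: W_sqO.
by move=> j; exact: weak_deriv_iter.
Qed.

Hypothesis bO : bounded_set Omega.
Hypothesis cO : forall x, closure Omega x -> cone_at Omega x.

Definition dtest (i : 'I_N) (psi : testfun Omega) : testfun Omega :=
  exist _ ('D_(e_ i) (sval psi)) (test_function_derive i (svalP psi)).

Lemma W1_test u i (psi : testfun Omega) : H2 u ->
  ipO (W [:: i] u) (sval psi) = - ipO u (sval (dtest i psi)).
Proof.
move=> hu; have [_ /weak_derivE w] := wderivP (s := [:: i]) hu isT.
by have := w _ (svalP psi) => /= ->; rewrite expr1 mulN1r opprK.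
Qed.

(** Poincare's inequality for each first derivative, whose pairings are moved to [u] by [dtest].
    Dividing [e] by [N + 1] absorbs the factor [N] that comes from squaring a sum of [N] norms. *)
Lemma gradient_poincare e : 0 < e -> exists (psis : seq (testfun Omega)) (C : R), 0 <= C /\
  forall u, H2 u -> \sum_i ipO (W [:: i] u) (W [:: i] u) <=
    e * d2form u u + C * \sum_(psi <- psis) ipO u (sval psi) ^+ 2.
Proof.
move=> e0; have N0 : 0 < N%:R + 1 :> R by rewrite ltr_wpDl.
have [psis [C [C0 hC]]] := poincare_inequality oO bO cO (divr_gt0 e0 N0).
exists [seq dtest i psi | i <- index_enum 'I_N, psi <- psis], C; split => // u hu.
rewrite big_flatten big_map; under [X in _ + C * X]eq_bigr do rewrite big_map.
rewrite mulr_sumr mulr_sumr -big_split /=; apply: ler_sum => i _.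
have := hC _ _ (H2_hessian i hu); move=> /le_trans; apply.
apply: lerD; last first.
  rewrite ler_wpM2l// le_eqVlt; apply/orP; left; apply/eqP; apply: eq_bigr => psi _.
  by rewrite W1_test// sqrrN.
rewrite mulrAC ler_pdivrMr// -mulrA ler_wpM2l ?(ltW e0)//.
have := sqr_sum_le (fun j => nrm mu Omega (W [:: i; j] u)).
rewrite card_ord; under [in X in _ <= X -> _]eq_bigr do rewrite sqr_nrm.
move=> /le_trans; apply; rewrite mulrC ler_wpM2l ?lerDl// sumr_ge0// => j _.
exact: ip_ge0.
Qed.

Lemma d2form_ge0 u : 0 <= d2form u u.
Proof. by apply: sumr_ge0 => i _; apply: sumr_ge0 => j _; exact: ip_ge0. Qed.

Lemma W_le_d2form u i j : ipO (W [:: i; j] u) (W [:: i; j] u) <= d2form u u.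
Proof.
pose F k l := ipO (W [:: k; l] u) (W [:: k; l] u).
by apply: (@le_sum_sum _ _ F) => k l; exact: ip_ge0.
Qed.

(** For [u] itself the coefficient of the gradient can be [1]; the smallness is gained when the
    gradient is in turn bounded by second derivatives. *)
Lemma H2_poincare e : 0 < e -> exists (psis : seq (testfun Omega)) (C : R), 0 <= C /\
  forall u, H2 u -> ipO u u <= e * d2form u u + C * \sum_(psi <- psis) ipO u (sval psi) ^+ 2.
Proof.
move=> e0; have N0 : 0 < N%:R + 1 :> R by rewrite ltr_wpDl.
have [p1 [C1 [C10 h1]]] := poincare_inequality oO bO cO ltr01.
have [p2 [C2 [C20 h2]]] := gradient_poincare (divr_gt0 e0 N0).
exists (p1 ++ p2), (C1 + N%:R * C2); split; first by rewrite addr_ge0// mulr_ge0.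
move=> u hu; apply: le_trans (h1 _ _ (H2_gradient hu)) _; rewrite mul1r big_cat /=.
set S1 := \sum_(psi <- p1) _; set S2 := \sum_(psi <- p2) _.
have S10 : 0 <= S1 by rewrite sumr_ge0// => q _; rewrite sqr_ge0.
have S20 : 0 <= S2 by rewrite sumr_ge0// => q _; rewrite sqr_ge0.
have := sqr_sum_le (fun j => nrm mu Omega (W [:: j] u)).
rewrite card_ord; under [in X in _ <= X -> _]eq_bigr do rewrite sqr_nrm.
move=> h3; have := ler_wpM2l (ler0n R N) (h2 u hu); move: h3.
rewrite -/S2; set G := \sum_i ipO _ _; set Q := (\sum_i _) ^+ 2; set A := d2form u u => h3 h4.
have A0 : 0 <= A by exact: d2form_ge0.
have h5 : N%:R * (e / (N%:R + 1)) * A <= e * A.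
  by rewrite ler_wpM2r// mulrA ler_pdivrMr// mulrC ler_wpM2l ?lerDl// ltW.
rewrite mulrDr mulrA in h4.
have := mulr_ge0 C10 S20; have := mulr_ge0 (mulr_ge0 (ler0n R N) C20) S10.
move: h4; rewrite (mulrA N%:R C2 S2).
move: (N%:R * C2) (N%:R * G) (N%:R * (e / (N%:R + 1)) * A) (e * A) h3 h5.
by move=> D G' X Y; lra.
Qed.

(** The pairings in [gradient_poincare] are bounded by Cauchy-Schwarz. This gives control of the
    first derivatives, absent from the form, in the proof of completeness. *)
Lemma gradient_bound : exists2 C, 0 <= C & forall u, H2 u ->
  \sum_i ipO (W [:: i] u) (W [:: i] u) <= d2form u u + C * ipO u u.
Proof.
have [psis [C [C0 hC]]] := gradient_poincare ltr01.
exists (C * \sum_(psi <- psis) ipO (sval psi) (sval psi)).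
  by rewrite mulr_ge0// sumr_ge0// => psi _; exact: ip_ge0.
move=> u hu; apply: le_trans (hC u hu) _; rewrite mul1r lerD2l -mulrA ler_wpM2l//.
rewrite mulr_suml; apply: ler_sum => psi _; rewrite mulrC.
apply: ip_CS => //; first exact: sobolev_sqO hu.
exact: test_sqO (svalP psi).
Qed.

(** [wderiv] chooses a representative, so it is linear only almost everywhere; inner products do not
    see the difference. *)
Lemma W_sub u v s : H2 u -> H2 v -> (size s <= 2)%N ->
  ipO (fun x => W s u x - W s v x) (fun x => W s u x - W s v x) =
  ipO (W s (fun x => u x - v x)) (W s (fun x => u x - v x)).
Proof.
move=> hu hv s2.
have hvu : H2 (fun x => -1 * v x + u x) by exact: sobolev_lin.
have e1 : (fun x => u x - v x) = (fun x => -1 * v x + u x).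
  by apply/funext => x; rewrite mulN1r addrC.
have e2 : (fun x => W s u x - W s v x) = (fun x => -1 * W s v x + W s u x).
  by apply/funext => x; rewrite mulN1r addrC.
rewrite e1 e2; apply: eq_ae_ip2.
- by apply: sqintD => //; [apply: sqintZ => //|]; [have [] := wderivP hv s2|have [] := wderivP hu s2].
- by have [] := wderivP hvu s2.
have := wderiv_lin oO (-1) hv hu s2; apply: filterS => x h Ox; by rewrite h.
Qed.

Lemma H2B u v : H2 u -> H2 v -> H2 (fun x => u x - v x).
Proof.
move=> hu hv; have := sobolev_lin oO (-1) hv hu.
by congr (sobolev Omega 2 _); apply/funext => x; rewrite mulN1r addrC.
Qed.

(** Each derivative of order at most 2 is Cauchy in [L^2], the first ones by [gradient_bound], and
    by [weak_deriv_lim] its limit is a weak derivative of the limit [w]. *)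
Lemma H2_complete (u : nat -> rV -> R) : (forall n, H2 (u n)) ->
  (forall e, 0 < e -> exists n0, forall m n, (n0 <= m)%N -> (n0 <= n)%N ->
    d2form (fun x => u m x - u n x) (fun x => u m x - u n x) +
    ipO (fun x => u m x - u n x) (fun x => u m x - u n x) <= e) ->
  exists2 w, H2 w & forall e, 0 < e -> exists n0, forall n, (n0 <= n)%N ->
    d2form (fun x => u n x - w x) (fun x => u n x - w x) +
    ipO (fun x => u n x - w x) (fun x => u n x - w x) <= e.
Proof.
move=> hu uC; have [C C0 hC] := gradient_bound.
have W0 m n s : (size s <= 2)%N -> ipO (fun x => W s (u m) x - W s (u n) x) (fun x => W s (u m) x - W s (u n) x) <=
  (1 + C) * (d2form (fun x => u m x - u n x) (fun x => u m x - u n x) +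
    ipO (fun x => u m x - u n x) (fun x => u m x - u n x)).
  move=> s2; rewrite W_sub//; have hd := H2B (hu m) (hu n).
  set d := (fun x => u m x - u n x) in hd *.
  have A0 := d2form_ge0 d; have B0 := ip_ge0 mu Omega d.
  have CA0 := mulr_ge0 C0 A0; have CB0 := mulr_ge0 C0 B0.
  apply: (@le_trans _ _ (d2form d d + C * ipO d d + ipO d d)); last by lra.
  move: s s2 => [|i [|j [|//]]] _.
  - rewrite (_ : ipO (W [::] d) _ = ipO d d); first by lra.
    have [w1 w2] := wderivP (s := [::]) hd isT.
    apply: eq_ae_ip2 => //; first exact: sobolev_sqO hd.
    apply: (weak_deriv_unique oO (s := [::]) (u := d)) => //; first exact: sobolev_sqO hd.
    by apply/weak_derivE => phi _ /=; rewrite mul1r.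
  - apply: (@le_trans _ _ (d2form d d + C * ipO d d)); last by lra.
    apply: le_trans (hC d hd); rewrite (bigD1 i)//= lerDl sumr_ge0// => j _.
    exact: ip_ge0.
  apply: (@le_trans _ _ (d2form d d)); last by lra.
  exact: W_le_d2form.
have Wsq n s : (size s <= 2)%N -> sqO (W s (u n)) by move=> s2; have [] := wderivP (hu n) s2.
have WC s : (size s <= 2)%N -> exists2 f, sqO f & forall e, 0 < e -> exists n0, forall n, (n0 <= n)%N ->
    ipO (fun x => W s (u n) x - f x) (fun x => W s (u n) x - f x) <= e.
  move=> s2; apply: sqint_complete => // [n|e e0]; first exact: Wsq.
  have C1 : 0 < 1 + C by lra.
  have [n0 hn0] := uC (e / (1 + C)) (divr_gt0 e0 C1); exists n0 => m n mn nn.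
  apply: le_trans (W0 m n s s2) _; have := hn0 m n mn nn.
  by rewrite ler_pdivlMr// mulrC.
have [w hw wl] : exists2 f, sqO f & forall e, 0 < e -> exists n0, forall n, (n0 <= n)%N ->
    ipO (fun x => u n x - f x) (fun x => u n x - f x) <= e.
  apply: sqint_complete => // [n|e e0]; first exact: sobolev_sqO (hu n).
  have [n0 hn0] := uC e e0; exists n0 => m n mn nn; apply: le_trans (hn0 m n mn nn).
  by rewrite lerDr d2form_ge0.
have wd s f : (size s <= 2)%N -> sqO f -> (forall e, 0 < e -> exists n0, forall n, (n0 <= n)%N ->
    ipO (fun x => W s (u n) x - f x) (fun x => W s (u n) x - f x) <= e) -> weak_deriv Omega s w f.
  move=> s2 hf fl; apply: (weak_deriv_lim oO _ _ hw hf _ wl fl).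
  - by move=> n; exact: sobolev_sqO (hu n).
  - by move=> n; exact: Wsq.
  - by move=> n; have [] := wderivP (hu n) s2.
have H2w : H2 w.
  by split => // s s2; have [f hf fl] := WC s s2; exists f => //; exact: wd.
have Wl s : (size s <= 2)%N -> forall e, 0 < e -> exists n0, forall n, (n0 <= n)%N ->
    ipO (W s (fun x => u n x - w x)) (W s (fun x => u n x - w x)) <= e.
  move=> s2 e e0; have [f hf fl] := WC s s2; have [n0 hn0] := fl e e0.
  exists n0 => n nn; rewrite -W_sub//.
  have [h1 h2] := wderivP H2w s2.
  rewrite (@eq_ae_ip2 _ (fun x => W s (u n) x - f x)); first exact: hn0.
  - by apply: sqintB => //; exact: Wsq.
  - by apply: sqintB => //; exact: Wsq.
  have := wderivE oO hf (wd s f s2 hf fl); apply: filterS => x h Ox; by rewrite h.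
exists w => // e e0.
have [n0 hn0] := wl (e / 2) ltac:(by rewrite divr_gt0).
have NN0 : 0 < 2 * (N%:R * N%:R + 1) :> R by rewrite mulr_gt0// ltr_wpDl// mulr_ge0.
have /choice[F hF] : forall ij : 'I_N * 'I_N, exists n0, forall n, (n0 <= n)%N ->
    ipO (W [:: ij.1; ij.2] (fun x => u n x - w x)) (W [:: ij.1; ij.2] (fun x => u n x - w x)) <=
    e / (2 * (N%:R * N%:R + 1)).
  by move=> ij; apply: Wl => //; exact: divr_gt0.
exists (maxn n0 (\max_ij F ij)) => n; rewrite geq_max => /andP[n0n Fn].
rewrite [leRHS](splitr e); apply: lerD; last exact: hn0.
apply: (@le_trans _ _ (\sum_(i < N) \sum_(j < N) e / (2 * (N%:R * N%:R + 1)))).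
  apply: ler_sum => i _; apply: ler_sum => j _; apply: (hF (i, j)).
  by apply: leq_trans Fn; exact: leq_bigmax.
rewrite !sumr_const card_ord -mulrnA; set x := e / _.
rewrite -[x *+ _]mulr_natl natrM /x mulrA ler_pdivrMr//.
have -> : e / 2 * (2 * (N%:R * N%:R + 1)) = e * (N%:R * N%:R + 1) by field.
by rewrite mulrC ler_wpM2l ?lerDl// ltW.
Qed.

End sobolev2.

(** * The minimax principle *)

Section symmetric_forms.
Context {R : realType} {V : lmodType R}.
Implicit Types (q : V -> V -> R) (u v w : V).

(** No definiteness is included: the [L^2] form vanishes on functions that are zero almost
    everywhere, and null vectors are carried along instead of taking a quotient. *)
Definition symform q := [/\ forall u v, q u v = q v u,
  forall u v w, q (u + v) w = q u w + q v w & forall c u w, q (c *: u) w = c * q u w].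

Lemma symformDr q u v w : symform q -> q w (u + v) = q w u + q w v.
Proof. by move=> [C D _]; rewrite C D !(C w). Qed.

Lemma symformZr q c u w : symform q -> q w (c *: u) = c * q w u.
Proof. by move=> [C _ Z]; rewrite C Z (C w). Qed.

Lemma symform0l q w : symform q -> q 0 w = 0.
Proof. by move=> [_ _ Z]; rewrite -(scale0r 0) Z mul0r. Qed.

Lemma symformBl q u v w : symform q -> q (u - v) w = q u w - q v w.
Proof. by move=> [_ D Z]; rewrite -scaleN1r D Z mulN1r. Qed.

Lemma symform_suml q I (r : seq I) (P : pred I) (F : I -> V) w : symform q ->
  q (\sum_(i <- r | P i) F i) w = \sum_(i <- r | P i) q (F i) w.
Proof.
move=> hq; have [_ D _] := hq; elim: r => [|i r IH]; first by rewrite !big_nil symform0l.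
by rewrite !big_cons; case: (P i); rewrite ?D IH.
Qed.

Lemma symform_sqrD q u v c : symform q ->
  q (u + c *: v) (u + c *: v) = q u u + 2 * c * q u v + c ^+ 2 * q v v.
Proof.
move=> hq; have [C D Z] := hq.
rewrite D !symformDr// !symformZr// !Z (C v u); ring.
Qed.

Lemma symform_parallelogram q u v : symform q ->
  q (u - v) (u - v) + q (u + v) (u + v) = 2 * q u u + 2 * q v v.
Proof.
move=> hq; have := symform_sqrD u v (-1) hq; have := symform_sqrD u v 1 hq.
rewrite scaleN1r scale1r => -> ->; ring.
Qed.

(** Nonnegativity is asked only on [S], because [a - m * b] is nonnegative only on an orthogonal
    complement. With [u] a minimizer, the conclusion is the Euler-Lagrange equation. *)
Lemma psd_CS q (S : V -> Prop) u v : symform q -> (forall c, S (u + c *: v)) ->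
  (forall w, S w -> 0 <= q w w) -> q u u = 0 -> 0 <= q v v -> q u v = 0.
Proof.
move=> hq hS q0 uu vv; apply/eqP; apply: contraT => uv.
have [v0|v0] := eqVneq (q v v) 0.
  have := q0 _ (hS (- (q u v)^-1)); rewrite symform_sqrD// uu v0 mulr0 addr0 add0r.
  have -> : 2 * - (q u v)^-1 * q u v = - 2 by field.
  by rewrite oppr_ge0 lern0.
have vp : 0 < q v v by rewrite lt_neqAle eq_sym v0.
have := q0 _ (hS (- q u v / q v v)); rewrite symform_sqrD// uu add0r.
have -> : 2 * (- q u v / q v v) * q u v + (- q u v / q v v) ^+ 2 * q v v = - (q u v ^+ 2 / q v v).
  by field.
rewrite oppr_ge0 leNgt divr_gt0//.
by rewrite lt_neqAle sqr_ge0 eq_sym sqrf_eq0 uv.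
Qed.

Lemma symform_CS q u v : symform q -> (forall w, 0 <= q w w) ->
  q u v ^+ 2 <= q u u * q v v.
Proof.
move=> hq q0; have [C _ _] := hq; have [v0|v0] := eqVneq (q v v) 0.
  by rewrite C (@psd_CS q (fun=> True)) ?v0 ?expr0n ?mulr0.
have vp : 0 < q v v by rewrite lt_neqAle eq_sym v0 q0.
have := mulr_ge0 (ltW vp) (q0 (u + (- (q u v / q v v)) *: v)); rewrite symform_sqrD//.
have -> : q v v * (q u u + 2 * - (q u v / q v v) * q u v + (- (q u v / q v v)) ^+ 2 * q v v) =
  q u u * q v v - q u v ^+ 2 by field.
by rewrite subr_ge0.
Qed.

(* AM-GM: 2 |q u x| <= t q u u + q x x / t *)
Lemma psd_continuous q (u : nat -> V) w M : symform q -> (forall v, 0 <= q v v) ->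
  (forall n, q (u n) (u n) <= M) ->
  (forall e, 0 < e -> exists n0, forall n, (n0 <= n)%N -> q (u n - w) (u n - w) <= e) ->
  forall e, 0 < e -> exists n0, forall n, (n0 <= n)%N -> `|q w w - q (u n) (u n)| <= e.
Proof.
move=> hq q0 uM uw e e0.
have M0 : 0 <= M by apply: le_trans (uM 0%N).
(* With this [t] the term [t * q (u n) (u n)] takes at most half of [e]; the closeness of [u n] to
   [w] takes care of the other half. *)
pose t := e / (2 * (M + 1)); have t0 : 0 < t by rewrite divr_gt0// mulr_gt0//; lra.
have d0 : 0 < e / (2 * (1 + t^-1)) by rewrite divr_gt0// mulr_gt0// addr_gt0// invr_gt0.
have [n0 hn0] := uw _ d0; exists n0 => n nn.
have hx := hn0 n nn; set x := u n - w in hx.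
have -> : w = u n + (-1) *: x by rewrite scaleN1r /x opprB addrCA subrr addr0.
rewrite symform_sqrD//.
have p1 := q0 (u n + t^-1 *: x); have p2 := q0 (u n + (- t^-1) *: x).
rewrite !symform_sqrD// in p1 p2.
have x0 := q0 x; have un0 := q0 (u n); have unM := uM n.
have tM : t * q (u n) (u n) <= e / 2.
  apply: (@le_trans _ _ (t * M)); first by rewrite ler_wpM2l// ltW.
  rewrite /t mulrAC ler_pdivrMr ?mulr_gt0//; last by lra.
  have -> : e / 2 * (2 * (M + 1)) = e * M + e by field.
  by rewrite lerDl ltW.
have tx : (1 + t^-1) * q x x <= e / 2.
  have t1 : 0 < 1 + t^-1 by rewrite addr_gt0// invr_gt0.
  move: hx; rewrite invfM mulrA ler_pdivlMr// mulrC; exact.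
have c1 : 2 * q (u n) x <= t * q (u n) (u n) + t^-1 * q x x.
  have := mulr_ge0 (ltW t0) p2.
  have -> : t * (q (u n) (u n) + 2 * - t^-1 * q (u n) x + (- t^-1) ^+ 2 * q x x) =
    t * q (u n) (u n) - 2 * q (u n) x + t^-1 * q x x by field; rewrite gt_eqF.
  lra.
have c2 : - (2 * q (u n) x) <= t * q (u n) (u n) + t^-1 * q x x.
  have := mulr_ge0 (ltW t0) p1.
  have -> : t * (q (u n) (u n) + 2 * t^-1 * q (u n) x + (t^-1) ^+ 2 * q x x) =
    t * q (u n) (u n) + 2 * q (u n) x + t^-1 * q x x by field; rewrite gt_eqF.
  lra.
rewrite ler_norml; apply/andP; split; lra.
Qed.

(** For nonnegative [q], linear independence modulo the null vectors of [q]. *)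
Definition independent q n (u : 'I_n -> V) := forall c : 'I_n -> R,
  q (\sum_i c i *: u i) (\sum_i c i *: u i) = 0 -> forall i, c i = 0.

Lemma nonzero_left_kernel p n (M : 'M[R]_(p, n)) : (n < p)%N ->
  exists2 c : 'rV[R]_p, c != 0 & c *m M = 0.
Proof.
move=> np; have : kermx M != 0.
  by rewrite -mxrank_eq0 mxrank_ker subn_eq0 -ltnNge (leq_ltn_trans _ np)// rank_leq_col.
move=> /rowV0Pn[c /sub_kermxP cM c0]; by exists c.
Qed.

(** The dimension count behind every minimax comparison: [n] linear equations in [p > n] unknowns
    have a nonzero solution, which independence allows to normalize. *)
Lemma independent_orthogonal q p n (u : 'I_p -> V) (e : 'I_n -> V) : symform q ->
  (forall v, 0 <= q v v) -> independent q u -> (n < p)%N ->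
  exists c : 'I_p -> R, let w := \sum_i c i *: u i in
    q w w = 1 /\ forall i, q w (e i) = 0.
Proof.
move=> hq q0 iu np; have [C D Z] := hq.
have [c c0 cM] := nonzero_left_kernel (\matrix_(i, j) q (u i) (e j)) np.
pose w := \sum_i c 0 i *: u i.
have w0 : 0 < q w w.
  rewrite lt_neqAle q0 andbT eq_sym; apply: contra c0 => /eqP w0.
  by apply/eqP/rowP => i; rewrite mxE; exact: (iu (fun i => c 0 i)).
pose s := (Num.sqrt (q w w))^-1.
have sE : \sum_i (s * c 0 i) *: u i = s *: w.
  by rewrite scaler_sumr; apply: eq_bigr => i _; rewrite scalerA.
exists (fun i => s * c 0 i) => /=; rewrite sE; split.
  rewrite Z symformZr// mulrA -expr2 exprVn sqr_sqrtr ?q0// mulVf// gt_eqF//.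
move=> j; rewrite Z symform_suml//.
have := congr1 (fun M : 'rV_n => M 0 j) cM; rewrite !mxE => h.
rewrite (eq_bigr (fun i => c 0 i * q (u i) (e j))) => [|i _]; last by rewrite Z.
rewrite [X in s * X](_ : _ = 0) ?mulr0// -[RHS]h; apply: eq_bigr => i _.
by rewrite mxE.
Qed.

Lemma psd_null q u v : symform q -> (forall w, 0 <= q w w) -> q v v = 0 -> q u v = 0.
Proof.
move=> hq q0 v0; apply/eqP; rewrite -sqrf_eq0 eq_le sqr_ge0 andbT.
by apply: le_trans (symform_CS _ _ hq q0) _; rewrite v0 mulr0.
Qed.

Lemma symform_orthonormal q n (e : 'I_n -> V) c k : symform q ->
  (forall i j, q (e i) (e j) = (i == j)%:R) -> q (\sum_i c i *: e i) (e k) = c k.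
Proof.
move=> hq qe; have [_ _ Z] := hq; rewrite symform_suml// (bigD1 k)//= Z qe eqxx mulr1.
by rewrite big1 ?addr0// => i /negPf ik; rewrite Z qe ik mulr0.
Qed.

Lemma orthonormal_independent q n (e : 'I_n -> V) : symform q -> (forall w, 0 <= q w w) ->
  (forall i j, q (e i) (e j) = (i == j)%:R) -> independent q e.
Proof.
move=> hq q0 qe c c0 k; have [C _ _] := hq.
by rewrite -(symform_orthonormal c k hq qe) C psd_null.
Qed.

End symmetric_forms.

(** * Eigenpairs by successive minimization *)

Section minmax.
Context {R : realType} {V : lmodType R}.
Variables a b : V -> V -> R.
Hypotheses (sa : symform a) (sb : symform b).
Hypotheses (a0 : forall v, 0 <= a v v) (b0 : forall v, 0 <= b v v).

(** On [H^2] these will be the pairings with test functions. *)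
Definition bounded_functional := {f : V -> R | (forall u v, f (u - v) = f u - f v) /\
  exists2 K, 0 <= K & forall u, f u ^+ 2 <= K * b u u}.

Hypothesis ab_complete : forall u : nat -> V,
  (forall e, 0 < e -> exists n0, forall m n, (n0 <= m)%N -> (n0 <= n)%N ->
    a (u m - u n) (u m - u n) + b (u m - u n) (u m - u n) <= e) ->
  exists w, forall e, 0 < e -> exists n0, forall n, (n0 <= n)%N ->
    a (u n - w) (u n - w) + b (u n - w) (u n - w) <= e.

Hypothesis ab_compact : forall e, 0 < e -> exists (fs : seq bounded_functional) (C : R),
  0 <= C /\ forall u, b u u <= e * a u u + C * \sum_(f <- fs) sval f u ^+ 2.

(* Bolzano-Weierstrass for the finitely many functionals fs *)
Lemma bounded_functionals_subseq (fs : seq bounded_functional) (v : nat -> V) :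
  (forall n, b (v n) (v n) <= 1) ->
  exists k : nat -> nat, (forall n, (n <= k n)%N) /\
    exists p : 'I_(size fs) -> R, forall n (i : 'I_(size fs)),
      `|sval (tnth (in_tuple fs) i) (v (k n)) - p i| <= n.+1%:R^-1.
Proof.
move=> v1; pose m := size fs.
pose F n : 'rV[R]_m := \row_i sval (tnth (in_tuple fs) i) (v n).
have [M [M0 FM]] : exists M : R, 0 <= M /\ forall n, `|F n| <= M.
  have /choice[K KP] : forall i : 'I_m, exists K, 0 <= K /\
      forall n, `|sval (tnth (in_tuple fs) i) (v n)| <= K.
    move=> i; have [_ [K K0 hK]] := svalP (tnth (in_tuple fs) i).
    exists (K + 1); split => [|n]; first by rewrite addr_ge0.
    rewrite -(@ler_pXn2r _ 2)// ?nnegrE ?addr_ge0// -normrX ger0_norm ?sqr_ge0//.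
    apply: le_trans (hK _) _; apply: (@le_trans _ _ K); first by rewrite ler_piMr.
    by rewrite sqrrD1; have := sqr_ge0 K; lra.
  exists (\sum_i K i); split; first by apply: sumr_ge0 => i _; have [] := KP i.
  move=> n; apply: norm_rV_le; first by apply: sumr_ge0 => i _; have [] := KP i.
  move=> i; rewrite mxE (bigD1 i)//=; apply: le_trans ((KP i).2 n) _.
  by rewrite lerDl; apply: sumr_ge0 => j _; have [] := KP j.
have [|p [_ pcl]] := @norm_le_compact R m M (F @ \oo) _.
  by exists 0%N => // n _ /=; exact: FM.
have /choice[k kP] : forall n : nat, exists k, (n <= k)%N /\ `|F k - p| <= n.+1%:R^-1.
  move=> n; have n0 : (0 : R) < n.+1%:R^-1 by rewrite invr_gt0.
  have [|_ [[k /= nk <-]] pk] := pcl (F @` [set k | (n <= k)%N]) _ _ (nbhsx_ballx p _ n0).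
    by exists n => // k /= nk; exists k.
  exists k; split => //; move: pk; rewrite -ball_normE /= distrC; exact: ltW.
exists k; split; first by move=> n; have [] := kP n.
exists (fun i => p 0 i) => n i; have [_] := kP n; apply: le_trans.
by apply: le_trans (coord_le_norm _ i); rewrite !mxE.
Qed.

(** The direct method. With [m] the infimum, [q = a - m * b] is nonnegative on the orthogonal
    complement [W], so by the parallelogram law it is small on differences of a minimizing sequence.
    Compactness bounds [b] on these differences, and a subsequence is Cauchy for [a + b]. Its limit
    is a null vector of [q], whence the equation. *)
Lemma minimizer n (e : 'I_n -> V) (v0 : V) : b v0 v0 = 1 -> (forall i, b v0 (e i) = 0) ->
  exists (w : V) (m : R), [/\ b w w = 1, forall i, b w (e i) = 0,
    forall v, (forall i, b v (e i) = 0) -> a w v = m * b w v &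
    forall v, (forall i, b v (e i) = 0) -> m * b v v <= a v v].
Proof.
move=> v01 v0W; have [bC bD bZ] := sb.
pose W v := forall i, b v (e i) = 0.
pose E : set R := [set x | exists v, [/\ W v, b v v = 1 & x = a v v]].
have infE : has_inf E.
  split; first by exists (a v0 v0), v0.
  by exists 0 => _ [v [_ _ ->]].
pose m := inf E.
have m0 : 0 <= m by apply: lb_le_inf; [exact: infE.1|move=> _ [v [_ _ ->]]].
have WD u v c : W u -> W v -> W (u + c *: v).
  by move=> hu hv i; rewrite bD bZ hu hv mulr0 addr0.
have mle v : W v -> m * b v v <= a v v.
  move=> Wv; have [bv|bv] := eqVneq (b v v) 0; first by rewrite bv mulr0.
  have bp : 0 < b v v by rewrite lt_neqAle eq_sym bv b0.
  pose s := (Num.sqrt (b v v))^-1.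
  have s2 : s ^+ 2 = (b v v)^-1 by rewrite exprVn sqr_sqrtr// b0.
  have : m <= a (s *: v) (s *: v).
    apply: ge_inf; first exact: infE.2.
    exists (s *: v); split => //; first by move=> i; rewrite bZ Wv mulr0.
    by rewrite bZ symformZr// mulrA -expr2 s2 mulVf.
  have [_ _ aZ] := sa; rewrite aZ symformZr// mulrA -expr2 s2 mulrC.
  by rewrite ler_pdivlMr.
pose q u v := a u v - m * b u v.
have sq : symform q.
  have [aC aD aZ] := sa; split; first by move=> u v; rewrite /q aC bC.
    by move=> u v w; rewrite /q aD bD; ring.
  by move=> c u w; rewrite /q aZ bZ; ring.
have q0 v : W v -> 0 <= q v v by move=> Wv; rewrite subr_ge0 mle.
have /choice[v vP] : forall n : nat, exists v, [/\ W v, b v v = 1 & q v v <= n.+1%:R^-1].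
  move=> k; have k0 : (0 : R) < k.+1%:R^-1 by rewrite invr_gt0.
  have [_ [v [Wv v1 ->]] vm] := inf_adherent k0 infE.
  by exists v; split => //; rewrite /q v1 mulr1 lerBlDl ltW.
(* With this coefficient, [m * b d d] costs at most half of [a d d], so [q d d] controls [a d d] up
   to the functionals. *)
have e0 : 0 < (2 * (m + 1))^-1 by rewrite invr_gt0 mulr_gt0//; lra.
have [fs [C [C0 hC]]] := ab_compact e0.
have v1 k : b (v k) (v k) <= 1 by have [_ ->] := vP k.
have [k [kn [p hp]]] := bounded_functionals_subseq fs v1.
pose u k' := v (k k').
have uW j : W (u j) by have [] := vP (k j).
have u1 j : b (u j) (u j) = 1 by have [] := vP (k j).
have uq j : q (u j) (u j) <= j.+1%:R^-1.
  have [_ _ h] := vP (k j); apply: le_trans h _.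
  by rewrite lef_pV2 ?posrE// ler_nat ltnS.
(* In units of [D]: [a d d] is at most [8 + 8 * m * C * size fs], and [b d d] is at most [a d d]
   plus [4 * C * size fs]; [K] bounds their sum. *)
pose K := 8 + 8 * m * C * (size fs)%:R + 8 + 8 * m * C * (size fs)%:R + 4 * C * (size fs)%:R.
have K0 : 0 < K.
  rewrite /K; have := mulr_ge0 (mulr_ge0 (mulr_ge0 (ler0n R 8) m0) C0) (ler0n R (size fs)).
  have := mulr_ge0 (mulr_ge0 (ler0n R 4) C0) (ler0n R (size fs)); lra.
have uC : forall e, 0 < e -> exists n0, forall m n, (n0 <= m)%N -> (n0 <= n)%N ->
    a (u m - u n) (u m - u n) + b (u m - u n) (u m - u n) <= e.
  move=> eps eps0.
  have [n0 hn0] : exists n0 : nat, n0.+1%:R^-1 < eps / K.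
    have ek : 0 < eps / K by rewrite divr_gt0.
    have [n0 _ h] := near_infty_natSinv_lt (PosNum ek).
    by exists n0; exact: (h n0 (leqnn n0)).
  exists n0 => i j ni nj; set d := u i - u j.
  pose D : R := n0.+1%:R^-1.
  have D0 : 0 < D by rewrite invr_gt0.
  have D1 : D <= 1 by rewrite invf_le1// ler1n.
  have Dle l : (n0 <= l)%N -> l.+1%:R^-1 <= D.
    by move=> nl; rewrite lef_pV2 ?posrE// ler_nat ltnS.
  have qd : q d d <= 4 * D.
    have := symform_parallelogram (u i) (u j) sq.
    have := q0 (u i + u j) _; rewrite -[X in W (_ + X)]scale1r.
    move=> /(_ (WD _ _ _ (uW i) (uW j))).
    have := uq i; have := uq j; have := Dle i ni; have := Dle j nj; rewrite -/d.
    move: (q d d) (q _ _) (q _ _) (q _ _) (_.+1%:R^-1) (_.+1%:R^-1) => r1 r2 r3 r4 r5 r6 *; lra.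
  have fd : \sum_(f <- fs) sval f d ^+ 2 <= 4 * (size fs)%:R * D.
    rewrite (big_tnth _ _ fs); apply: (@le_trans _ _ (\sum_(l < size fs) 4 * D)).
      apply: ler_sum => l _.
      have [fB _] := svalP (tnth (in_tuple fs) l); rewrite fB.
      have h1 := hp i l; have h2 := hp j l.
      have := Dle i ni; have := Dle j nj => dj di.
      have : `|sval (tnth (in_tuple fs) l) (u i) - sval (tnth (in_tuple fs) l) (u j)| <= 2 * D.
        rewrite -(subrKA (p l)); apply: le_trans (ler_normD _ _) _.
        rewrite (distrC (p l)) (_ : 2 * D = D + D); last by ring.
        by apply: lerD; [exact: le_trans h1 di|exact: le_trans h2 dj].
      move=> h; rewrite -real_normK ?num_real//.
      apply: (@le_trans _ _ ((2 * D) ^+ 2)); first by rewrite lerXn2r ?nnegrE ?mulr_ge0// ltW.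
      by rewrite exprMn (_ : 2 ^+ 2 = 4 :> R) -?natrX// ler_wpM2l// expr2 ler_piMr// ltW.
    rewrite sumr_const card_ord -[leLHS]mulr_natl mulrA.
    by rewrite (mulrC _ 4).
  have ad0 := a0 d; have bd0 := b0 d.
  have hb := hC d.
  have qE : q d d = a d d - m * b d d by [].
  have m1 : 0 < 2 * (m + 1) by rewrite mulr_gt0//; lra.
  have S := ler_wpM2l C0 fd.
  have h1 : m * b d d <= a d d / 2 + m * (C * (4 * (size fs)%:R * D)).
    apply: le_trans (ler_wpM2l m0 (le_trans hb (lerD (lexx _) S))) _.
    rewrite mulrDr lerD2r mulrA [leRHS]mulrC; apply: ler_wpM2r => //.
    by rewrite ler_pdivrMr// mulrA mulVf// mul1r; lra.
  have h2 : b d d <= a d d + C * (4 * (size fs)%:R * D).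
    apply: le_trans (le_trans hb (lerD (lexx _) S)) _; rewrite lerD2r.
    rewrite ler_piMl// invf_le1//; lra.
  have : K * D <= eps by rewrite mulrC -ler_pdivlMr// ltW.
  have -> : K * D = 16 * D + 16 * (m * (C * (4 * (size fs)%:R * D)) / 4) + C * (4 * (size fs)%:R * D).
    by rewrite /K; field.
  move: h1 h2; set X := m * (C * _); set Y := C * _; lra.
have [w hw] := ab_complete uC.
have bw e1 : 0 < e1 -> exists n0, forall n, (n0 <= n)%N -> b (u n - w) (u n - w) <= e1.
  move=> /hw[n0 h]; exists n0 => j /h; apply: le_trans.
  by rewrite lerDr a0.
have aw e1 : 0 < e1 -> exists n0, forall n, (n0 <= n)%N -> a (u n - w) (u n - w) <= e1.
  move=> /hw[n0 h]; exists n0 => j /h; apply: le_trans.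
  by rewrite lerDl b0.
have auE j : a (u j) (u j) <= m + j.+1%:R^-1 by have := uq j; rewrite /q u1 mulr1 lerBlDl.
have auM j : a (u j) (u j) <= m + 1.
  by apply: le_trans (auE j) _; rewrite lerD2l invf_le1// ler1n.
have w1 : b w w = 1.
  apply/eqP; rewrite -subr_eq0 -normr_le0; apply/ler_addgt0Pr => e1 e10; rewrite add0r.
  have [n0 h] := psd_continuous sb b0 (fun j => v1 (k j)) bw e10.
  by have := h n0 (leqnn _); rewrite u1.
have wW : W w.
  move=> i; apply/eqP; rewrite -sqrf_eq0 eq_le sqr_ge0 andbT.
  apply/ler_addgt0Pr => e1 e10; rewrite add0r.
  have e20 : 0 < e1 / (b (e i) (e i) + 1) by rewrite divr_gt0// ltr_wpDl.
  have [n0 h] := bw _ e20; have := symform_CS (u n0 - w) (e i) sb b0.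
  rewrite symformBl// (uW n0 i) sub0r sqrrN => /le_trans; apply.
  apply: le_trans (ler_wpM2r (b0 _) (h n0 (leqnn _))) _.
  rewrite mulrAC ler_pdivrMr ?ltr_wpDl// ler_wpM2l// ?ltW//.
  by rewrite ltrDl.
have mw := mle w wW; rewrite w1 mulr1 in mw.
exists w, m; split => // v' Wv'; apply/eqP; rewrite -subr_eq0; apply/eqP.
suff : q w v' = 0 by [].
apply: (psd_CS sq (S := W)) => //; [by move=> c; exact: WD| |exact: q0].
apply/eqP; rewrite /q subr_eq0 w1 mulr1 eq_le mw andbT.
apply/ler_addgt0Pr => e1 e10; have e20 : 0 < e1 / 2 by rewrite divr_gt0.
have [n0 h] := psd_continuous sa a0 auM aw e20.
have [n1 _ h1] := near_infty_natSinv_lt (PosNum e20).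
have := h (maxn n0 n1) (leq_maxl _ _); rewrite ler_distl => /andP[_] /le_trans; apply.
rewrite {2}(splitr e1) addrA lerD2r; apply: le_trans (auE _) _; rewrite lerD2l.
exact: ltW (h1 _ (leq_maxr _ _)).
Qed.

(* The first [n] eigenpairs, for the minimax principle: the last clause is the variational
   characterization of [m k], the first two alone do not exclude skipped eigenvalues. *)
Definition spectral n (e : nat -> V) (m : nat -> R) :=
  [/\ forall i k, (i < n)%N -> (k < n)%N -> b (e i) (e k) = (i == k)%:R,
      forall k v, (k < n)%N -> a (e k) v = m k * b (e k) v
    & forall k v, (k < n)%N -> (forall i, (i < k)%N -> b v (e i) = 0) ->
        m k * b v v <= a v v].

Lemma spectral_exists n : (forall p, exists u : 'I_p -> V, independent b u) ->
  exists e m, spectral n e m.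
Proof.
move=> inf; elim: n => [|n [e [m [be ae me]]]]; first by exists (fun=> 0), (fun=> 0); split.
have [aC aD aZ] := sa; have [bC bD bZ] := sb.
have [u iu] := inf n.+1.
have [c [v1 ve]] := independent_orthogonal (fun i : 'I_n => e i) sb b0 iu (ltnSn n).
have [w [m' [w1 we awm mle]]] := minimizer v1 ve.
have wei i : (i < n)%N -> b w (e i) = 0 by move=> i_n; exact: (we (Ordinal i_n)).
(* [minimizer] gives the equation only against vectors orthogonal to the [e i]. The projection [p]
   contributes [0] to both sides, because the [e i] are eigenvectors orthogonal to [w]. *)
have weig v : a w v = m' * b w v.
  pose p := \sum_(i < n) b v (e i) *: e i.
  have bp (i : 'I_n) : b (v - p) (e i) = 0.
    rewrite symformBl// (symform_orthonormal (e := fun i : 'I_n => e i)) ?subrr// => k l.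
    by rewrite be.
  have ap : a w p = 0.
    rewrite aC symform_suml//; apply: big1 => i _.
    by rewrite aZ ae// (bC (e i)) wei// !mulr0.
  have bwp : b w p = 0.
    by rewrite bC symform_suml//; apply: big1 => i _; rewrite bZ (bC (e i)) wei// mulr0.
  have := awm _ bp; rewrite aC symformBl// bC symformBl//.
  by rewrite (aC p) ap (bC p) bwp !subr0 aC (bC v).
exists (fun i => if (i < n)%N then e i else w), (fun i => if (i < n)%N then m i else m').
have ltSE k : (k < n.+1)%N -> (k < n)%N \/ k = n.
  by rewrite ltnS leq_eqVlt => /orP[/eqP|]; [right|left].
split.
- move=> i k /ltSE[i_n|->] /ltSE[kn|->].
  + by rewrite i_n kn be.
  + by rewrite i_n ltnn bC wei// ltn_eqF.
  + by rewrite kn ltnn wei// gtn_eqF.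
  + by rewrite ltnn w1 eqxx.
- by move=> k v /ltSE[kn|->]; rewrite ?kn ?ltnn//; exact: ae.
- move=> k v /ltSE[kn|->] h.
    rewrite kn; apply: me => // i ik.
    by have := h i ik; rewrite (ltn_trans ik kn).
  by rewrite ltnn; apply: mle => i; have := h i (ltn_ord i); rewrite ltn_ord.
Qed.

End minmax.

(** * Matching a given list of eigenvalues with the minimax values *)

Lemma count_mem_size_le (T : eqType) (s t : seq T) :
  (forall x, count_mem x s <= count_mem x t)%N -> (size s <= size t)%N.
Proof.
move=> /count_subseqP[r rt /perm_size ->]; exact: size_subseq.
Qed.

Section eigenvalues.
Context {R : realType} {V : lmodType R}.
Variables a b : V -> V -> R.
Hypotheses (sa : symform a) (sb : symform b).
Hypotheses (a0 : forall v, 0 <= a v v) (b0 : forall v, 0 <= b v v).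

Definition eigvec nu u := forall v, a u v = nu * b u v.

Definition eigmult nu M := exists f : 'I_M -> V,
  [/\ forall i, eigvec nu (f i), independent b f &
      forall u, eigvec nu u -> exists c : 'I_M -> R,
        b (u - \sum_i c i *: f i) (u - \sum_i c i *: f i) = 0].

Lemma eigvec_sum nu p (u : 'I_p -> V) c : (forall i, eigvec nu (u i)) ->
  eigvec nu (\sum_i c i *: u i).
Proof.
move=> hu v; have [_ _ aZ] := sa; have [_ _ bZ] := sb.
rewrite !symform_suml// mulr_sumr; apply: eq_bigr => i _.
by rewrite aZ bZ hu mulrCA.
Qed.

Lemma spectral_le n e m k l : spectral a b n e m -> (k <= l)%N -> (l < n)%N -> m k <= m l.
Proof.
move=> [be ae me] kl ln; have := me k (e l) (leq_ltn_trans kl ln).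
rewrite ae// be// eqxx !mulr1; apply => i ik.
have il := leq_trans ik kl; by rewrite be ?(gtn_eqF il)// (ltn_trans il ln).
Qed.

(** More than [M] orthonormal eigenvectors for [nu] would have a unit combination orthogonal to a
    family spanning the eigenspace, hence to itself. *)
Lemma eigmult_ge n e m nu M : spectral a b n e m -> eigmult nu M ->
  (count_mem nu [seq m k | k <- iota 0 n] <= M)%N.
Proof.
move=> [be ae me] [f [fe fi fs]]; rewrite leqNgt; apply/negP.
rewrite count_map -size_filter; set s := seq.filter _ _ => ps.
have su : uniq s by rewrite filter_uniq// iota_uniq.
have sP i : (i < size s)%N -> (nth 0 s i < n)%N /\ m (nth 0 s i) = nu.
  move=> /(mem_nth 0); rewrite mem_filter mem_iota add0n => /andP[/eqP ->].
  by [].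
pose u (i : 'I_(size s)) := e (nth 0 s i).
have uo i j : b (u i) (u j) = (i == j)%:R.
  by rewrite be ?(sP _ (ltn_ord _)).1// nth_uniq.
have [c [w1 wf]] := independent_orthogonal f sb b0 (orthonormal_independent sb b0 uo) ps.
set w := \sum_i _ in w1 wf.
have wE : eigvec nu w.
  apply: eigvec_sum => i v; have [si mi] := sP i (ltn_ord i).
  by rewrite ae// mi.
have [d wd] := fs w wE.
have := psd_null w sb b0 wd; have [bC bD bZ] := sb.
rewrite bC symformBl// w1 symform_suml// big1 ?subr0 => [/eqP|i _]; first by rewrite oner_eq0.
by rewrite bZ bC wf mulr0.
Qed.

(** Otherwise some unit eigenvector for [nu] is orthogonal to all [e i] with [m i = nu], and to the
    other [e i] because their eigenvalues differ. The variational clause at [n] would then give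
    [m n <= nu]. *)
Lemma eigmult_le n e m nu M : spectral a b n.+1 e m -> eigmult nu M -> nu < m n ->
  (M <= count_mem nu [seq m k | k <- iota 0 n])%N.
Proof.
move=> [be ae me] [f [fe fi fs]] num; rewrite leqNgt; apply/negP.
rewrite count_map -size_filter; set s := seq.filter _ _ => ps.
have [bC bD bZ] := sb.
have [c [w1 wf]] := independent_orthogonal (fun i : 'I_(size s) => e (nth 0 s i)) sb b0 fi ps.
set w := \sum_i _ in w1 wf.
have we : eigvec nu w by exact: eigvec_sum.
have := me n w (ltnSn n); rewrite we w1 !mulr1 leNgt num => h.
suff : false by []. apply: h => i i_n.
have [mi|mi] := eqVneq (m i) nu.
  have is_ : i \in s by rewrite mem_filter /= mi eqxx mem_iota.
  have := wf (Ordinal (etrans (index_mem i s) is_)) => /=.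
  by rewrite nth_index.
have iS := leqW i_n.
have := ae i w iS; have [aC _ _] := sa; rewrite aC we bC => /eqP.
by rewrite -subr_eq0 -mulrBl mulf_eq0 subr_eq0 eq_sym (negPf mi) => /eqP.
Qed.

Definition eigseq (l : nat -> R) :=
  [/\ forall i j, (0 < i <= j)%N -> l i <= l j,
      forall j, (0 < j)%N -> exists2 u, eigvec (l j) u & b u u != 0
    & forall nu, (exists2 u, eigvec nu u & b u u != 0) -> exists2 M, eigmult nu M &
        ([set j | (0 < j)%N /\ l j = nu] #= `I_M)%card].

Lemma card_seq (s : seq nat) : ([set` s] #= `I_(size (undup s)))%card.
Proof.
rewrite (_ : [set` s] = nth 0%N (undup s) @` `I_(size (undup s))).
  apply: inj_card_eq => i k /[!inE] /= hi hk /eqP.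
  by rewrite nth_uniq// ?undup_uniq// => /eqP.
apply/seteqP; split => [x /= xs|x [i /= hi <-]]; last by rewrite /= -mem_undup mem_nth.
exists (index x (undup s)); first by rewrite /= index_mem mem_undup.
by rewrite nth_index// mem_undup.
Qed.

(** [l] is numbered from 1 and [m] from 0. If the values differed, the first [n.+1] terms of the
    list with the smaller value would occur, with multiplicity, among the first [n] terms of the
    other. *)
Lemma eigseqE l n e m : eigseq l -> spectral a b n.+1 e m -> l n.+1 = m n.
Proof.
move=> [lmon lev lmult] sp; have [be ae me] := sp.
have szm p : size [seq m k | k <- iota 0 p] = p by rewrite size_map size_iota.
have szl p : size [seq l k | k <- iota 1 p] = p by rewrite size_map size_iota.
apply/eqP; rewrite eq_le; apply/andP; split; rewrite leNgt; apply/negP => h.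
  have := @count_mem_size_le _ [seq m k | k <- iota 0 n.+1] [seq l k | k <- iota 1 n].
  rewrite szm szl ltnn => H; suff: false by []. apply: H => nu.
  have [->//|] := posnP (count_mem nu [seq m k | k <- iota 0 n.+1]).
  rewrite -has_count => /hasP[x /mapP[k + ->{x}]]; rewrite mem_iota add0n => /= kn /eqP knu.
  have [|M Mm Mc] := lmult nu.
    by exists (e k); [move=> v; rewrite ae// knu|rewrite be// eqxx oner_eq0].
  apply: leq_trans (eigmult_ge sp Mm) _.
  rewrite count_map -size_filter; apply: leq_trans (size_undup _).
  rewrite -card_le_II -(card_le_eql Mc) -(card_le_eqr (card_seq _)); apply: subset_card_le.
  move=> j [j0 lj] /=; rewrite mem_filter /= lj eqxx mem_iota j0 add1n /= ltnNge.
  apply/negP => nj; have := lmon n.+1 j; rewrite nj => /(_ isT).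
  rewrite leNgt lj => /negP; apply; apply: le_lt_trans h.
  by rewrite -knu; apply: spectral_le sp _ _.
have := @count_mem_size_le _ [seq l k | k <- iota 1 n.+1] [seq m k | k <- iota 0 n].
rewrite szm szl ltnn => H; suff: false by []. apply: H => nu.
have [->//|] := posnP (count_mem nu [seq l k | k <- iota 1 n.+1]).
rewrite -has_count => /hasP[x /mapP[k + ->{x}]]; rewrite mem_iota => /andP[k0 kn] /eqP knu.
have [|M Mm Mc] := lmult nu; first by rewrite -knu; exact: lev.
have numn : nu < m n.
  by rewrite -knu; apply: le_lt_trans h; apply: lmon; rewrite k0.
apply: leq_trans (eigmult_le sp Mm numn).
rewrite count_map -size_filter -[seq.filter _ _]undup_id; last by rewrite filter_uniq// iota_uniq.
rewrite -card_le_II -(card_le_eqr Mc) -(card_le_eql (card_seq _)); apply: subset_card_le.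
move=> j h1; have {h1} : j \in seq.filter _ _ := h1.
by rewrite mem_filter mem_iota => /andP[/eqP lj /andP[j0 _]].
Qed.

End eigenvalues.

(* [w] is taken in the span of the first [n.+1] eigenvectors of [a], orthogonal to the
   first [n] eigenvectors of [a']. *)
Lemma spectral_compare (R : realType) (V : lmodType R) (a a' b : V -> V -> R) n e m e' m' :
  symform a -> symform b -> (forall v, 0 <= b v v) ->
  spectral a b n.+1 e m -> spectral a' b n.+1 e' m' ->
  exists w, [/\ b w w = 1, a w w <= m n & m' n <= a' w w].
Proof.
move=> sa sb b0 sp [be' ae' me']; have [be ae me] := sp.
pose u (i : 'I_n.+1) := e i.
have uo i j : b (u i) (u j) = (i == j)%:R by rewrite be.
have [c [w1 we]] := independent_orthogonal (fun i : 'I_n => e' i) sb b0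
  (orthonormal_independent sb b0 uo) (ltnSn n).
set w := \sum_i _ in w1 we; exists w; split => //; last first.
  have := me' n w (ltnSn n); rewrite w1 mulr1; apply => i i_n.
  exact: (we (Ordinal i_n)).
have [aC aD aZ] := sa; have [bC bD bZ] := sb.
have bw i : b w (u i) = c i by exact: symform_orthonormal.
have b1 : \sum_i c i ^+ 2 = 1.
  rewrite -w1 [in RHS]/w symform_suml//; apply: eq_bigr => i _.
  by rewrite bZ bC bw expr2.
rewrite [leLHS](_ : _ = \sum_(i < n.+1) m i * c i ^+ 2).
  rewrite -[m n]mulr1 -b1 mulr_sumr; apply: ler_sum => i _.
  by rewrite ler_wpM2r ?sqr_ge0// (spectral_le sp)// -ltnS.
rewrite [in LHS]/w symform_suml//; apply: eq_bigr => i _.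
by rewrite aZ ae// -/w -/(u i) (bC (u i)) bw expr2 mulrCA.
Qed.

(** The upper bound in the minimax principle, by a unit combination of trial vectors orthogonal to
    the first [n] eigenvectors. *)
Lemma spectral_test (R : realType) (V : lmodType R) (a b : V -> V -> R) n e m (u : 'I_n.+1 -> V) :
  symform b -> (forall v, 0 <= b v v) -> spectral a b n.+1 e m -> independent b u ->
  exists c : 'I_n.+1 -> R, let w := \sum_i c i *: u i in b w w = 1 /\ m n <= a w w.
Proof.
move=> sb b0 [be ae me] iu.
have [c [w1 we]] := independent_orthogonal (fun i : 'I_n => e i) sb b0 iu (ltnSn n).
exists c; split => //; have := me n _ (ltnSn n) (fun i i_n => we (Ordinal i_n)).
by rewrite w1 mulr1.
Qed.

Lemma symform_linear (R : realType) (V : lmodType R) (q : V -> V -> R) :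
  (forall u v, q u v = q v u) ->
  (forall c u v w, q (c *: u + v) w = c * q u w + q v w) -> symform q.
Proof.
move=> C L; have Z0 w : q 0 w = 0.
  by have := L (-1) 0 0 w; rewrite scaler0 addr0 mulN1r addNr.
split=> // [u v w|c u w]; first by have := L 1 u v w; rewrite scale1r mul1r.
by have := L c u 0 w; rewrite addr0 Z0 addr0.
Qed.

(** * The Neumann problem on the Sobolev space *)

Section sobolev_space.
Context {R : realType} {N : nat}.
Local Notation rV := 'rV[R]_N.
Variable Omega : set rV.
Hypothesis oO : open Omega.
Local Notation H2 := (sobolev Omega 2).

Let mO : measurable Omega. Proof. exact: open_rV_measurable. Qed.

(* The proof [oO] is a phantom argument, from which the module structure is inferred. *)
Definition sobolev2_pred (_ : open Omega) : {pred (rV -> R^o)} := fun u => `[< H2 u >].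

Lemma sobolev2_submod : GRing.submod_closed (sobolev2_pred oO).
Proof.
split; first by apply/asboolP; exact: sobolev0.
move=> c u v /asboolP hu /asboolP hv; apply/asboolP; exact: sobolev_lin.
Qed.

End sobolev_space.

HB.instance Definition _ (R : realType) (N : nat) (Omega : set 'rV[R]_N) (oO : open Omega) :=
  GRing.isSubmodClosed.Build R ('rV[R]_N -> R^o) (sobolev2_pred oO)
    (sobolev2_submod oO).

Record sobolev2 (R : realType) (N : nat) (Omega : set 'rV[R]_N) (oO : open Omega) :=
  Sobolev2 { sobolev2_val :> 'rV[R]_N -> R^o; sobolev2_valP : sobolev2_val \in sobolev2_pred oO }.

HB.instance Definition _ (R : realType) (N : nat) (Omega : set 'rV[R]_N) (oO : open Omega) :=
  [isSub for @sobolev2_val R N Omega oO].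
HB.instance Definition _ (R : realType) (N : nat) (Omega : set 'rV[R]_N) (oO : open Omega) :=
  [Choice of sobolev2 oO by <:].
HB.instance Definition _ (R : realType) (N : nat) (Omega : set 'rV[R]_N) (oO : open Omega) :=
  [SubChoice_isSubLmodule of sobolev2 oO by <:].

(** * The Neumann problem in terms of symmetric forms *)

Section neumann_forms.
Context {R : realType} {N : nat}.
Local Notation rV := 'rV[R]_N.
Local Notation mu := (lebesgue_rV (R := R) N).
Variable Omega : set rV.
Hypothesis oO : open Omega.
Local Notation sqO := (sqint mu Omega).
Local Notation ipO := (ip mu Omega).
Local Notation W s u := (wderiv Omega s u).
Local Notation H2 := (sobolev Omega 2).
Local Notation V := (sobolev2 oO).

Let mO : measurable Omega. Proof. exact: open_rV_measurable. Qed.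

Lemma sobolev2P (u : V) : H2 u. Proof. by have /asboolP := sobolev2_valP u. Qed.

Lemma sobolev2_eval c (u v : V) : sobolev2_val (c *: u + v) = (fun x => c * u x + v x).
Proof. by []. Qed.

Definition mk2 (u : rV -> R) (hu : H2 u) : V := Sobolev2 (asboolT hu).

Definition l2_form (u v : V) := ipO u v.

Definition neumann2 sigma (u v : V) := neumann_form Omega sigma u v.

Lemma l2_symform : symform l2_form.
Proof.
apply: symform_linear => [u v|c u v w]; first exact: ipC.
have hu := sobolev_sqO (sobolev2P u); have hv := sobolev_sqO (sobolev2P v).
have hw := sobolev_sqO (sobolev2P w).
rewrite /l2_form sobolev2_eval ipDl// ?ipZl//; exact: sqintZ.
Qed.

Lemma eq_ae_ipl u u' v : sqO u -> sqO u' -> sqO v -> ae_eq_on Omega u u' -> ipO u v = ipO u' v.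
Proof. by move=> [m1 _] [m2 _] [m3 _]; exact: eq_ae_ip. Qed.

Lemma d2_symform : symform (fun u v : V => d2form Omega u v).
Proof.
apply: symform_linear => [u v|c u v w].
  by apply: eq_bigr => i _; apply: eq_bigr => j _; exact: ipC.
have hu := sobolev2P u; have hv := sobolev2P v; have hw := sobolev2P w.
rewrite /d2form mulr_sumr -big_split; apply: eq_bigr => i _ /=.
rewrite mulr_sumr -big_split; apply: eq_bigr => j _ /=.
have su := W_sqO i j hu; have sv := W_sqO i j hv; have sw := W_sqO i j hw.
rewrite -ipZl// -ipDl//; last exact: sqintZ.
apply: eq_ae_ipl => //; last exact: (wderiv_lin oO c hu hv).
  exact: W_sqO (sobolev2P (c *: u + v)).
by apply: sqintD => //; exact: sqintZ.
Qed.

Lemma lap_symform : symform (fun u v : V => ipO (lap Omega u) (lap Omega v)).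
Proof.
apply: symform_linear => [u v|c u v w]; first exact: ipC.
have hu := sobolev2P u; have hv := sobolev2P v; have hw := sobolev2P w.
have su := lap_sqO oO hu; have sv := lap_sqO oO hv; have sw := lap_sqO oO hw.
rewrite -ipZl// -ipDl//; last exact: sqintZ.
apply: eq_ae_ipl => //.
- exact: lap_sqO (sobolev2P (c *: u + v)).
- by apply: sqintD => //; exact: sqintZ.
rewrite /lap sobolev2_eval.
have H (r : seq 'I_N) : ae_eq_on Omega
    (fun x => \sum_(i <- r) W [:: i; i] (fun x => c * u x + v x) x)
    (fun x => c * (\sum_(i <- r) W [:: i; i] u x) + \sum_(i <- r) W [:: i; i] v x).
  elim: r => [|i r IH]; first by apply: aeW => x _; rewrite !big_nil mulr0 addr0.
  have hi : ae_eq_on Omega (W [:: i; i] (fun x => c * u x + v x))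
      (fun x => c * W [:: i; i] u x + W [:: i; i] v x) by exact: (wderiv_lin oO c hu hv).
  apply: filterS2 IH hi => x h1 h2 xO.
  by rewrite !big_cons h1// h2//; ring.
exact: H.
Qed.

Lemma ip0l (g : rV -> R) : ipO (fun=> 0) g = 0.
Proof.
by rewrite /ip; under eq_Rintegral do rewrite mul0r; rewrite Rintegral_cst// mul0r.
Qed.

Lemma symform_comb (c d : R) (q q' : V -> V -> R) : symform q -> symform q' ->
  symform (fun u v => c * q u v + d * q' u v).
Proof.
move=> [C D Z] [C' D' Z']; split=> [u v|u v w|k u w].
- by rewrite C C'.
- by rewrite D D'; ring.
- by rewrite Z Z'; ring.
Qed.

Lemma neumann2E sigma (u v : V) : neumann2 sigma u v =
  (1 - sigma) * d2form Omega u v + sigma * ipO (lap Omega u) (lap Omega v).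
Proof. by rewrite /neumann2 neumann_formE//; exact: sobolev2P. Qed.

Lemma neumann_symform sigma : symform (neumann2 sigma).
Proof.
have -> : neumann2 sigma = (fun u v : V =>
    (1 - sigma) * d2form Omega u v + sigma * ipO (lap Omega u) (lap Omega v)).
  by apply/funext => u; apply/funext => v; exact: neumann2E.
exact: symform_comb d2_symform lap_symform.
Qed.

(** Cauchy-Schwarz on the [N] diagonal entries of the Hessian, then the diagonal is dominated by all
    entries. *)
Lemma lap_le_d2form (u : V) : ipO (lap Omega u) (lap Omega u) <= N%:R * d2form Omega u u.
Proof.
have hu := sobolev2P u; pose F i : rV -> R := W [:: i; i] u.
have hF i : sqO (F i) by exact: W_sqO.
have nF : nrm mu Omega (lap Omega u) <= \sum_i nrm mu Omega (F i).
  rewrite /lap.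
  have H (r : seq 'I_N) : nrm mu Omega (fun x => \sum_(i <- r) F i x) <= \sum_(i <- r) nrm mu Omega (F i).
    elim: r => [|i r IH].
      rewrite (_ : (fun x => _) = fun=> 0); last by apply/funext => x; rewrite big_nil.
      by rewrite big_nil /nrm ip0l sqrtr0.
    rewrite big_cons (_ : (fun x => _) = fun x => F i x + \sum_(i <- r) F i x); last first.
      by apply/funext => x; rewrite big_cons.
    apply: le_trans (nrmD _ _ _) _ => //; first exact: sqint_sum.
    by rewrite lerD2l.
  exact: H.
rewrite -sqr_nrm.
apply: (@le_trans _ _ ((\sum_i nrm mu Omega (F i)) ^+ 2)).
  rewrite lerXn2r// nnegrE ?sqrtr_ge0//; apply: sumr_ge0 => i _; exact: sqrtr_ge0.
apply: le_trans (sqr_sum_le _) _; rewrite card_ord ler_wpM2l//.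
apply: ler_sum => i _; rewrite sqr_nrm (bigD1 i)//= lerDl.
by apply: sumr_ge0 => j _; exact: ip_ge0.
Qed.

Section sigma.
Variable sigma : R.
Hypothesis sigma01 : 0 <= sigma < 1.

Let s0 : 0 <= sigma. Proof. by case/andP: sigma01. Qed.
Let s1 : 0 < 1 - sigma. Proof. by rewrite subr_gt0; case/andP: sigma01. Qed.

Lemma d2form_le_neumann (u : V) : (1 - sigma) * d2form Omega u u <= neumann2 sigma u u.
Proof. by rewrite neumann2E lerDl mulr_ge0// ip_ge0. Qed.

Lemma neumann_le_d2form (u : V) : neumann2 sigma u u <= (1 + N%:R) * d2form Omega u u.
Proof.
rewrite neumann2E [leRHS]mulrDl mul1r; apply: lerD.
  rewrite -[leRHS]mul1r.
  by rewrite ler_wpM2r ?d2form_ge0// gerBl.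
apply: le_trans (lap_le_d2form u); rewrite ler_piMl ?ip_ge0//.
by case/andP: sigma01 => _ /ltW.
Qed.

Lemma neumann_ge0 (u : V) : 0 <= neumann2 sigma u u.
Proof. by apply: le_trans (d2form_le_neumann u); rewrite mulr_ge0 ?d2form_ge0// ltW. Qed.

Lemma l2_form_ge0 (u : V) : 0 <= l2_form u u. Proof. exact: ip_ge0. Qed.

Hypothesis bO : bounded_set Omega.
Hypothesis cO : forall x, closure Omega x -> cone_at Omega x.

Lemma sobolev2_sub (u v : V) : sobolev2_val (u - v) = (fun x => u x - v x).
Proof. by []. Qed.

(** For a fixed [sigma < 1] the form lies between [1 - sigma] and [1 + N] times [d2form], so
    completeness transfers from [H2_complete]. *)
Lemma neumann_complete (u : nat -> V) :
  (forall e, 0 < e -> exists n0, forall m n, (n0 <= m)%N -> (n0 <= n)%N ->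
    neumann2 sigma (u m - u n) (u m - u n) + l2_form (u m - u n) (u m - u n) <= e) ->
  exists w, forall e, 0 < e -> exists n0, forall n, (n0 <= n)%N ->
    neumann2 sigma (u n - w) (u n - w) + l2_form (u n - w) (u n - w) <= e.
Proof.
move=> uC.
have s1' : 1 <= (1 - sigma)^-1 by rewrite invf_ge1// gerBl.
have [n|e e0|w hw uw] := @H2_complete R N Omega oO bO cO (fun n => u n).
- exact: sobolev2P.
- have [n0 h] := uC ((1 - sigma) * e) (mulr_gt0 s1 e0); exists n0 => m n mn nn.
  have := h m n mn nn; have := d2form_le_neumann (u m - u n).
  rewrite /l2_form sobolev2_sub; set d := fun x => _ => h1 h2.
  rewrite -(ler_pM2l s1); apply: le_trans h2; rewrite mulrDr lerD//.
  by rewrite ler_piMl ?ip_ge0// gerBl.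
exists (mk2 hw) => e e0; have N1 : 0 < 1 + N%:R :> R by rewrite ltr_wpDr.
have [n0 h] := uw (e / (1 + N%:R)) (divr_gt0 e0 N1); exists n0 => n nn.
have := h n nn; rewrite ler_pdivlMr// mulrC mulrDr; apply: le_trans.
apply: lerD; first exact: neumann_le_d2form.
by rewrite ler_peMl ?l2_form_ge0// lerDl.
Qed.

Lemma neumann_compact e : 0 < e -> exists (fs : seq (bounded_functional l2_form)) (C : R),
  0 <= C /\ forall u, l2_form u u <= e * neumann2 sigma u u + C * \sum_(f <- fs) sval f u ^+ 2.
Proof.
move=> e0; have [psis [C [C0 hC]]] := H2_poincare oO bO cO (mulr_gt0 e0 s1).
have P (psi : testfun Omega) : exists f : bounded_functional l2_form, sval f = (fun u : V => ipO u (sval psi)).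
  have tp := test_sqO oO (svalP psi).
  have h : (forall u v : V, ipO (u - v) (sval psi) = ipO u (sval psi) - ipO v (sval psi)) /\
      exists2 K, 0 <= K & forall u : V, ipO u (sval psi) ^+ 2 <= K * l2_form u u.
    split=> [u v|].
      by rewrite sobolev2_sub ipBl//; apply: sobolev_sqO; exact: sobolev2P.
    exists (ipO (sval psi) (sval psi)); first exact: ip_ge0.
    by move=> u; rewrite mulrC; apply: ip_CS => //; apply: sobolev_sqO; exact: sobolev2P.
  by exists (exist _ (fun u : V => ipO u (sval psi)) h).
have /choice[F FE] := P.
exists [seq F psi | psi <- psis], C; split => // u.
apply: le_trans (hC u (sobolev2P u)) _; rewrite big_map.
under [X in _ <= _ + _ * X]eq_bigr => psi _ do rewrite FE.
rewrite lerD2r -mulrA; apply: ler_wpM2l (d2form_le_neumann u); exact: ltW.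
Qed.

End sigma.
(** The link between null vectors of the abstract theory and equality almost everywhere in the
    definitions of eigenvalue and multiplicity. *)
Lemma l2_form_eq0 (u : V) : l2_form u u = 0 <-> ae_eq_on Omega u (fun=> 0).
Proof.
have su := sobolev_sqO (sobolev2P u); split; first exact: ip_eq0.
move=> u0; rewrite /l2_form (eq_ae_ipl su (sqint0 mu Omega) su u0); exact: ip0l.
Qed.

Lemma eigenspaceE sigma nu (u : V) :
  Defs.eigenspace Omega sigma nu u <-> eigvec (neumann2 sigma) l2_form nu u.
Proof.
split=> [[_ h] v|h]; first exact: h (sobolev2P v).
by split=> [|v hv]; [exact: sobolev2P|exact: (h (mk2 hv))].
Qed.

Lemma sobolev2_sum n (c : 'I_n -> R) (u : 'I_n -> V) :
  sobolev2_val (\sum_i c i *: u i) = (fun x => \sum_i c i * u i x).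
Proof.
have H (r : seq 'I_n) : sobolev2_val (\sum_(i <- r) c i *: u i) = (fun x => \sum_(i <- r) c i * u i x).
  elim: r => [|i r IH]; first by apply/funext => x; rewrite !big_nil.
  rewrite big_cons sobolev2_eval IH; apply/funext => x.
  by rewrite big_cons.
exact: H.
Qed.

Lemma eigenvalueE sigma nu : Defs.eigenvalue Omega sigma nu <->
  exists2 u, eigvec (neumann2 sigma) l2_form nu u & l2_form u u != 0.
Proof.
split=> [[u eu u0]|[u /eigenspaceE eu u0]].
  have [hu _] := eu; exists (mk2 hu); first exact/eigenspaceE.
  by apply/eqP => /l2_form_eq0.
by exists u => // /l2_form_eq0/eqP; exact/negP.
Qed.

Lemma multiplicityE sigma nu M : multiplicity Omega sigma nu M ->
  eigmult (neumann2 sigma) l2_form nu M.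
Proof.
move=> [f [fe fi fs]]; have fH i : H2 (f i) by have [] := fe i.
exists (fun i => mk2 (fH i)); split.
- by move=> i; apply/eigenspaceE; exact: fe.
- by move=> c /l2_form_eq0; rewrite sobolev2_sum; exact: fi.
- move=> u /eigenspaceE/fs[c hc]; exists c; apply/l2_form_eq0.
  rewrite sobolev2_sub sobolev2_sum; apply: filterS hc => x h xO.
  by rewrite h// subrr.
Qed.

Lemma eigenvalue_sequence_eigseq sigma l : eigenvalue_sequence Omega sigma l ->
  eigseq (neumann2 sigma) l2_form l.
Proof.
move=> [h1 h2 h3]; split=> // [j /h2 /eigenvalueE//|nu /eigenvalueE/h3[M /multiplicityE]].
by exists M.
Qed.

End neumann_forms.

(** * Exponential harmonic functions *)

Section harmonic.
Context {R : realType} {N : nat}.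
Local Notation rV := 'rV[R]_N.
Local Notation mu := (lebesgue_rV (R := R) N).
Local Notation e_ i := (unit_rV (R := R) i).

(** For [c = 1] and [s = 0], the real part of a complex exponential in [x_p + i x_q]. Keeping both
    coefficients makes the family stable under derivation; for [p != q] the second derivatives along
    [p] and [q] are opposite. The [+ 0] fits the pattern of [is_derive_comp_coord]. *)
Definition harmonic (p q : 'I_N) (k d c s : R) (x : rV) : R :=
  expR (k * x 0 p + 0) * (c * cos (k * x 0 q + d) + s * sin (k * x 0 q + d)).

Lemma is_derive_cos_sin (c s t : R) :
  is_derive t 1 (fun x => c * cos x + s * sin x) (s * cos t + - c * sin t).
Proof.
have := is_deriveD (is_deriveZ c (is_derive_cos t)) (is_deriveZ s (is_derive_sin t)).
by move=> h; apply: (is_derive_eq h); rewrite /GRing.scale /=; ring.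
Qed.

Lemma derive_harmonic (p q i : 'I_N) (k d c s : R) :
  'D_(e_ i) (harmonic p q k d c s) =
  harmonic p q k d (k * ((i == p)%:R * c + (i == q)%:R * s))
    (k * ((i == p)%:R * s - (i == q)%:R * c)).
Proof.
apply/funext => x.
have h1 : derivable (@expR R) (k * x 0 p + 0) 1 by exact: derivable_expR.
have h2 : derivable (fun x => c * cos x + s * sin x) (k * x 0 q + d) 1.
  by have [] := is_derive_cos_sin c s (k * x 0 q + d).
have := is_deriveM (is_derive_comp_coord (e_ i) h1) (is_derive_comp_coord (e_ i) h2).
have [_ ->] := is_derive_expR (k * x 0 p + 0).
have [_ ->] := is_derive_cos_sin c s (k * x 0 q + d).
move=> [_ E]; rewrite [LHS]E.
rewrite /harmonic !mxE !eqxx /= /GRing.scale /= !(eq_sym _ i); ring.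
Qed.

Lemma class_C_harmonic n p q k d c s : class_C n (harmonic p q k d c s).
Proof.
apply: class_C_M; first exact: (@class_C_comp_coord R N n (@expR R) k 0 p (smooth1_expR n)).
exact: (@class_C_comp_coord R N n (fun x => c * cos x + s * sin x) k d q (smooth1_cos_sin n c s)).
Qed.

Lemma harmonicZ p q k d a c s x : harmonic p q k d (a * c) (a * s) x = a * harmonic p q k d c s x.
Proof. by rewrite /harmonic; ring. Qed.

Lemma derive2_harmonic (p q i : 'I_N) (k d c s : R) : p != q ->
  'D_(e_ i) ('D_(e_ i) (harmonic p q k d c s)) =
  harmonic p q k d (k ^+ 2 * ((i == p)%:R - (i == q)%:R) * c)
    (k ^+ 2 * ((i == p)%:R - (i == q)%:R) * s).
Proof.
move=> pq; rewrite derive_harmonic; apply: etrans; first exact: derive_harmonic.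
have [ip|ip] := eqVneq i p; have [iq|iq] := eqVneq i q;
  by [move: pq; rewrite -ip -iq eqxx|congr harmonic; rewrite /=; ring].
Qed.

Lemma laplace_harmonic (p q : 'I_N) (k d c s : R) (x : rV) : p != q ->
  \sum_i 'D_(e_ i) ('D_(e_ i) (harmonic p q k d c s)) x = 0.
Proof.
move=> pq; rewrite (eq_bigr (fun i => k ^+ 2 * harmonic p q k d c s x * (i == p)%:R -
    k ^+ 2 * harmonic p q k d c s x * (i == q)%:R)); last first.
  move=> i _; have -> := congr1 (fun f => f x) (derive2_harmonic i k d c s pq).
  by rewrite harmonicZ; ring.
have S a (j : 'I_N) : \sum_i a * (i == j)%:R = a :> R.
  rewrite (bigD1 j)//= eqxx mulr1 big1 ?addr0// => i /negPf ->.
  by rewrite mulr0.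
by rewrite sumrB !S subrr.
Qed.

(** Otherwise [f] would be nonzero on a nonempty open set, which has positive measure. *)
Lemma continuous_ae_eq0 (Omega : set rV) (f : rV -> R) : open Omega -> continuous f ->
  ae_eq_on Omega f (fun=> 0) -> forall x, Omega x -> f x = 0.
Proof.
move=> oO cf f0 x xO; apply/eqP; apply: contraT => fx.
pose U := Omega `&` f @^-1` [set y | y != 0].
have oU : open U by apply: openI => //; apply: open_comp => //; exact: open_neq.
have := lebesgue_rV_open_gt0 oU (conj xO fx).
have [Z [mZ Z0 UZ]] := f0.
have : (mu U <= mu Z)%E.
  apply: le_measure; rewrite ?inE//; first exact: open_rV_measurable.
  by move=> y [yO fy]; apply: UZ => /(_ yO) /eqP; rewrite (negPf fy).
by rewrite Z0 => h1 /(lt_le_trans)/(_ h1); rewrite ltxx.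
Qed.

Lemma poly_infinite_roots (P : {poly R}) (z : nat -> R) : injective z ->
  (forall m, P.[z m] = 0) -> P = 0.
Proof.
move=> zi zP; apply/eqP; apply: contraT => P0.
have := max_poly_roots (rs := [seq z m | m <- iota 0 (size P)]) P0.
rewrite size_map size_iota ltnn map_inj_uniq// iota_uniq => h; apply: h => //.
by apply/allP => _ /mapP[m _ ->]; apply/rootP.
Qed.

(** The phase is chosen to vanish on the line through [y] in direction [p]. There the combination is
    the polynomial with coefficients [c i] at [exp (y_p + t)], and it has infinitely many roots. *)
Lemma harmonic_independent (Omega : set rV) (y : rV) (p q : 'I_N) n (c : 'I_n -> R) :
  open Omega -> Omega y -> p != q ->
  ae_eq_on Omega (fun x => \sum_i c i * harmonic p q i%:R (- (i%:R * y 0 q)) 1 0 x) (fun=> 0) ->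
  forall i, c i = 0.
Proof.
move=> oO yO pq h.
have cH : continuous (fun x => \sum_i c i * harmonic p q i%:R (- (i%:R * y 0 q)) 1 0 x).
  apply/class_C0; elim: (index_enum _) => [|i l IH].
    by under eq_fun do rewrite big_nil; exact: class_C_cst.
  under eq_fun do rewrite big_cons; apply: class_C_D => //.
  exact: class_C_Z (class_C_harmonic _ _ _ _ _ _ _).
have h0 := continuous_ae_eq0 oO cH h.
have /nbhs_ballP[r /= r0 rO] : nbhs y Omega by exact: open_nbhs_nbhs.
(* Distinct values, all below [r] already for [m = 0]. *)
pose t m : R := r / m.+2%:R.
pose z m := expR (y 0 p + t m).
pose P : {poly R} := \sum_(i < n) c i *: 'X^i.
have P0 : P = 0.
  apply: (@poly_infinite_roots _ z).
    move=> m m' /expR_inj /addrI /(mulfI (lt0r_neq0 r0)) /invr_inj /eqP.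
    by rewrite eqr_nat => /eqP[].
  move=> m; rewrite -(h0 (y + t m *: e_ p)).
    rewrite horner_sum; apply: eq_bigr => i _.
    rewrite hornerZ hornerXn /harmonic !mxE eqxx (eq_sym q) (negPf pq) /=.
    rewrite mulr0 !addr0 subrr cos0 sin0 !(mulr1, mulr0, mul1r, addr0, mul0r).
    by rewrite eqxx mulr1 expRM_natl.
  apply: rO; rewrite -ball_normE /= opprD addrA subrr add0r normrN.
  have tm : 0 <= t m < r.
    by rewrite divr_ge0 ?ltW//= ltr_pdivrMr// ltr_pMr// ltr1n.
  case/andP: tm => tm0 tmr; apply: le_lt_trans tmr; apply: norm_rV_le => // i.
  by rewrite !mxE eqxx /=; case: eqP; rewrite ?mulr1 ?mulr0 ?normr0// ger0_norm.
move=> i; have := congr1 (fun P : {poly R} => P`_i) P0.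
rewrite coef0 coef_sum (bigD1 i)//= coefZ coefXn eqxx mulr1 big1 ?addr0// => j ji.
have /negPf ij : (i != j :> nat) by rewrite eq_sym.
by rewrite coefZ coefXn ij mulr0.
Qed.

Lemma lap_harmonic (Omega : set rV) (p q : 'I_N) (k d c s : R) : open Omega -> bounded_set Omega -> p != q ->
  sobolev Omega 2 (harmonic p q k d c s) /\
  ae_eq_on Omega (lap Omega (harmonic p q k d c s)) (fun=> 0).
Proof.
move=> oO bO pq; set h := harmonic _ _ _ _ _ _.
have [hH _ w2] := sobolev_smooth oO bO (class_C_harmonic 2 p q k d c s).
split => //.
have hW i : ae_eq_on Omega (wderiv Omega [:: i; i] h) ('D_(e_ i) ('D_(e_ i) h)).
  apply: wderivE => //.
  rewrite derive2_harmonic//.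
  by have [/sobolev_sqO] := sobolev_smooth oO bO (class_C_harmonic 2 p q k d
    (k ^+ 2 * ((i == p)%:R - (i == q)%:R) * c) (k ^+ 2 * ((i == p)%:R - (i == q)%:R) * s)).
have : {ae mu, forall x, forall i, Omega x -> wderiv Omega [:: i; i] h x = 'D_(e_ i) ('D_(e_ i) h) x}.
  exact: filter_forall.
apply: filterS => x hx xO; apply: etrans (laplace_harmonic k d c s x pq).
by apply: eq_bigr => i _; exact: hx.
Qed.

End harmonic.

(** A substitute for Gram-Schmidt: each new vector is a unit combination of [n.+1] independent
    vectors, orthogonal to the [n] vectors already found. [P] is asked of all combinations so that
    it passes to the new vector. *)
Lemma orthonormal_family (R : realType) (V : lmodType R) (b : V -> V -> R) (P : V -> Prop) :
  symform b -> (forall v, 0 <= b v v) ->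
  (forall n, exists2 u : 'I_n -> V, independent b u &
    forall c : 'I_n -> R, P (\sum_i c i *: u i)) ->
  forall n, exists e : nat -> V, forall i k, (i < n)%N -> (k < n)%N ->
    P (e i) /\ b (e i) (e k) = (i == k)%:R.
Proof.
move=> sb b0 inf; have [bC _ _] := sb; elim=> [|n [e he]]; first by exists (fun=> 0).
have [u iu Pu] := inf n.+1.
have [c [w1 we]] := independent_orthogonal (fun i : 'I_n => e i) sb b0 iu (ltnSn n).
have := Pu c; set w := \sum_i _ in w1 we * => Pw.
have wei i : (i < n)%N -> b w (e i) = 0 by move=> i_n; exact: (we (Ordinal i_n)).
exists (fun i => if (i < n)%N then e i else w) => i k.
have ltSE l : (l < n.+1)%N -> l = n \/ (l < n)%N.
  by rewrite ltnS leq_eqVlt => /orP[/eqP|]; [left|right].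
move=> /ltSE[->|i_n] /ltSE[->|kn].
- by rewrite ltnn w1 eqxx.
- by rewrite ltnn kn wei// gtn_eqF.
- by rewrite ltnn i_n bC wei// (ltn_eqF i_n); have [] := he i i i_n i_n.
- by rewrite i_n kn; exact: he.
Qed.

(** * Dependence of the eigenvalues on [sigma] *)

Section lipschitz.
Context {R : realType} {N : nat}.
Local Notation rV := 'rV[R]_N.
Local Notation mu := (lebesgue_rV (R := R) N).
Variables (Omega : set rV) (oO : open Omega).
Hypothesis bO : bounded_set Omega.
Hypothesis cO : forall x, closure Omega x -> cone_at Omega x.
Variables (y : rV) (p q : 'I_N).
Hypotheses (yO : Omega y) (pq : p != q).
Local Notation ipO := (ip mu Omega).
Local Notation V := (sobolev2 oO).
Local Notation b := (@l2_form R N Omega oO).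
Local Notation a := (@neumann2 R N Omega oO).

Let A (u v : V) := d2form Omega u v.
Let L (u v : V) := ipO (lap Omega u) (lap Omega v).
Let sA : symform A := d2_symform oO.
Let sL : symform L := lap_symform oO.
Let L0 v : 0 <= L v v. Proof. exact: ip_ge0. Qed.

Let sb : symform b := l2_symform oO.
Let b0 : forall v, 0 <= b v v := @l2_form_ge0 R N Omega oO.

Lemma harmonic_family n : exists2 u : 'I_n -> V, independent b u &
  forall c : 'I_n -> R, L (\sum_i c i *: u i) (\sum_i c i *: u i) = 0.
Proof.
pose h i := harmonic p q i%:R (- (i%:R * y 0 q)) 1 0.
have hH i := lap_harmonic i%:R (- (i%:R * y 0 q)) 1 0 oO bO pq.
exists (fun i : 'I_n => mk2 oO (hH i).1) => c.
  move=> /l2_form_eq0; rewrite sobolev2_sum.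
  exact: harmonic_independent.
have [LC LD LZ] := sL.
rewrite symform_suml//; apply: big1 => i _; rewrite LZ LC (@psd_null _ _ L) ?mulr0//.
have hl := lap_sqO oO (hH i).1.
by rewrite /L (eq_ae_ipl oO hl (sqint0 mu Omega) hl (hH i).2) ip0l.
Qed.

Lemma neumann_spectral sigma n : 0 <= sigma < 1 ->
  exists e m, spectral (a sigma) b n e m.
Proof.
move=> s01; have inf n' : exists u : 'I_n' -> V, independent b u.
  by have [u iu _] := harmonic_family n'; exists u.
exact (@spectral_exists _ _ _ _ (neumann_symform oO sigma) sb (@neumann_ge0 _ _ _ oO _ s01) b0
  (@neumann_complete _ _ _ oO _ s01 bO cO) (@neumann_compact _ _ _ oO _ s01 bO cO) n inf).
Qed.

Lemma eigenvalue_ge0 sigma l j : 0 <= sigma < 1 -> eigenvalue_sequence Omega sigma l ->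
  0 <= l j.+1.
Proof.
move=> s01 /(eigenvalue_sequence_eigseq oO) hl.
have [e [m sp]] := neumann_spectral j.+1 s01.
have -> := eigseqE (neumann_symform oO sigma) sb b0 hl sp; have [be ae _] := sp.
have := neumann_ge0 s01 (e j).
by rewrite ae// be// eqxx mulr1.
Qed.

Lemma eigenvalue_le j : exists2 C, 0 <= C & forall sigma l, 0 <= sigma < 1 ->
  eigenvalue_sequence Omega sigma l -> l j.+1 <= C * (1 - sigma).
Proof.
have [f hf] := orthonormal_family (P := fun v => L v v = 0) sb b0 harmonic_family j.+1.
pose u (i : 'I_j.+1) := f i.
have uo i k : b (u i) (u k) = (i == k)%:R by have [] := hf i k (ltn_ord i) (ltn_ord k).
have u0 i : L (u i) (u i) = 0 by have [] := hf i i (ltn_ord i) (ltn_ord i).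
(* A unit combination of orthonormal vectors has coefficients at most [1] in absolute value, so this
   sum bounds [A] on all of them; it depends on [j] but not on [sigma]. *)
exists (\sum_i \sum_k `|A (u i) (u k)|).
  by apply: sumr_ge0 => i _; apply: sumr_ge0.
move=> sigma l s01 /(eigenvalue_sequence_eigseq oO) hl.
have [e [m sp]] := neumann_spectral j.+1 s01.
rewrite (eigseqE (neumann_symform oO sigma) sb b0 hl sp).
have iu := orthonormal_independent sb b0 uo.
have [c [w1 mw]] := spectral_test sb b0 sp iu; apply: le_trans mw _.
set w := \sum_i c i *: u i in w1 *.
have c1 i : `|c i| <= 1.
  have -> : c i = b w (u i) by rewrite /w (symform_orthonormal _ _ sb).
  rewrite -(@ler_pXn2r _ 2)// ?nnegrE// expr1n real_normK ?num_real//.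
  apply: le_trans (symform_CS _ _ sb b0) _.
  by rewrite w1 uo eqxx mulr1.
have [LC LD LZ] := sL.
have Lw : L w w = 0.
  rewrite {1}/w symform_suml//.
  by apply: big1 => i _; rewrite LZ LC (@psd_null _ _ L) ?mulr0.
rewrite neumann2E -/(L w w) -/(A w w) Lw mulr0 addr0 mulrC.
have s1 : 0 <= 1 - sigma by rewrite subr_ge0 ltW//; case/andP: s01.
apply: ler_wpM2r => //; have [AC AD AZ] := sA.
have -> : A w w = \sum_i \sum_k c i * c k * A (u i) (u k).
  rewrite {1}/w symform_suml//; apply: eq_bigr => i _.
  rewrite AZ AC {1}/w symform_suml// mulr_sumr; apply: eq_bigr => k _.
  by rewrite AZ AC mulrA.
apply: ler_sum => i _; apply: ler_sum => k _; apply: le_trans (ler_norm _) _.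
rewrite !normrM ler_piMl// -[leRHS]mulr1; exact: ler_pM.
Qed.

Lemma eigenvalue_lipschitz j : exists2 C, 0 <= C & forall sigma tau l l',
  0 <= sigma -> sigma <= tau -> tau < 1 ->
  eigenvalue_sequence Omega sigma l -> eigenvalue_sequence Omega tau l' ->
  `|l j.+1 - l' j.+1| <= C * (tau - sigma).
Proof.
have [C C0 hC] := eigenvalue_le j.
(* The constant is the bound on [Lw] below; it also exceeds the bound [C] on [Aw] used for the
   converse inequality. *)
exists (2 * (1 + N%:R) * C); first by rewrite !mulr_ge0.
move=> sigma tau l l' s0 st t1 hl hl'.
have s01 : 0 <= sigma < 1 by rewrite s0 (le_lt_trans st).
have t01 : 0 <= tau < 1 by rewrite t1 (le_trans s0).
have [e [m sp]] := neumann_spectral j.+1 s01.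
have [e' [m' sp']] := neumann_spectral j.+1 t01.
have lC := hC _ _ s01 hl; have lC' := hC _ _ t01 hl'; move: lC lC'.
rewrite (eigseqE (neumann_symform oO sigma) sb b0 (eigenvalue_sequence_eigseq oO hl) sp).
rewrite (eigseqE (neumann_symform oO tau) sb b0 (eigenvalue_sequence_eigseq oO hl') sp').
move=> lC lC'; have d0 : 0 <= tau - sigma by rewrite subr_ge0.
have N0 : 0 <= N%:R :> R by [].
rewrite ler_distl; apply/andP; split.
  have [w [_ w1 w2]] := spectral_compare (neumann_symform oO sigma) sb b0 sp sp'.
  rewrite lerBlDr; apply: le_trans w2 _; move: w1; rewrite !neumann2E.
  have := lap_le_d2form w; have := d2form_ge0 Omega w; have := L0 w.
  rewrite -/(A w w) -/(L w w); move: (A w w) (L w w) => Aw Lw L0' A0 LA w1.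
  have X1 : 0 <= (1 - sigma) * Aw by rewrite mulr_ge0//; lra.
  have X2 : 0 <= sigma * Lw by rewrite mulr_ge0.
  have X3 : 0 <= sigma * C by rewrite mulr_ge0.
  have X4 : 0 <= N%:R * C by rewrite mulr_ge0.
  have LC : Lw <= 2 * (1 + N%:R) * C.
    (* The term [sigma * Lw] of the form controls [Lw] only away from [sigma = 0]; for smaller
       [sigma] the Hessian term bounds [Aw], and [LA] passes to [Lw]. *)
    have [s2|s2] := leP (1 / 2) sigma.
      have X5 : 0 <= (sigma - 1 / 2) * Lw by rewrite mulr_ge0// subr_ge0.
      by clear LA; lra.
    have X5 : 0 <= (1 / 2 - sigma) * Aw by rewrite mulr_ge0// subr_ge0 ltW.
    have A2 : Aw <= 2 * C by lra.
    have X6 := ler_wpM2l N0 A2; lra.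
  have X5 := ler_wpM2l d0 LC; have X6 := mulr_ge0 d0 A0; lra.
have [w [_ w1 w2]] := spectral_compare (neumann_symform oO tau) sb b0 sp' sp.
apply: le_trans w2 _; move: w1; rewrite !neumann2E.
have := d2form_ge0 Omega w; have := L0 w.
rewrite -/(A w w) -/(L w w); move: (A w w) (L w w) => Aw Lw L0' A0 w1.
have t1' : 0 < 1 - tau by rewrite subr_gt0.
have X1 : 0 <= tau * Lw by rewrite mulr_ge0//; case/andP: t01.
have AC : Aw <= C by rewrite -(ler_pM2l t1'); lra.
have X2 := ler_wpM2l d0 AC; have X3 := mulr_ge0 d0 L0'.
have X4 : 0 <= (tau - sigma) * (N%:R * C) by rewrite !mulr_ge0.
have X5 := mulr_ge0 d0 C0; lra.
Qed.

End lipschitz.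

Theorem theorem3p1 (R : realType) (N : nat) (alpha : R) (Omega : set 'rV[R]_N)
    (lambda : nat -> R -> R)
    (hN : (2 <= N)%N)
    (halpha : 0 < alpha < 1)
    (Omega_reg : domain_of_class 4 alpha Omega)
    (Omega_bounded : bounded_set Omega)
    (hlambda : forall sigma : R, 0 <= sigma < 1 ->
      eigenvalue_sequence Omega sigma (fun j => lambda j sigma)) :
  forall j : nat, (1 <= j)%N ->
    lambda j sigma @[sigma --> 1^'-] --> (0 : R) /\
    [lipschitz (if (sigma : R) == 1 then 0 else lambda j sigma)
      | sigma in `[0, 1]%classic].
Proof.
case=> // j _.
have [[oO _] _] := Omega_reg.
have cO x : closure Omega x -> cone_at Omega x by exact: cone_at_closure Omega_reg.
pose p : 'I_N := Ordinal (ltnW hN); pose q : 'I_N := Ordinal hN.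
have pq : p != q by [].
(* On an empty [Omega] every function vanishes almost everywhere, which excludes the eigenfunction
   for [sigma = 0]. *)
have [y yO] : exists y, Omega y.
  have h0 : 0 <= (0 : R) < 1 by rewrite lexx ltr01.
  have [_ /(_ 1%N isT) [u _ u0] _] := hlambda 0 h0.
  apply: contrapT => /forallNP Oempty; apply: u0.
  by apply: aeW => x /Oempty.
have [C C0 hC] := eigenvalue_le oO Omega_bounded cO yO pq j.
have [K K0 hK] := eigenvalue_lipschitz oO Omega_bounded cO yO pq j.
have lC (s : R) : 0 <= s < 1 -> 0 <= lambda j.+1 s <= C * (1 - s).
  move=> s01; rewrite (hC _ _ s01 (hlambda s s01)) andbT.
  exact: (eigenvalue_ge0 oO Omega_bounded cO yO pq j s01 (hlambda s s01)).
split.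
  apply: (@squeeze_cvgr _ _ _ _ (fun=> 0) (fun s : R => C * (1 - s))).
  - near=> s; apply: lC; apply/andP; split; near: s.
      exact: nbhs_left_ge.
    exact: nbhs_left_lt.
  - exact: cvg_cst.
  - rewrite (_ : (0 : R) = C * (1 - 1)); last by rewrite subrr mulr0.
    apply: cvg_at_left_filter; apply: cvgM; first exact: cvg_cst.
    by apply: cvgB; [exact: cvg_cst|exact: cvg_id].
pose f (s : R) := if s == 1 then 0 else lambda j.+1 s.
(* When [t = 1] the decay estimate [C * (1 - s)] is itself the Lipschitz bound; for [t < 1] the
   constant [K] applies. *)
have main (s t : R) : 0 <= s -> s <= t -> t <= 1 -> `|f s - f t| <= (C + K) * (t - s).
  move=> s0 st t1; rewrite /f; have [->|tn1] := eqVneq t 1.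
    have [->|sn1] := eqVneq s 1; first by rewrite !subrr normr0 mulr0.
    have s01 : 0 <= s < 1 by rewrite s0 lt_neqAle sn1 (le_trans st).
    have /andP[l0 lc] := lC s s01; rewrite subr0 ger0_norm//.
    by apply: le_trans lc _; rewrite ler_wpM2r ?lerDl// subr_ge0 (le_trans st).
  have tlt : t < 1 by rewrite lt_neqAle tn1.
  have slt := le_lt_trans st tlt.
  rewrite (lt_eqF slt).
  have s01 : 0 <= s < 1 by rewrite s0.
  have t01 : 0 <= t < 1 by rewrite tlt (le_trans s0).
  apply: le_trans (hK s t _ _ s0 st tlt (hlambda s s01) (hlambda t t01)) _.
  by rewrite ler_wpM2r ?lerDr// subr_ge0.
have PF : ProperFilter (globally (`[0, 1]%classic `*` `[0, 1]%classic : set (R * R))).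
  by apply: (@globally_properfilter _ _ (0, 0)); split; rewrite /= in_itv /= lexx ler01.
apply: (@klipschitzW _ _ _ (C + K)).
move=> [s t] [/= ]; rewrite !in_itv /= => /andP[s0 s1] /andP[t0 t1].
have [st|ts] := leP s t.
  by rewrite (distrC s) [`|t - s|]ger0_norm ?subr_ge0//; exact: main.
rewrite distrC [`|s - t|]ger0_norm ?subr_ge0 ?(ltW ts)//.
by apply: main => //; exact: ltW.
Unshelve. all: by end_near. Qed.
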